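(* Let $M^m$ be a hypersurface with at most two distinct principal curvatures in $N^{m+1}(c)$, a Riemannian manifold of constant sectional curvature $c$. Then $M$ is an $H$-tensional submanifold if and only if it is minimal.
   Context: A Riemannian submanifold $\iota:(M^m,g)\to(N^n,h)$ is a (connected) manifold $M$ together with an isometric immersion $\iota$; it is a hypersurface if $n=m+1$. Its mean curvature vector is $H=\frac1m\operatorname{Tr}_g B=\frac1m\tau(\iota)$, where $B$ is the second fundamental form and $\tau(\iota)=\sum_{i=1}^m\{\nabla^\iota_{e_i}d\iota(e_i)-d\iota(\nabla_{e_i}e_i)\}$ is the tension field ($\{e_i\}$ a local orthonormal frame of $(M,g)$, $\nabla$ the Levi-Civita connection of $(M,g)$, $\nabla^\iota$ the connection on $\iota^{-1}TN$ induced by the Levi-Civita connection of $(N,h)$). $M$ is minimal if $H=0$. The principal curvatures of a hypersurface at a point are the eigenvalues of its shape operator there (with respect to a unit normal); ''at most two distinct principal curvatures'' means at most two distinct eigenvalues at each point. The rough Laplacian on sections $\xi$ of $\iota^{-1}TN$ is $\Delta^\iota\xi=-\sum_{i=1}^m(\nabla^\iota_{e_i}\nabla^\iota_{e_i}\xi-\nabla^\iota_{\nabla_{e_i}e_i}\xi)$. $M$ is called $H$-tensional if $\Delta^\iota\tau(\iota)=0$. *)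

(* Defs.v *)
From mathcomp Require Import all_boot all_order all_algebra.
From mathcomp Require Import all_classical all_reals all_analysis.

Set Implicit Arguments.
Unset Strict Implicit.
Unset Printing Implicit Defensive.

Import Order.TTheory GRing.Theory Num.Theory.
Import numFieldNormedType.Exports.

Local Open Scope classical_set_scope.
Local Open Scope ring_scope.

(* Smooth (C^infinity) maps on an open subset U of R^n.  Values outside U are
   irrelevant: 'D_v f x only depends on the germ of f at x. *)
Section Smooth.
Context {R : realType} {n : nat} {W : normedModType R}.

Fixpoint Ck_on (k : nat) (U : set 'rV[R]_n) (f : 'rV[R]_n -> W) : Prop :=
  match k with
  | 0%N => forall x, U x -> {for x, continuous f}
  | k'.+1 => (forall x, U x -> differentiable f x) /\
             (forall v : 'rV[R]_n, Ck_on k' U (fun x => 'D_v f x))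
  end.

Definition smooth_on (U : set 'rV[R]_n) (f : 'rV[R]_n -> W) : Prop :=
  forall k, Ck_on k U f.

End Smooth.

(* A chart is a homeomorphism cfun from an open set cdom of M onto an open set
   cran of R^n, with inverse cinv; both maps are totalized by arbitrary values. *)
Record chart (R : realType) (n : nat) (M : topologicalType) := Chart {
  cdom : set M;
  cfun : M -> 'rV[R]_n;
  cinv : 'rV[R]_n -> M;
}.

Definition cran {R : realType} {n : nat} {M : topologicalType}
    (phi : chart R n M) : set 'rV[R]_n :=
  cfun phi @` cdom phi.

Definition is_chart {R : realType} {n : nat} {M : topologicalType}
    (phi : chart R n M) : Prop :=
  [/\ open (cdom phi),
      open (cran phi),
      (forall p, cdom phi p -> cinv phi (cfun phi p) = p),
      {within cdom phi, continuous (cfun phi)} &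
      {within cran phi, continuous (cinv phi)}].

Record manifold (R : realType) (n : nat) := Manifold {
  carrier :> topologicalType;
  atlas : set (chart R n carrier);
  manifold_hausdorff : hausdorff_space carrier;
  manifold_second_countable : @second_countable carrier;
  atlas_chart : forall phi, atlas phi -> is_chart phi;
  atlas_cover : forall p : carrier, exists2 phi, atlas phi & cdom phi p;
  atlas_smooth : forall phi psi, atlas phi -> atlas psi ->
    smooth_on (cfun phi @` (cdom phi `&` cdom psi)) (cfun psi \o cinv phi);
}.

(* The value on tangent vectors u, v of the inner product with Gram matrix G. *)
Definition inner {R : realType} {n : nat} (G : 'M[R]_n) (u v : 'rV[R]_n) : R :=
  (u *m G *m v^T) 0 0.

(* A Riemannian metric, given by its components in each chart: gram phi x is
   the matrix of the inner products of the coordinate vectors of phi at the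
   point of coordinates x, and gram_change is the tensor transformation law. *)
Record riemannian_metric (R : realType) (n : nat) (M : manifold R n) := RiemannianMetric {
  gram : chart R n M -> 'rV[R]_n -> 'M[R]_n;
  gram_smooth : forall phi, atlas phi -> forall i j,
    smooth_on (cran phi) (fun x => gram phi x i j);
  gram_sym : forall phi, atlas phi -> forall x, cran phi x ->
    (gram phi x)^T = gram phi x;
  gram_pos : forall phi, atlas phi -> forall x, cran phi x ->
    forall u, u != 0 -> 0 < inner (gram phi x) u u;
  gram_change : forall phi psi, atlas phi -> atlas psi ->
    forall x, (cfun phi @` (cdom phi `&` cdom psi)) x ->
    let t := cfun psi \o cinv phi in
    forall u v,
    inner (gram phi x) u v = inner (gram psi (t x)) ('d t x u) ('d t x v);
}.

(* Local Riemannian geometry, in coordinates.  G : 'rV_n -> 'M_n is the Gram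
   matrix of the metric as a function of the coordinates, and tangent vectors
   are written in the basis of coordinate vectors. *)
Section LeviCivita.
Context {R : realType} {n : nat}.
Implicit Types (G : 'rV[R]_n -> 'M[R]_n) (x u v w : 'rV[R]_n)
  (Y : 'rV[R]_n -> 'rV[R]_n).

Definition gram_deriv G x (i j k : 'I_n) : R :=
  'D_(delta_mx 0 i) (fun y => G y j k) x.

Definition christoffel G x (i j k : 'I_n) : R :=
  2^-1 * \sum_l invmx (G x) k l *
    (gram_deriv G x i j l + gram_deriv G x j i l - gram_deriv G x l i j).

Definition Gamma G x u v : 'rV[R]_n :=
  \row_k \sum_i \sum_j u 0 i * v 0 j * christoffel G x i j k.

(* nabla_u Y at x, for the Levi-Civita connection nabla. *)
Definition nabla G u Y x : 'rV[R]_n := 'D_u Y x + Gamma G x u (Y x).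

(* R(u,v)w = nabla_u nabla_v w - nabla_v nabla_u w, the vectors being extended
   by constant coordinates, so that the term nabla_[u,v] w vanishes. *)
Definition riemann G x u v w : 'rV[R]_n :=
  nabla G u (nabla G v (cst w)) x - nabla G v (nabla G u (cst w)) x.

Definition sectional G x u v : R :=
  inner (G x) (riemann G x u v v) u /
  (inner (G x) u u * inner (G x) v v - inner (G x) u v ^+ 2).

Definition orthonormal_frame G (U : set 'rV[R]_n)
    (e : 'I_n -> 'rV[R]_n -> 'rV[R]_n) : Prop :=
  (forall i, smooth_on U (e i)) /\
  (forall x, U x -> forall i j, inner (G x) (e i x) (e j x) = (i == j)%:R).

End LeviCivita.

(* Local geometry of an immersion F from coordinates on M (metric G) to
   coordinates on N (metric H).  Sections of the pulled-back tangent bundle are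
   maps xi : 'rV_m -> 'rV_n, xi x being a tangent vector at F x. *)
Section Immersion.
Context {R : realType} {m n : nat}.
Variables (G : 'rV[R]_m -> 'M[R]_m) (H : 'rV[R]_n -> 'M[R]_n)
  (F : 'rV[R]_m -> 'rV[R]_n).
Implicit Types (x u v : 'rV[R]_m) (X Y : 'rV[R]_m -> 'rV[R]_m)
  (xi : 'rV[R]_m -> 'rV[R]_n) (e : 'I_m -> 'rV[R]_m -> 'rV[R]_m).

(* the induced connection: nabla^iota_u xi at x *)
Definition pull_nabla u xi x : 'rV[R]_n :=
  'D_u xi x + Gamma H (F x) ('d F x u) (xi x).

(* B(X,Y) = nabla^iota_X dF(Y) - dF(nabla_X Y) *)
Definition second_form X Y x : 'rV[R]_n :=
  pull_nabla (X x) (fun y => 'd F y (Y y)) x - 'd F x (nabla G (X x) Y x).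

Definition tension e x : 'rV[R]_n := \sum_i second_form (e i) (e i) x.

Definition mean_curvature e x : 'rV[R]_n := m%:R^-1 *: tension e x.

Definition rough_laplacian e xi x : 'rV[R]_n :=
  - \sum_i (pull_nabla (e i x) (fun y => pull_nabla (e i y) xi y) x
            - pull_nabla (nabla G (e i x) (e i) x) xi x).

Definition unit_normal x (eta : 'rV[R]_n) : Prop :=
  inner (H (F x)) eta eta = 1 /\
  forall u, inner (H (F x)) eta ('d F x u) = 0.

(* The matrix A of the shape operator u |-> u *m A, i.e. the one such that
   <u *m A, v>_G = <B(u,v), eta>_H for all u and v. *)
Definition shape_operator x (eta : 'rV[R]_n) : 'M[R]_m :=
  (\matrix_(i, j) inner (H (F x))
     (second_form (cst (delta_mx 0 i)) (cst (delta_mx 0 j)) x) eta)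
  *m invmx (G x).

End Immersion.

Definition constant_sectional_curvature {R : realType} {n : nat}
    {N : manifold R n} (h : riemannian_metric N) (c : R) : Prop :=
  forall psi, atlas psi -> forall y, cran psi y ->
  forall u v, row_free (col_mx u v) -> sectional (gram h psi) y u v = c.

Section Submanifold.
Context {R : realType} {m n : nat} {M : manifold R m} {N : manifold R n}.
Variables (g : riemannian_metric M) (h : riemannian_metric N) (iota : M -> N).

Definition local_dom (phi : chart R m M) (psi : chart R n N) : set 'rV[R]_m :=
  cfun phi @` (cdom phi `&` iota @^-1` cdom psi).

Definition local_map (phi : chart R m M) (psi : chart R n N) :
    'rV[R]_m -> 'rV[R]_n :=
  cfun psi \o iota \o cinv phi.

Definition isometric_immersion : Prop :=
  continuous iota /\
  forall phi psi, atlas phi -> atlas psi ->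
  let F := local_map phi psi in
  smooth_on (local_dom phi psi) F /\
  forall x, local_dom phi psi x ->
    injective ('d F x) /\
    forall u v, inner (gram g phi x) u v =
                inner (gram h psi (F x)) ('d F x u) ('d F x v).

(* P holds at every point of M, for all charts around it and its image and
   every local orthonormal frame e around it.  Such frames exist near every
   point (Gram-Schmidt), and the P used below do not depend on the choice. *)
Definition for_local_frames
    (P : ('rV[R]_m -> 'M[R]_m) -> ('rV[R]_n -> 'M[R]_n) ->
         ('rV[R]_m -> 'rV[R]_n) -> ('I_m -> 'rV[R]_m -> 'rV[R]_m) ->
         'rV[R]_m -> Prop) : Prop :=
  forall phi psi, atlas phi -> atlas psi ->
  forall U e, open U -> U `<=` local_dom phi psi ->
  orthonormal_frame (gram g phi) U e ->
  forall x, U x -> P (gram g phi) (gram h psi) (local_map phi psi) e x.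

Definition minimal : Prop :=
  for_local_frames (fun G H F e x => mean_curvature G H F e x = 0).

Definition H_tensional : Prop :=
  for_local_frames (fun G H F e x =>
    rough_laplacian G H F e (tension G H F e) x = 0).

Definition at_most_two_principal_curvatures : Prop :=
  forall phi psi, atlas phi -> atlas psi ->
  let F := local_map phi psi in
  forall x, local_dom phi psi x ->
  forall eta, unit_normal (gram h psi) F x eta ->
  exists k1 k2 : R, forall a,
    eigenvalue (shape_operator (gram g phi) (gram h psi) F x eta) a ->
    a = k1 \/ a = k2.

End Submanifold.

(* Main.v *)
From HB Require Import structures.
Require Import Defs.
From mathcomp Require Import all_boot all_order all_algebra.
From mathcomp Require Import all_classical all_reals.
From mathcomp Require Import interval_inference landau topology normedtype derive realfun.
From mathcomp Require Import complex.
From mathcomp Require Import ring lra.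

Set Implicit Arguments.
Unset Strict Implicit.
Unset Printing Implicit Defensive.

Import Order.TTheory GRing.Theory Num.Theory.
Import numFieldNormedType.Exports.

Local Open Scope ring_scope.

(** A minimal immersion has [tau = 0], so it is H-tensional.  For the converse,
    suppose that the tension field [tau] does not vanish at some point.  Since [tau]
    is normal, it can replace the unit normal on the open set where [Q = |tau|^2] is
    nonzero, so that no square root has to be differentiated.  Write [L = <B, tau>] for
    the second fundamental form paired with [tau], so that [tr L = Q], and let
    [q = grad Q] and [S = |q|^2].

    In an orthonormal frame the equation [Delta tau = 0] splits, thanks to Codazzi,
    into a tangential and a normal part:
      [2 L q = - Q q]   and   [2 Q tr (Hess Q) = 4 Q |L|^2 + S].
    If [q] vanished on an open set where [Q <> 0], the second equation would give
    [L = 0], hence [Q = tr L = 0].  So one may restrict to an open set where both [Q]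
    and [q] are nowhere zero.  There [- Q / 2] is one of the at most two eigenvalues of
    [L], and the trace determines the other one once [|L|^2] is known.  This is the
    polynomial identity
      [(2 L + Q) ((m + 2) Q L - (2 |L|^2 + Q^2)) = 0],
    which holds pointwise and may be differentiated.  Its covariant derivative together
    with Codazzi shows that the eigenvalue [- Q / 2] is simple ([eigen_simple]), so that
    [L] is explicitly determined by [Q] and [q] ([two_curvature_shape]).  Differentiating
    this formula and using Codazzi once more makes [grad S] a multiple [sg q] of [q],
    and [Hess Q] a combination of the metric and [q (x) q] ([hessian_shape]).
    The Ricci identity for [Hess Q], with the curvature given by Gauss, then computes
    [sg] ([ricci_relation]); inserted in the normal equation it yields, with
    [mu = m - 1],
      [3 mu (6 - 2 mu) S + 4 c mu (mu + 3)^2 Q^2 = 3 (mu + 3) (2 mu + 12) Q^3].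
    Differentiating this along [q] and eliminating [S] leaves
      [9 (2 mu + 3) Q + 2 (2 mu - 3) (mu + 3) mu c = 0],
    so [Q] is constant: a contradiction ([nonconstant_impossible]).

    All the differential geometry is carried out in the commutative ring of smooth
    functions on an open set, with its partial derivatives: an algebra with commuting
    derivations and with evaluations at points.  Vectors are rows, and a connection is a
    family of matrices [w a], acting by [v |-> d_a v + v w_a].  The structure equations,
    the change from coordinates to an orthonormal frame, and the pullback of the ambient
    Levi-Civita connection are identities between matrices over this ring.  Evaluations
    at points are used where one divides, or argues with eigenvalues or positivity.
    Analysis enters only through the symmetry of second derivatives and the chain rule,
    and through the passage between maps and elements of this ring. *)

(** * Matrices over a commutative ring *)

(** Proves matrix identities that are linear in the products occurring in them: each
    product is treated as an unknown matrix, and the identity is checked entrywise. *)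
Ltac abel := repeat match goal with |- context [mulmx ?a ?b] =>
  let x := fresh in set x := (mulmx a b); clearbody x end;
  apply/matrixP => ? ?; rewrite !mxE; ring.

(** To deduce [x = y] from [a = b] it suffices to exhibit the factor [t] by which
    the second difference is multiplied; [field] or [ring] then does the rest. *)
Lemma eq_by_scaling (A : pzRingType) (t a b x y : A) :
  a = b -> x - y = t * (a - b) -> x = y.
Proof. by move=> -> /eqP; rewrite subrr mulr0 subr_eq0 => /eqP. Qed.

Lemma scalar_mx_entry (A : pzRingType) m (f : A) (i j : 'I_m) :
  (f%:M : 'M_m) i j = f * (i == j)%:R.
Proof. by rewrite mxE mulr_natr. Qed.

Lemma mulmx_quad (A : comPzRingType) m (u v : 'rV[A]_m) (M : 'M_m) :
  (u *m M *m v^T) 0 0 = \sum_b \sum_k u 0 b * M b k * v 0 k.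
Proof.
rewrite mxE exchange_big /=; apply: eq_bigr => k _.
by rewrite mxE mulr_suml; apply: eq_bigr => b _; rewrite mxE.
Qed.

Lemma mulmx_dot (A : comPzRingType) m (u v : 'rV[A]_m) :
  (u *m v^T) 0 0 = \sum_b u 0 b * v 0 b.
Proof. by rewrite mxE; apply: eq_bigr => b _; rewrite mxE. Qed.

Lemma dot_sym (A : comPzRingType) m (u v : 'rV[A]_m) :
  (u *m v^T) 0 0 = (v *m u^T) 0 0.
Proof. by rewrite !mulmx_dot; apply: eq_bigr => i _; rewrite mulrC. Qed.

Lemma dot_eq0 (R : realDomainType) m (u : 'rV[R]_m) :
  (u *m u^T) 0 0 = 0 -> u = 0.
Proof.
rewrite mulmx_dot => /eqP; rewrite psumr_eq0 => [/allP u0|i _]; last exact: sqr_ge0.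
apply/rowP => i; rewrite mxE.
by have := u0 i (mem_index_enum _); rewrite mulf_eq0 orbb => /eqP.
Qed.

Lemma trmx_add (A : pzRingType) m n (M N : 'M[A]_(m, n)) : (M + N)^T = M^T + N^T.
Proof. exact: linearD. Qed.

Lemma trmx_opp (A : pzRingType) m n (M : 'M[A]_(m, n)) : (- M)^T = - M^T.
Proof. exact: linearN. Qed.

Lemma trmx_scale (A : pzRingType) m n c (M : 'M[A]_(m, n)) : (c *: M)^T = c *: M^T.
Proof. exact: linearZ. Qed.

Lemma outer_entry (A : pzRingType) m (u v : 'rV[A]_m) i j :
  (u^T *m v) i j = u 0 i * v 0 j.
Proof. by rewrite mxE big_ord1 mxE. Qed.

Lemma rank_one_entry (F : fieldType) m (L : 'M[F]_m) (u : 'rV_m) t x y b k :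
  t != 0 -> t *: L = x%:M - y *: (u^T *m u) ->
  L b k = (x * (b == k)%:R - y * (u 0 b * u 0 k)) / t.
Proof.
move=> t0 /(congr1 (fun M : 'M_m => M b k)); move: (outer_entry u u b k).
move: (u^T *m u) => u2 u2E; rewrite !mxE u2E mulr_natr => <-.
by rewrite mulrC mulKf.
Qed.

(** Contraction with three vectors, which turns entrywise identities between tensors such
    as Codazzi's into identities between matrix products. *)
Section Trilinear.
Variables (A : comPzRingType) (m : nat) (u v w : 'rV[A]_m).

Definition trilin (F : 'I_m -> 'I_m -> 'I_m -> A) : A :=
  \sum_a \sum_b \sum_k u 0 a * v 0 b * w 0 k * F a b k.

Lemma trilin_eq F G : (forall a b k, F a b k = G a b k) -> trilin F = trilin G.
Proof.
by move=> FG; apply: eq_bigr => a _; apply: eq_bigr => b _; apply: eq_bigr => k _; rewrite FG.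
Qed.

Lemma trilinB F G : trilin (fun a b k => F a b k - G a b k) = trilin F - trilin G.
Proof.
rewrite -sumrB; apply: eq_bigr => a _; rewrite -sumrB; apply: eq_bigr => b _.
by rewrite -sumrB; apply: eq_bigr => k _; ring.
Qed.

Lemma trilinZ t F : trilin (fun a b k => t * F a b k) = t * trilin F.
Proof.
rewrite mulr_sumr; apply: eq_bigr => a _; rewrite mulr_sumr; apply: eq_bigr => b _.
by rewrite mulr_sumr; apply: eq_bigr => k _; ring.
Qed.

Lemma trilin1 (N : 'I_m -> 'M[A]_m) :
  trilin (fun a b k => N a b k) = \sum_a u 0 a * (v *m N a *m w^T) 0 0.
Proof.
apply: eq_bigr => a _; rewrite mulmx_quad mulr_sumr; apply: eq_bigr => b _.
by rewrite mulr_sumr; apply: eq_bigr => k _; ring.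
Qed.

Lemma trilin2 (N : 'I_m -> 'M[A]_m) :
  trilin (fun a b k => N b a k) = \sum_b v 0 b * (u *m N b *m w^T) 0 0.
Proof.
rewrite /trilin exchange_big; apply: eq_bigr => b _; rewrite mulmx_quad mulr_sumr.
by apply: eq_bigr => a _; rewrite mulr_sumr; apply: eq_bigr => k _; ring.
Qed.

Lemma trilin_prod1 (q : 'rV[A]_m) (L : 'M_m) :
  trilin (fun a b k => q 0 a * L b k) = (u *m q^T) 0 0 * (v *m L *m w^T) 0 0.
Proof.
rewrite mulmx_dot mulmx_quad mulr_suml; apply: eq_bigr => a _.
rewrite mulr_sumr; apply: eq_bigr => b _.
by rewrite mulr_sumr; apply: eq_bigr => k _; ring.
Qed.

Lemma trilin_prod2 (q : 'rV[A]_m) (L : 'M_m) :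
  trilin (fun a b k => q 0 b * L a k) = (v *m q^T) 0 0 * (u *m L *m w^T) 0 0.
Proof.
rewrite mulmx_dot mulmx_quad mulr_suml /trilin exchange_big; apply: eq_bigr => b _.
rewrite mulr_sumr; apply: eq_bigr => a _.
by rewrite mulr_sumr; apply: eq_bigr => k _; ring.
Qed.

Lemma codazzi_contract (N : 'I_m -> 'M[A]_m) (L : 'M_m) (q : 'rV[A]_m) t :
  (forall a b k, t * (N a b k - N b a k) = q 0 a * L b k - q 0 b * L a k) ->
  t * (\sum_a u 0 a * (v *m N a *m w^T) 0 0 -
       \sum_b v 0 b * (u *m N b *m w^T) 0 0) =
  (u *m q^T) 0 0 * (v *m L *m w^T) 0 0 -
  (v *m q^T) 0 0 * (u *m L *m w^T) 0 0.
Proof.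
move=> cod; rewrite -trilin_prod1 -trilin_prod2 -trilinB -trilin1 -trilin2 -trilinB -trilinZ.
exact: trilin_eq.
Qed.

End Trilinear.

(** * Derivations and connection matrices *)

Section MatrixDerivation.
Variables (A : comPzRingType) (d : {additive A -> A}).
Hypothesis dM : forall f g, d (f * g) = d f * g + f * d g.

Lemma deriv1 : d 1 = 0.
Proof. by apply: (addrI (d 1)); rewrite addr0; have := dM 1 1; rewrite !mulr1 mul1r. Qed.

Lemma deriv_nat k : d k%:R = 0.
Proof. by rewrite raddfMn deriv1 mul0rn. Qed.

Lemma derivX f k : d (f ^+ k.+1) = k.+1%:R * f ^+ k * d f.
Proof.
elim: k => [|k IHk]; first by rewrite expr1 expr0; ring.
by rewrite exprS dM IHk (exprS f k); ring.
Qed.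

Lemma map_derivM m n p (M : 'M_(m, n)) (N : 'M_(n, p)) :
  map_mx d (M *m N) = map_mx d M *m N + M *m map_mx d N.
Proof.
apply/matrixP => i j; rewrite !mxE raddf_sum -big_split /=.
by apply: eq_bigr => k _; rewrite !mxE dM.
Qed.

Lemma map_derivZ m n f (M : 'M_(m, n)) :
  map_mx d (f *: M) = d f *: M + f *: map_mx d M.
Proof. by apply/matrixP => i j; rewrite !mxE dM. Qed.

Lemma map_deriv_scalar m f : map_mx d (f%:M : 'M_m) = (d f)%:M.
Proof. by apply/matrixP => i j; rewrite !mxE raddfMn. Qed.

End MatrixDerivation.

Section Covariant.
Variables (A : comPzRingType) (m : nat) (d : {additive A -> A}).
Hypothesis dM : forall f g, d (f * g) = d f * g + f * d g.
Variable w : 'M[A]_m.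

(** With [w] the matrix of a connection in the direction of [d], the rows of [v] are
    differentiated as vectors; [cov_mx] is the induced derivative of endomorphisms
    [v |-> v *m M]. *)
Definition cov_row p (v : 'M[A]_(p, m)) : 'M[A]_(p, m) := map_mx d v + v *m w.
Definition cov_mx (M : 'M[A]_m) : 'M[A]_m := map_mx d M - w *m M + M *m w.

Lemma cov_mxM M N : cov_mx (M *m N) = cov_mx M *m N + M *m cov_mx N.
Proof.
rewrite /cov_mx map_derivM // !mulmxDl !mulmxDr !mulmxN !mulNmx !mulmxA.
abel.
Qed.

Lemma cov_mxD M N : cov_mx (M + N) = cov_mx M + cov_mx N.
Proof. by rewrite /cov_mx map_mxD !mulmxDl !mulmxDr; abel. Qed.

Lemma cov_mxN M : cov_mx (- M) = - cov_mx M.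
Proof. by rewrite /cov_mx map_mxN !mulmxN !mulNmx; abel. Qed.

Lemma cov_mxZ f M : cov_mx (f *: M) = d f *: M + f *: cov_mx M.
Proof. by rewrite /cov_mx map_derivZ // -scalemxAl -scalemxAr; abel. Qed.

Lemma cov_mx_scalar f : cov_mx f%:M = (d f)%:M.
Proof. by rewrite /cov_mx map_deriv_scalar mul_scalar_mx mul_mx_scalar subrK. Qed.

(* the connection is metric in an orthonormal frame *)
Hypothesis wT : w^T = - w.

Lemma trmx_cov_mx M : (cov_mx M)^T = cov_mx M^T.
Proof. by rewrite /cov_mx !linearD !linearN /= !trmx_mul wT map_trmx !mulmxN mulNmx; abel. Qed.

Lemma cov_mx_outer (u v : 'rV_m) : cov_mx (u^T *m v) = (cov_row u)^T *m v + u^T *m cov_row v.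
Proof.
rewrite /cov_mx /cov_row map_derivM // linearD /= trmx_mul wT -map_trmx mulNmx.
by rewrite mulmxDl mulmxDr mulNmx !mulmxA; abel.
Qed.

Lemma deriv_dot (u v : 'rV_m) :
  map_mx d (u *m v^T) = cov_row u *m v^T + u *m (cov_row v)^T.
Proof.
rewrite /cov_row map_derivM // linearD /= trmx_mul wT -map_trmx mulNmx.
by rewrite mulmxDl mulmxDr mulmxN !mulmxA; abel.
Qed.

Lemma mxtrace_cov_mx M : \tr (cov_mx M) = d (\tr M).
Proof.
rewrite /cov_mx !raddfD raddfN /= (mxtrace_mulC w) addrNK.
by rewrite /mxtrace raddf_sum; apply: eq_bigr => i _; rewrite mxE.
Qed.

End Covariant.

(** The directions [d a] need not commute: [s a b k] are the components of the bracket
    of [d a] and [d b]. *)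
Section FrameCurvature.
Variables (A : comPzRingType) (m n : nat) (d : 'I_m -> {additive A -> A}).
Hypothesis dM : forall a f g, d a (f * g) = d a f * g + f * d a g.
Variable s : 'I_m -> 'I_m -> 'I_m -> A.
Hypothesis d_comm : forall a b f,
  d a (d b f) - d b (d a f) = \sum_k s a b k * d k f.
Variable w : 'I_m -> 'M[A]_n.

(** By [cov_row_comm] this is the curvature tensor, acting on rows. *)
Definition frame_curvature a b : 'M[A]_n :=
  map_mx (d a) (w b) - map_mx (d b) (w a) + w b *m w a - w a *m w b -
  \sum_k s a b k *: w k.

Lemma d_comm_mx p r a b (v : 'M[A]_(p, r)) :
  map_mx (d a) (map_mx (d b) v) - map_mx (d b) (map_mx (d a) v) =
  \sum_k s a b k *: map_mx (d k) v.
Proof.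
apply/matrixP => i j; rewrite !mxE d_comm summxE.
by apply: eq_bigr => k _; rewrite !mxE.
Qed.

Lemma cov_row_comm p a b (v : 'M[A]_(p, n)) :
  cov_row (d a) (w a) (cov_row (d b) (w b) v) - cov_row (d b) (w b) (cov_row (d a) (w a) v) -
  \sum_k s a b k *: cov_row (d k) (w k) v = v *m frame_curvature a b.
Proof.
rewrite /frame_curvature mulmxBr mulmx_sumr.
under eq_bigr do rewrite scalerDr scalemxAr.
rewrite big_split -d_comm_mx /= /cov_row !map_mxD !map_derivM // !mulmxDl !(mulmxDr v) !mulmxN
  !mulmxA.
by move: (\sum_k _) => s1; abel.
Qed.

End FrameCurvature.

(** * The shape operator at a point *)

(** Everything here takes place in one tangent space, in an orthonormal basis.  [L] is
    the second fundamental form paired with the tension field, [N a] its covariant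
    derivative in the direction [a], [q] and [Q] are the gradient of the squared length
    of the tension field and that squared length.  [quad] says that [L] has the
    eigenvalue [- (Q / 2)] and at most one other; [quad_deriv] is its covariant
    derivative, [N' a] being the derivative of the second factor. *)
Section Multiplicity.
Variables (R : realFieldType) (m : nat) (L : 'M[R]_m) (N N' : 'I_m -> 'M[R]_m)
  (q : 'rV[R]_m) (Q : R).
Hypothesis Q_gt0 : 0 < Q.
Hypothesis q_neq0 : q != 0.
Hypothesis L_sym : L^T = L.
Hypothesis N_sym : forall a, (N a)^T = N a.
Hypothesis L_tr : \tr L = Q.
Hypothesis L_q : q *m L = (- (Q / 2)) *: q.
Hypothesis codazzi : forall a b k,
  2 * Q * (N a b k - N b a k) = q 0 a * L b k - q 0 b * L a k.
Let Z : R := 2 * \tr (L *m L) + Q ^+ 2.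
Let P : 'M[R]_m := (m.+2%:R * Q) *: L - Z%:M.
Hypothesis quad : (2 *: L + Q%:M) *m P = 0.
Hypothesis quad_deriv : forall a,
  (2 *: N a + (q 0 a)%:M) *m P + (2 *: L + Q%:M) *m N' a = 0.

Let S : R := (q *m q^T) 0 0.
(* [- nu] is the value of [P] on the eigenspace of [L] for [- (Q / 2)] *)
Let nu : R := m.+2%:R * Q ^+ 2 / 2 + Z.

Let S_neq0 : S != 0.
Proof. by apply: contra_neq q_neq0 => /dot_eq0. Qed.

Let nu_neq0 : nu != 0.
Proof.
have tr_ge0 : 0 <= \tr (L *m L).
  rewrite -{2}L_sym /mxtrace sumr_ge0 // => i _.
  by rewrite mxE sumr_ge0 // => j _; rewrite mxE -expr2 sqr_ge0.
have : 0 < m.+2%:R * Q ^+ 2 / 2 :> R.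
  by rewrite !mulr_gt0 ?ltr0n ?exprn_gt0 ?invr_gt0.
have : 0 < Q ^+ 2 by rewrite exprn_gt0.
rewrite /nu /Z => h1 h2; apply: lt0r_neq0; lra.
Qed.

(** For eigenvectors [y] and [w] with eigenvalue [- (Q / 2)] and [y] orthogonal to [q],
    sandwiching [quad_deriv] between [y] and [w] kills its second term, whereas [P]
    multiplies [w] by [- nu <> 0]; hence [<y N_a, w> = - q_a <y, w> / 2].  Codazzi
    applied to [q], [y], [y] then reads [- Q S |y|^2 = - Q S |y|^2 / 2]. *)
Lemma eigen_simple (y : 'rV[R]_m) :
  y *m L = (- (Q / 2)) *: y -> (y *m q^T) 0 0 = 0 -> y = 0.
Proof.
move=> Ly yq.
have yL0 : y *m (2 *: L + Q%:M) = 0.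
  rewrite mulmxDr mul_mx_scalar -scalemxAr Ly scalerA -scalerDl.
  by rewrite (_ : _ + Q = 0) ?scale0r //; lra.
have key (w : 'rV_m) : w *m L = (- (Q / 2)) *: w ->
    forall a, (y *m N a *m w^T) 0 0 = - (q 0 a / 2) * (y *m w^T) 0 0.
  move=> Lw a.
  have Pw : P *m w^T = (- nu) *: w^T.
    rewrite /P mulmxBl mul_scalar_mx -scalemxAl -{1}L_sym -trmx_mul Lw linearZ /=.
    rewrite scalerA -scalerBl; congr (_ *: _); rewrite /nu; lra.
  have /(congr1 (fun M => y *m M *m w^T)) := quad_deriv a.
  rewrite mulmxDr !mulmxA yL0 mul0mx addr0 mulmx0 mul0mx -!mulmxA Pw.
  rewrite -!scalemxAr mulmxDl mulmxDr mul_scalar_mx -scalemxAl -!scalemxAr.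
  move/eqP; rewrite scaler_eq0 oppr_eq0 (negbTE nu_neq0) /= mulmxA.
  move=> /eqP/matrixP/(_ 0 0).
  by rewrite [LHS]mxE [X in X + _]mxE [X in _ + X]mxE [RHS]mxE; lra.
have /(codazzi_contract q y y) := codazzi.
have -> : \sum_a q 0 a * (y *m N a *m y^T) 0 0 = - (S * (y *m y^T) 0 0) / 2.
  rewrite /S mulmx_dot mulr_suml -sumrN mulr_suml; apply: eq_bigr => a _.
  by rewrite key //; lra.
have -> : \sum_b y 0 b * (q *m N b *m y^T) 0 0 = 0.
  rewrite big1 // => b _.
  rewrite (_ : (q *m N b *m y^T) 0 0 = (y *m N b *m q^T) 0 0); last first.
    transitivity ((q *m N b *m y^T)^T 0 0); first by rewrite [RHS]mxE.
    by rewrite 2!trmx_mul trmxK N_sym mulmxA.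
  by rewrite key // yq !mulr0.
rewrite yq mul0r !subr0 -/S Ly -scalemxAl [X in _ = S * X]mxE => h.
apply: dot_eq0; apply: (mulfI (mulf_neq0 S_neq0 (lt0r_neq0 Q_gt0))).
rewrite mulr0; move: h; set t := (_ *m _) 0 0; nra.
Qed.

(** The rows of [P] are eigenvectors of [L] for [- (Q / 2)] by [quad], and by
    [eigen_simple] these are the multiples of [q]. *)
Lemma quad_shape : P = - (nu / S) *: (q^T *m q).
Proof.
have PL : P *m L = (- (Q / 2)) *: P.
  have: P *m (2 *: L + Q%:M) = 0.
    rewrite -[RHS](quad) /P !(mulmxDr, mulmxDl, mulmxN, mulNmx, mul_mx_scalar, mul_scalar_mx).
    by rewrite -!scalemxAl -!scalemxAr; abel.
  rewrite mulmxDr mul_mx_scalar -scalemxAr => /eqP; rewrite addr_eq0 => /eqP h.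
  apply: (@scalerI _ _ 2); first by rewrite pnatr_eq0.
  by rewrite h scalerA -scaleNr; congr (_ *: _); lra.
have Pq : P *m q^T = (- nu) *: q^T.
  rewrite /P mulmxBl mul_scalar_mx -scalemxAl -{1}L_sym -trmx_mul L_q linearZ /=.
  by rewrite scalerA -scalerBl; congr (_ *: _); rewrite /nu; lra.
have qq : q *m q^T = S%:M by rewrite [LHS]mx11_scalar.
apply/eqP; rewrite -subr_eq0 scaleNr opprK; apply/eqP/row_matrixP => i.
rewrite row0; apply: eigen_simple.
  rewrite -row_mul mulmxDl PL -scalemxAl -mulmxA L_q -scalemxAr scalerA [_ * (- _)]mulrC.
  by rewrite -scalerA -scalerDr linearZ.
rewrite -row_mul mulmxDl Pq -scalemxAl -mulmxA qq mul_mx_scalar scalerA.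
by rewrite divfK // scaleNr addNr row0 mxE.
Qed.

(** The trace of [quad_shape] determines [|L|^2]. *)
Lemma quad_tr : (m%:R - 1) * Z = 3 / 2 * m.+2%:R * Q ^+ 2.
Proof.
have := congr1 mxtrace quad_shape.
rewrite /P linearB /= !mxtraceZ L_tr mxtrace_scalar mxtrace_mulC trace_mx11 -/S.
rewrite mulNr divfK // -mulr_natl /nu => h; lra.
Qed.

(** [quad_shape] solved for [L], with the value of [|L|^2] from [quad_tr]; the latter
    also excludes dimension one, as its right-hand side is positive. *)
Lemma two_curvature_shape :
  (2 * (m%:R - 1) * S) *: L = (3 * Q * S)%:M - (m.+2%:R * Q) *: (q^T *m q)
  /\ m%:R - 1 != 0 :> R.
Proof.
have m2 : m.+2%:R != 0 :> R by rewrite pnatr_eq0.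
have Q0 := lt0r_neq0 Q_gt0.
have mu0 : m%:R - 1 != 0 :> R.
  apply/eqP => m1; have := quad_tr; rewrite m1 mul0r => /esym/eqP.
  by rewrite !mulf_eq0 invr_eq0 !pnatr_eq0 (negbTE Q0).
split=> //.
apply/matrixP => i j; have := congr1 (fun M : 'M_m => M i j) quad_shape.
rewrite /P /nu; move: (q^T *m q) => q2;
  rewrite !mxE -[Z *+ _]mulr_natr -[(3 * Q * S) *+ _]mulr_natr.
set dl := (i == j)%:R; set a := m.+2%:R in m2 *; set mu := m%:R - 1 in mu0 * => h.
have ZE : Z = 3 / 2 * a * Q ^+ 2 / mu by rewrite -quad_tr -/mu mulrAC divff ?mul1r.
have am : a = mu + 3 by rewrite /a /mu -addn2 natrD; ring.
have -> : L i j = (Z * dl - (a * Q ^+ 2 / 2 + Z) / S * q2 i j) / (a * Q).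
  apply: (mulfI (mulf_neq0 m2 Q0)).
  by rewrite [RHS]mulrC divfK ?mulf_neq0 // -mulNr -h subrKC.
rewrite ZE am; field.
by rewrite -am m2 mu0 Q0 S_neq0.
Qed.

End Multiplicity.

Lemma sum_lincomb4 (A : comPzRingType) m (q x y z w : 'I_m -> A) a b c d :
  \sum_i q i * (a * x i + b * y i + c * z i + d * w i) =
  a * (\sum_i q i * x i) + b * (\sum_i q i * y i) +
  c * (\sum_i q i * z i) + d * (\sum_i q i * w i).
Proof. by rewrite !mulr_sumr -!big_split /=; apply: eq_bigr => i _; ring. Qed.

Lemma sum_delta (A : comPzRingType) m (q : 'I_m -> A) k :
  \sum_i q i * (i == k)%:R = q k.
Proof.
rewrite (bigD1 k) //= eqxx mulr1 big1 ?addr0 // => i /negbTE->; exact: mulr0.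
Qed.

(** Here [h] is the Hessian of [Q], [s] the gradient of [S], and [shape_deriv] the
    covariant derivative of [shape]; [sg] will be the factor between [s] and [q]. *)
Section HessianShape.
Variables (R : realFieldType) (m : nat) (L h : 'M[R]_m) (N : 'I_m -> 'M[R]_m)
  (q s : 'rV[R]_m) (Q : R).
Let S : R := (q *m q^T) 0 0.
Let mu : R := m%:R - 1.
Hypothesis Q_neq0 : Q != 0.
Hypothesis S_neq0 : S != 0.
Hypothesis mu_neq0 : mu != 0.
Hypothesis h_sym : h^T = h.
Hypothesis sE : s = 2 *: (q *m h).
Hypothesis codazzi : forall a b k,
  2 * Q * (N a b k - N b a k) = q 0 a * L b k - q 0 b * L a k.
Hypothesis shape : (2 * mu * S) *: L = (3 * Q * S)%:M - (m.+2%:R * Q) *: (q^T *m q).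
Hypothesis shape_deriv : forall a,
  (2 * mu) *: (s 0 a *: L + S *: N a) =
  (3 * (q 0 a * S + Q * s 0 a))%:M -
  m.+2%:R *: (q 0 a *: (q^T *m q) + Q *: ((row a h)^T *m q + q^T *m row a h)).

Let sg : R := (q *m s^T) 0 0 / S.

Let m2E : m.+2%:R = mu + 3 :> R.
Proof. by rewrite /mu -addn2 natrD; ring. Qed.

Let m2_neq0 : mu + 3 != 0.
Proof. by rewrite -m2E pnatr_eq0. Qed.

Let shape_entry b k :
  L b k = (3 * Q * S * (b == k)%:R - (mu + 3) * Q * (q 0 b * q 0 k)) / (2 * mu * S).
Proof. by rewrite -m2E; apply: rank_one_entry; rewrite // !mulf_neq0 ?pnatr_eq0. Qed.

(* Codazzi with [N] computed from [shape_deriv] becomes a relation on the Hessian; its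
   contractions with [q], first in [a] and then also in [k], give the two lemmas below. *)
Let codazzi_hess a b k :
  3 / 2 * S * (q 0 a * (b == k)%:R - q 0 b * (a == k)%:R) =
  (mu + 3) * Q * (q 0 b * h a k - q 0 a * h b k -
     (s 0 a * q 0 b - s 0 b * q 0 a) * q 0 k / S).
Proof.
have hqE a' b' k' : ((row a' h)^T *m q + q^T *m row a' h) b' k' =
    h a' b' * q 0 k' + q 0 b' * h a' k'.
  by rewrite !mxE !big_ord1 !mxE.
have NE a' b' k' : N a' b' k' = ((3 * (q 0 a' * S + Q * s 0 a')) * (b' == k')%:R -
   (mu + 3) * (q 0 a' * (q 0 b' * q 0 k') + Q * (h a' b' * q 0 k' + q 0 b' * h a' k'))
   - 2 * mu * (s 0 a' * L b' k')) / (2 * mu * S).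
  have := congr1 (fun M : 'M_m => M b' k') (shape_deriv a').
  move: (outer_entry q q b' k') (hqE a' b' k'); move: (q^T *m q) (_ + _) => q2 hq q2E hqE'.
  rewrite !mxE hqE' q2E -m2E -[X in X - _]mulr_natr.
  move=> e; rewrite -e; field.
  by rewrite S_neq0 mu_neq0.
have := codazzi a b k.
rewrite !NE !shape_entry.
have -> : h b a = h a b by rewrite -{1}h_sym mxE.
rewrite -!(eq_sym k).
set da := (k == a)%:R; set db := (k == b)%:R; set ab := h a b => e.
apply: (eq_by_scaling (t := mu * S / Q) e); field.
by rewrite S_neq0 mu_neq0 Q_neq0.
Qed.

Let sum_qh k : \sum_a q 0 a * h a k = s 0 k / 2.
Proof.
rewrite sE mxE mxE mulrC mulKf ?pnatr_eq0 //.
Qed.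

Let hess_entry b k : S * ((mu + 3) * Q * h b k) =
   (mu + 3) * Q * (q 0 b * s 0 k / 2 - sg * q 0 b * q 0 k + s 0 b * q 0 k)
   - 3 / 2 * S * (S * (b == k)%:R - q 0 b * q 0 k).
Proof.
have SE : \sum_a q 0 a * q 0 a = S by rewrite /S mulmx_dot.
have sgE : \sum_a q 0 a * s 0 a = sg * S by rewrite /sg mulmx_dot divfK.
have : \sum_a q 0 a * (3 / 2 * S * (b == k)%:R * q 0 a +
      (- (3 / 2 * S * q 0 b)) * (a == k)%:R + 0 * q 0 a + 0 * q 0 a) =
    \sum_a q 0 a * (((mu + 3) * Q * q 0 b) * h a k + (- ((mu + 3) * Q * h b k)) * q 0 a
     + (- ((mu + 3) * Q * q 0 b * q 0 k / S)) * s 0 a + ((mu + 3) * Q * s 0 b * q 0 k / S) * q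
       0 a).
  apply: eq_bigr => a _; congr (_ * _).
  by apply: (eq_by_scaling (t := 1) (codazzi_hess a b k)); ring.
rewrite !sum_lincomb4 !SE sgE sum_qh (sum_delta (fun i => q 0 i)) => e.
apply: (eq_by_scaling (t := 1) e); field.
by rewrite S_neq0.
Qed.

Lemma grad_norm_parallel b : s 0 b = sg * q 0 b.
Proof.
have SE : \sum_a q 0 a * q 0 a = S by rewrite /S mulmx_dot.
have sgE : \sum_a q 0 a * s 0 a = sg * S by rewrite /sg mulmx_dot divfK.
have sum_hq : \sum_a q 0 a * h b a = s 0 b / 2.
  rewrite -sum_qh; apply: eq_bigr => a _; congr (_ * _).
  by rewrite -[in RHS]h_sym mxE.
have : \sum_k q 0 k * (S * ((mu + 3) * Q) * h b k + 0 * q 0 k + 0 * q 0 k + 0 * q 0 k) =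
    \sum_k q 0 k * ((mu + 3) * Q * q 0 b / 2 * s 0 k +
      ((mu + 3) * Q * (s 0 b - sg * q 0 b)) * q 0 k
      + (- (3 / 2 * S * S)) * (k == b)%:R + (3 / 2 * S * q 0 b) * q 0 k).
  apply: eq_bigr => k _; congr (_ * _); rewrite (eq_sym k).
  by apply: (eq_by_scaling (t := 1) (hess_entry b k)); field.
rewrite !sum_lincomb4 !SE sgE sum_hq (sum_delta (fun i => q 0 i)) => e.
apply: (eq_by_scaling (t := - 2 / (S * (mu + 3) * Q)) e); field.
by rewrite S_neq0 Q_neq0 m2_neq0.
Qed.

Lemma hessian_shape b k : h b k =
  - (3 * S / (2 * m.+2%:R * Q)) * (b == k)%:R +
  (3 / (2 * m.+2%:R * Q) + sg / (2 * S)) * (q 0 b * q 0 k).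
Proof.
rewrite m2E; apply: (eq_by_scaling (t := 1 / (S * (mu + 3) * Q)) (hess_entry b k)).
rewrite !grad_norm_parallel; field.
by rewrite S_neq0 Q_neq0 m2_neq0.
Qed.

End HessianShape.

(** The coefficient [z] is isolated by taking [q 0 a != 0] and any [b != a] (the
    dimension is not one), and combining the instances [k = a] and [k = b] with weights
    [q 0 b] and [q 0 a], so that [z] gets the factor [q_a^2 + q_b^2]. *)
Lemma wedge_eq0 (R : realFieldType) m (q c : 'rV[R]_m) z :
  m%:R - 1 != 0 :> R -> q != 0 ->
  (forall a b k, z * (q 0 a * (b == k)%:R - q 0 b * (a == k)%:R) +
     (c 0 a * q 0 b - c 0 b * q 0 a) * q 0 k = 0) -> z = 0.
Proof.
move=> m1 q0 E.
have [a qa] : exists a, q 0 a != 0.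
  by have /rV0Pn := q0.
have [b /negbTE ba] : exists b : 'I_m, b != a.
  case: m m1 a {q c q0 E qa} => [|[|m]] m1 a; first by case: a.
    by rewrite subrr eqxx in m1.
  by exists (if a == 0 then lift 0 0 else 0); case: (eqVneq a 0) => [->|]; rewrite 1?eq_sym.
have := E a b b; have := E a b a.
rewrite !eqxx ba (eq_sym a) ba => e1 e2.
have e : q 0 a * (z * (q 0 a * 1 - q 0 b * 0) + (c 0 a * q 0 b - c 0 b * q 0 a) * q 0 b)
  - q 0 b * (z * (q 0 a * 0 - q 0 b * 1) + (c 0 a * q 0 b - c 0 b * q 0 a) * q 0 a) = 0.
  by rewrite e1 e2 !mulr0 subr0.
have : z * (q 0 a ^+ 2 + q 0 b ^+ 2) = 0 by apply: (eq_by_scaling (t := 1) e); ring.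
move=> /eqP; rewrite mulf_eq0 => /orP[/eqP //|].
by rewrite paddr_eq0 ?sqr_ge0 // !expf_eq0 /= (negbTE qa).
Qed.

(** The remaining equations at a point, once [L] and [h] are known in terms of [q] and
    two scalars: the Ricci identity for [h] and the normal part of the equation. *)
Section FinalRelations.
Variables (R : realFieldType) (m : nat) (L h : 'M[R]_m) (M : 'I_m -> 'M[R]_m)
  (q c : 'rV[R]_m) (Q sg c0 : R).
Let S : R := (q *m q^T) 0 0.
Let mu : R := m%:R - 1.
Hypothesis Q_neq0 : Q != 0.
Hypothesis q_neq0 : q != 0.
Hypothesis mu_neq0 : mu != 0.
Hypothesis L_shape : (2 * mu * S) *: L = (3 * Q * S)%:M - (m.+2%:R * Q) *: (q^T *m q).
Hypothesis h_shape : forall b k, h b k =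
  - (3 * S / (2 * m.+2%:R * Q)) * (b == k)%:R +
  (3 / (2 * m.+2%:R * Q) + sg / (2 * S)) * (q 0 b * q 0 k).
(* [M a] is the covariant derivative of the Hessian; this is what differentiating
   the formula for [h] gives *)
Hypothesis h_deriv : forall a,
  (2 * m.+2%:R * (S ^+ 2 + 2 * Q * S * sg) * q 0 a) *: h +
  (2 * m.+2%:R * Q * S ^+ 2) *: M a =
  (- (9 * S ^+ 2 * sg * q 0 a))%:M + c 0 a *: (q^T *m q) +
  (3 * S ^+ 2 + m.+2%:R * Q * sg * S) *: ((row a h)^T *m q + q^T *m row a h).
Hypothesis ricci : forall a b k, M a b k - M b a k =
  - (q 0 b * L a k - q 0 a * L b k) / 2 +
  c0 * (q 0 b * (a == k)%:R - q 0 a * (b == k)%:R).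
Hypothesis normal : 2 * Q * \tr h = 4 * Q * \tr (L *m L) + S.

Let S_neq0 : S != 0.
Proof. by apply: contra_neq q_neq0 => /dot_eq0. Qed.

Let m2E : m.+2%:R = mu + 3 :> R.
Proof. by rewrite /mu -addn2 natrD; ring. Qed.

Let mE : m%:R = mu + 1 :> R.
Proof. by rewrite /mu subrK. Qed.

Let m2_neq0 : mu + 3 != 0.
Proof. by rewrite -m2E pnatr_eq0. Qed.

Let L_entry b k :
  L b k = (3 * Q * S * (b == k)%:R - (mu + 3) * Q * (q 0 b * q 0 k)) / (2 * mu * S).
Proof. by rewrite -m2E; apply: rank_one_entry; rewrite // !mulf_neq0 ?pnatr_eq0. Qed.

(** In the Ricci identity both sides are combinations of
    [q_a delta_bk - q_b delta_ak] and [(c_a q_b - c_b q_a) q_k]; by [wedge_eq0] the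
    coefficients of the former agree. *)
Lemma ricci_relation :
  sg = S / Q * (3 / (mu + 3) + 2) - (mu + 3) * Q ^+ 2 / mu + 4 / 3 * (mu + 3) * Q * c0.
Proof.
pose z := - (9 * S ^+ 2 * sg) + 3 * S / (2 * (mu + 3) * Q) *
  (3 * S ^+ 2 + (mu + 3) * Q * sg * S + 2 * (mu + 3) * (S ^+ 2 + 2 * Q * S * sg))
  - 2 * (mu + 3) * Q * S ^+ 2 * (3 * Q / (4 * mu) - c0).
have z0 : z = 0.
  apply: (@wedge_eq0 R m q c z) => // a b k.
  have hqE a' b' k' : ((row a' h)^T *m q + q^T *m row a' h) b' k' =
      h a' b' * q 0 k' + q 0 b' * h a' k'.
    by rewrite !mxE !big_ord1 !mxE.
  have ME a' b' k' : M a' b' k' = (- (9 * S ^+ 2 * sg * q 0 a') * (b' == k')%:R +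
     c 0 a' * (q 0 b' * q 0 k') + (3 * S ^+ 2 + (mu + 3) * Q * sg * S) *
      (h a' b' * q 0 k' + q 0 b' * h a' k') -
      2 * (mu + 3) * (S ^+ 2 + 2 * Q * S * sg) * q 0 a' * h b' k') /
      (2 * (mu + 3) * Q * S ^+ 2).
    have := congr1 (fun M : 'M_m => M b' k') (h_deriv a').
    move: (outer_entry q q b' k') (hqE a' b' k'); move: (q^T *m q) (_ + _) => q2 hq q2E hqE'.
    rewrite !mxE hqE' q2E m2E -[X in _ = X + _ + _]mulr_natr => e.
    apply: (eq_by_scaling (t := 1 / (2 * (mu + 3) * Q * S ^+ 2)) e); field.
    by rewrite Q_neq0 S_neq0 m2_neq0.
  have := ricci a b k; rewrite !ME !L_entry !h_shape m2E !(eq_sym _ k) (eq_sym b a).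
  move=> e; apply: (eq_by_scaling (t := 2 * (mu + 3) * Q * S ^+ 2) e).
  rewrite /z; field.
  by rewrite Q_neq0 S_neq0 m2_neq0 mu_neq0.
apply: (eq_by_scaling (t := - (2 / (3 * S ^+ 2))) z0); rewrite /z; field.
by rewrite Q_neq0 S_neq0 m2_neq0 mu_neq0.
Qed.

(** The normal equation, where both traces are explicit. *)
Lemma normal_relation : Q * sg - 3 * mu * S / (mu + 3) = Q ^+ 3 * (mu + 9) / mu + S.
Proof.
have qq : \sum_(i < m) q 0 i * q 0 i = S by rewrite /S mulmx_dot.
have trh : \tr h = - (3 * mu * S / (2 * (mu + 3) * Q)) + sg / 2.
  rewrite /mxtrace; under eq_bigr do rewrite h_shape eqxx mulr1.
  rewrite big_split /= sumr_const card_ord -mulr_sumr qq -[X in X + _]mulr_natl m2E mE; field.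
  by rewrite Q_neq0 S_neq0 m2_neq0.
have trL : \tr (L *m L) = Q ^+ 2 * (mu + 9) / (4 * mu).
  have LE : L = (3 * Q / (2 * mu))%:M - ((mu + 3) * Q / (2 * mu * S)) *: (q^T *m q).
    apply/matrixP => b k; rewrite L_entry !mxE big_ord1 !mxE -[_ *+ _]mulr_natr; field.
    by rewrite mu_neq0 S_neq0.
  have trqq : \tr (q^T *m q) = S by rewrite mxtrace_mulC trace_mx11.
  have qqqq : (q^T *m q) *m (q^T *m q) = S *: (q^T *m q).
    rewrite mulmxA -(mulmxA q^T) [q *m q^T]mx11_scalar -/S.
    by rewrite mul_mx_scalar scalemxAl.
  rewrite {}LE mulmxBl !mulmxBr !mul_mx_scalar !mul_scalar_mx -scalemxAl -scalemxAr qqqq.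
  rewrite !linearB /= !mxtraceZ mxtrace_scalar trqq.
  rewrite -[_ *+ m]mulr_natl mE.
  by field; rewrite mu_neq0 S_neq0.
have := normal; rewrite trh trL => e.
apply: (eq_by_scaling (t := 1) e); field.
by rewrite Q_neq0 m2_neq0 mu_neq0.
Qed.

(** Elimination of [sg] between [ricci_relation] and [normal_relation]. *)
Lemma gradient_relation :
  3 * mu * (6 - 2 * mu) * S + 4 * c0 * mu * (mu + 3) ^+ 2 * Q ^+ 2 =
  3 * (mu + 3) * (2 * mu + 12) * Q ^+ 3.
Proof.
have := normal_relation; rewrite ricci_relation => e.
apply: (eq_by_scaling (t := 3 * mu * (mu + 3)) e); field.
by rewrite Q_neq0 m2_neq0 mu_neq0.
Qed.

(** The premise is the derivative of [gradient_relation] along [q].  Expressing [sg] by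
    [ricci_relation] makes it a relation between [S] and [Q], and [gradient_relation]
    eliminates [S]. *)
Lemma constant_relation :
  3 * mu * (6 - 2 * mu) * sg + 8 * c0 * mu * (mu + 3) ^+ 2 * Q =
  9 * (mu + 3) * (2 * mu + 12) * Q ^+ 2 ->
  9 * (2 * mu + 3) * Q + 2 * (2 * mu - 3) * (mu + 3) * mu * c0 = 0.
Proof.
rewrite ricci_relation => e; have := congr1 ( *%R ((3 / (mu + 3) + 2) / Q)) gradient_relation.
move=> /(congr1 (fun t => 3 * mu * (6 - 2 * mu) *
  (S / Q * (3 / (mu + 3) + 2) - (mu + 3) * Q ^+ 2 / mu + 4 / 3 * (mu + 3) * Q * c0)
  + 8 * c0 * mu * (mu + 3) ^+ 2 * Q - t)).
rewrite [in RHS]e => e'; apply: (eq_by_scaling (t := - 1 / (2 * Q)) e'); field.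
by rewrite Q_neq0 m2_neq0 mu_neq0.
Qed.

End FinalRelations.

(** * The contradiction in an orthonormal frame *)

Lemma row_mul_delta (A : pzSemiRingType) m (v : 'rV[A]_m) (i j k : 'I_m) :
  (v *m delta_mx i j) 0 k = v 0 i * (j == k)%:R.
Proof.
rewrite mxE (bigD1 i) //= mxE eqxx big1 => [|l /negbTE li]; last by rewrite mxE li mulr0.
by rewrite addr0 eq_sym.
Qed.

Lemma row_mul_wedge (A : comPzRingType) m (v u w : 'rV[A]_m) (i j k : 'I_m) c :
  (v *m (u^T *m w - w^T *m u + c *: (delta_mx i j - delta_mx j i))) 0 k =
  (v *m u^T) 0 0 * w 0 k - (v *m w^T) 0 0 * u 0 k +
  c * (v 0 i * (j == k)%:R - v 0 j * (i == k)%:R).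
Proof.
have outer (u' w' : 'rV_m) : (v *m (u'^T *m w')) 0 k = (v *m u'^T) 0 0 * w' 0 k.
  by rewrite mulmxA mxE big_ord1.
rewrite mulmxDr mulmxBr -scalemxAr mulmxBr -!row_mul_delta -!outer.
by move: (v *m _) (v *m _) (v *m _) (v *m _) => a b c' e; rewrite !mxE.
Qed.

(** [A] is a ring of functions on [X], with derivations [d a] along an orthonormal frame
    and [g a] the matrices of the Levi-Civita connection in it, so that the bracket of
    [d a] and [d b] has components [g a b k - g b a k].  The hypotheses are the Codazzi
    and Gauss equations in a space of curvature [c0], the two parts of the equation
    [Delta tau = 0], and the identity [quad] expressing the assumption on the principal
    curvatures. *)
Section Frame.
Variables (R : realFieldType) (X : Type) (A : comPzRingType).
Variable ev : X -> {rmorphism A -> R}.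
Hypothesis ev_inj : forall f g, (forall x, ev x f = ev x g) -> f = g.
Variables (m : nat) (d : 'I_m -> {additive A -> A}).
Hypothesis dM : forall a f g, d a (f * g) = d a f * g + f * d a g.
Variables (g : 'I_m -> 'M[A]_m) (L : 'M[A]_m) (Q c0 : A).
Hypothesis g_skew : forall a, (g a)^T = - g a.
Hypothesis d_comm : forall a b f,
  d a (d b f) - d b (d a f) = \sum_k (g a b k - g b a k) * d k f.
Hypothesis d_c0 : forall a, d a c0 = 0.
Hypothesis L_sym : L^T = L.
Hypothesis L_tr : \tr L = Q.

Let q : 'rV[A]_m := \row_a d a Q.
Let S : A := (q *m q^T) 0 0.
Let N a : 'M_m := cov_mx (d a) (g a) L.
Let h : 'M[A]_m := \matrix_(a, k) cov_row (d a) (g a) q 0 k.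

Hypothesis codazzi : forall a b k,
  2 * Q * (N a b k - N b a k) = q 0 a * L b k - q 0 b * L a k.
Hypothesis tangent_eq : 2 *: (q *m L) = - Q *: q.
Hypothesis normal_eq : 2 * Q * \tr h = 4 * Q * \tr (L *m L) + S.
Hypothesis gauss : forall a b,
  Q *: (map_mx (d a) (g b) - map_mx (d b) (g a) + g b *m g a - g a *m g b -
        \sum_k (g a b k - g b a k) *: g k) =
  (row b L)^T *m row a L - (row a L)^T *m row b L +
  (Q * c0) *: (delta_mx b a - delta_mx a b).
Hypothesis quad : (2 *: L + Q%:M) *m
  ((m.+2%:R * Q) *: L - (2 * \tr (L *m L) + Q ^+ 2)%:M) = 0.
Hypothesis Q_gt0 : forall x, 0 < ev x Q.

(* [evE x] pushes the evaluation at [x] through ring operations *)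
Let evE x := (rmorph_nat (ev x), rmorph1 (ev x), rmorphM (ev x), rmorphXn (ev x), rmorphB (ev x),
  rmorphN (ev x), rmorphD (ev x)).

Lemma ev_mx_inj n p (M M' : 'M[A]_(n, p)) :
  (forall x, map_mx (ev x) M = map_mx (ev x) M') -> M = M'.
Proof.
move=> E; apply/matrixP => i j; apply: ev_inj => x.
by have /matrixP/(_ i j) := E x; rewrite !mxE.
Qed.

Lemma row_hess a : row a h = cov_row (d a) (g a) q.
Proof. by apply/rowP => k; rewrite !mxE. Qed.

(** The connection is torsion-free. *)
Lemma hess_sym : h^T = h.
Proof.
apply/matrixP => k a; rewrite !mxE; apply/eqP; rewrite -subr_eq0; apply/eqP.
rewrite opprD addrACA d_comm -sumrB -big_split big1 //= => l _.
have /matrixP/(_ k l) := g_skew a; have /matrixP/(_ a l) := g_skew k.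
by rewrite !mxE => -> ->; ring.
Qed.

Lemma deriv_S a : d a S = (2 *: (q *m h)) 0 a.
Proof.
transitivity ((map_mx (d a) (q *m q^T)) 0 0); first by rewrite mxE.
transitivity (2 * (q *m h^T) 0 a); last by rewrite hess_sym [RHS]mxE.
rewrite (deriv_dot (dM a) (g_skew a)) -row_hess mxE.
have -> : (q *m h^T) 0 a = (q *m (row a h)^T) 0 0.
  by rewrite !mxE; apply: eq_bigr => i _; rewrite !mxE.
by rewrite (dot_sym (row a h)); ring.
Qed.

(** The Ricci identity for the Hessian of [Q], with the curvature given by [gauss]. *)
Lemma ricci a b : Q *: (row b (cov_mx (d a) (g a) h) - row a (cov_mx (d b) (g b) h)) =
  q *m ((row b L)^T *m row a L - (row a L)^T *m row b L +
  (Q * c0) *: (delta_mx b a - delta_mx a b)).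
Proof.
have rowE a' b' : row b' (cov_mx (d a') (g a') h) =
    cov_row (d a') (g a') (cov_row (d b') (g b') q) - row b' (g a') *m h.
  rewrite /cov_mx /cov_row linearD linearB /= !row_mul -map_row !row_hess.
  by rewrite /cov_row; abel.
have sumE a' b' : row b' (g a') *m h = \sum_k g a' b' k *: cov_row (d k) (g k) q.
  by rewrite mulmx_sum_row; apply: eq_bigr => k _; rewrite mxE row_hess.
rewrite -gauss -scalemxAr; congr (_ *: _).
rewrite -[RHS](cov_row_comm dM d_comm) !rowE !sumE.
under [in RHS]eq_bigr do rewrite scalerBl.
by rewrite sumrB; move: (\sum_k _) (\sum_k _) => s1 s2; abel.
Qed.

(** With zero gradient the normal equation says [|L|^2 = 0], but [tr L = Q > 0]. *)
Lemma constant_impossible : X -> q = 0 -> False.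
Proof.
move=> x q0; have h0 : h = 0.
  by apply/matrixP => a k; rewrite mxE q0 /cov_row map_mx0 mul0mx addr0 !mxE.
have S0 : S = 0 by rewrite /S q0 mul0mx mxE.
have Qx := Q_gt0 x; have := congr1 (ev x) normal_eq.
rewrite h0 S0 mxtrace0 mulr0 addr0 rmorph0 => /esym/eqP.
rewrite !(rmorphM (ev x)) (rmorph_nat (ev x)) mulf_eq0 mulf_eq0 pnatr_eq0 (negbTE (lt0r_neq0
  Qx)) /=.
rewrite -trace_map_mx map_mxM -{2}L_sym -map_trmx /mxtrace psumr_eq0 => [/allP L0|i _];
  last first.
  by rewrite mxE sumr_ge0 // => j _; rewrite !mxE -expr2 sqr_ge0.
suff : ev x Q = 0 by move=> Q0; rewrite Q0 ltxx in Qx.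
rewrite -L_tr raddf_sum big1 // => i _.
have := L0 i (mem_index_enum _); rewrite mxE psumr_eq0 => [/allP Li|j _]; last first.
  by rewrite !mxE -expr2 sqr_ge0.
by have := Li i (mem_index_enum _); rewrite !mxE mulf_eq0 orbb => /eqP.
Qed.

Section NonConstant.
Hypothesis S_neq0 : forall x, ev x S != 0.

Let qx x : 'rV[R]_m := map_mx (ev x) q.

Lemma ev_S x : ev x S = (qx x *m (qx x)^T) 0 0.
Proof. by rewrite /qx map_trmx -map_mxM [RHS]mxE. Qed.

Lemma ev_q_neq0 x : qx x != 0.
Proof. by apply: contra_neq (S_neq0 x); rewrite ev_S => ->; rewrite mul0mx mxE. Qed.

Lemma ev_hess_sym x : (map_mx (ev x) h)^T = map_mx (ev x) h.
Proof. by rewrite map_trmx hess_sym. Qed.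

Lemma ev_codazzi x a b k : 2 * ev x Q * (map_mx (ev x) (N a) b k - map_mx (ev x) (N b) a k)
  = qx x 0 a * map_mx (ev x) L b k - qx x 0 b * map_mx (ev x) L a k.
Proof.
have := congr1 (ev x) (codazzi a b k).
rewrite !evE.
by rewrite [qx x 0 a]mxE [qx x 0 b]mxE ![map_mx _ _ _ _]mxE.
Qed.

Lemma quad_deriv a : (2 *: N a + (q 0 a)%:M) *m
    ((m.+2%:R * Q) *: L - (2 * \tr (L *m L) + Q ^+ 2)%:M) + (2 *: L + Q%:M) *m
   cov_mx (d a) (g a) ((m.+2%:R * Q) *: L - (2 * \tr (L *m L) + Q ^+ 2)%:M) = 0.
Proof.
have := congr1 (cov_mx (d a) (g a)) quad; rewrite cov_mxM // cov_mxD cov_mxZ // cov_mx_scalar //.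
rewrite (deriv_nat (dM a)) scale0r add0r -/(N a) [q 0 a]mxE => ->.
by rewrite /cov_mx map_mx0 mulmx0 mul0mx subr0 addr0.
Qed.

Let ev_shape_aux x :
  (2 * (m%:R - 1) * (qx x *m (qx x)^T) 0 0) *: map_mx (ev x) L =
    (3 * ev x Q * (qx x *m (qx x)^T) 0 0)%:M - (m.+2%:R * ev x Q) *: ((qx x)^T *m qx x)
  /\ m%:R - 1 != 0 :> R.
Proof.
have ev_tr : \tr (map_mx (ev x) L *m map_mx (ev x) L) = ev x (\tr (L *m L)).
  by rewrite -map_mxM trace_map_mx.
apply: (@two_curvature_shape R m _ (fun a => map_mx (ev x) (N a))
  (fun a => map_mx (ev x) (cov_mx (d a) (g a) ((m.+2%:R * Q) *: L - (2 * \tr (L *m L) + Q ^+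
    2)%:M)))).
- exact: Q_gt0.
- exact: ev_q_neq0.
- by rewrite map_trmx L_sym.
- by move=> a; rewrite map_trmx /N trmx_cov_mx ?L_sym.
- by rewrite trace_map_mx L_tr.
- apply: (@scalerI _ _ 2); first by rewrite pnatr_eq0.
  have := congr1 (map_mx (ev x)) tangent_eq.
  rewrite !map_mxZ map_mxM rmorph_nat rmorphN => ->.
  by rewrite scalerA; congr (_ *: _); field.
- exact: ev_codazzi.
- rewrite ev_tr -[RHS](map_mx0 (ev x)) -quad map_mxM map_mxD map_mxB !map_mxZ !map_scalar_mx.
  by rewrite !evE.
- move=> a; rewrite ev_tr -[RHS](map_mx0 (ev x)) -(quad_deriv a).
  rewrite (map_mxD (ev x)) !(map_mxM (ev x)) (map_mxD (ev x) (2 *: N a)) (map_mxD (ev x) (2 *: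
    L)) map_mxB.
  rewrite !map_mxZ !map_scalar_mx.
  by rewrite [qx x 0 a]mxE !evE.
Qed.

(** The pointwise [two_curvature_shape], read as an identity between functions so that
    it can be differentiated. *)
Lemma shape : (2 * (m%:R - 1) * S) *: L = (3 * Q * S)%:M - (m.+2%:R * Q) *: (q^T *m q).
Proof.
apply: ev_mx_inj => x; rewrite map_mxB !map_mxZ map_scalar_mx map_mxM -map_trmx.
rewrite !evE ev_S.
by case: (ev_shape_aux x).
Qed.

Lemma mu_neq0 (x : X) : m%:R - 1 != 0 :> R.
Proof. by case: (ev_shape_aux x). Qed.

(* the values of [Sg / S] form the function [sg] with [s = sg q], see [ev_s_parallel];
   [Sg] is used in the ring of functions, where [S] has no inverse at hand *)
Let s : 'rV[A]_m := \row_a d a S.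
Let Sg : A := (q *m s^T) 0 0.
Let sg x : R := ev x Sg / ev x S.
Let mu : A := m%:R - 1.

Let d_mu a : d a mu = 0.
Proof. by rewrite /mu raddfB /= (deriv_nat (dM a)) (deriv1 (dM a)) subr0. Qed.

Let d_nat a k : d a k%:R = 0.
Proof. exact: deriv_nat (dM a) k. Qed.

Let dX a f k : d a (f ^+ k.+1) = k.+1%:R * f ^+ k * d a f.
Proof. exact: derivX (dM a) f k. Qed.

Lemma shape_deriv a : (2 * mu) *: (s 0 a *: L + S *: N a) =
  (3 * (q 0 a * S + Q * s 0 a))%:M -
  m.+2%:R *: (q 0 a *: (q^T *m q) + Q *: ((row a h)^T *m q + q^T *m row a h)).
Proof.
have := congr1 (cov_mx (d a) (g a)) shape.
rewrite cov_mxZ // cov_mxD cov_mx_scalar // cov_mxN cov_mxZ // cov_mx_outer // -row_hess -/(N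
  a) -/mu.
rewrite !dM d_mu !d_nat !(mul0r, mulr0, add0r).
have -> : d a Q = q 0 a by rewrite mxE.
have -> : d a S = s 0 a by rewrite [in RHS]mxE.
move: (_ + _ *m _) (q^T *m q) => u v e.
apply/matrixP => i j; have := congr1 (fun M : 'M_m => M i j) e;
  rewrite !(scalar_mx_entry, mxE) => e'.
by apply: (eq_by_scaling (t := 1) e'); ring.
Qed.

Lemma ev_s x : map_mx (ev x) s = 2 *: (qx x *m map_mx (ev x) h).
Proof.
rewrite /qx -map_mxM -(rmorph_nat (ev x)) -map_mxZ; congr map_mx.
by apply/rowP => a; rewrite [LHS]mxE deriv_S.
Qed.

Lemma ev_sg x : sg x = (qx x *m (map_mx (ev x) s)^T) 0 0 / (qx x *m (qx x)^T) 0 0.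
Proof. by rewrite /sg -ev_S map_trmx -map_mxM [in RHS]mxE. Qed.

Let ev_shape x : (2 * (m%:R - 1) * (qx x *m (qx x)^T) 0 0) *: map_mx (ev x) L =
    (3 * ev x Q * (qx x *m (qx x)^T) 0 0)%:M - (m.+2%:R * ev x Q) *: ((qx x)^T *m qx x).
Proof. by case: (ev_shape_aux x). Qed.

Let ev_shape_deriv x a :
  (2 * (m%:R - 1)) *: (map_mx (ev x) s 0 a *: map_mx (ev x) L +
     (qx x *m (qx x)^T) 0 0 *: map_mx (ev x) (N a)) =
  (3 * (qx x 0 a * (qx x *m (qx x)^T) 0 0 + ev x Q * map_mx (ev x) s 0 a))%:M -
  m.+2%:R *: (qx x 0 a *: ((qx x)^T *m qx x) + ev x Q *:
    ((row a (map_mx (ev x) h))^T *m qx x + (qx x)^T *m row a (map_mx (ev x) h))).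
Proof.
have := congr1 (map_mx (ev x)) (shape_deriv a).
rewrite /qx -map_row !map_trmx -!(map_mxM (ev x)) -/(qx x) [qx x 0 a]mxE [map_mx (ev x) s 0 a]mxE.
rewrite [map_mx (ev x) (q *m q^T) 0 0]mxE -/S.
by rewrite !(map_mxD, map_mxN, map_mxZ, map_scalar_mx) /= !evE.
Qed.

Let ev_hyps x : [/\ ev x Q != 0, (qx x *m (qx x)^T) 0 0 != 0 & m%:R - 1 != 0 :> R].
Proof. by rewrite -ev_S S_neq0 (mu_neq0 x) (lt0r_neq0 (Q_gt0 x)). Qed.

Lemma ev_s_parallel x a : ev x (d a S) = sg x * ev x (q 0 a).
Proof.
have [Q0 S0 m0] := ev_hyps x.
have := grad_norm_parallel Q0 S0 m0 (ev_hess_sym x) (ev_s x) (ev_codazzi x)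
  (ev_shape x) (ev_shape_deriv x) a.
by rewrite -ev_sg !mxE.
Qed.

Lemma ev_hess_shape x b k : map_mx (ev x) h b k =
  - (3 * (qx x *m (qx x)^T) 0 0 / (2 * m.+2%:R * ev x Q)) * (b == k)%:R +
  (3 / (2 * m.+2%:R * ev x Q) + sg x / (2 * (qx x *m (qx x)^T) 0 0)) * (qx x 0 b * qx x 0 k).
Proof.
have [Q0 S0 m0] := ev_hyps x.
rewrite ev_sg; exact: (hessian_shape Q0 S0 m0 (ev_hess_sym x) (ev_s x) (ev_codazzi x)
  (ev_shape x) (ev_shape_deriv x)).
Qed.

Lemma hess_shape : (2 * m.+2%:R * Q * S ^+ 2) *: h =
  (- (3 * S ^+ 3))%:M + (3 * S ^+ 2 + m.+2%:R * Q * Sg) *: (q^T *m q).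
Proof.
apply: ev_mx_inj => x; apply/matrixP => b k.
have qq := outer_entry q q b k.
have := ev_hess_shape x b k.
rewrite -ev_S ![map_mx _ _ _ _]mxE.
move: qq; move: (q^T *m q) (h : 'M_m) => u hh uE hE.
rewrite !(scalar_mx_entry, mxE) uE !evE hE /sg.
have m2 : 2 + m%:R != 0 :> R by rewrite -natrD pnatr_eq0.
field.
by have [-> _ _] := ev_hyps x; rewrite S_neq0 m2.
Qed.

Lemma hess_shape_deriv a :
  (2 * m.+2%:R * (S ^+ 2 * d a Q + 2 * Q * S * d a S)) *: h +
  (2 * m.+2%:R * Q * S ^+ 2) *: cov_mx (d a) (g a) h =
  (- (9 * S ^+ 2 * d a S))%:M + d a (3 * S ^+ 2 + m.+2%:R * Q * Sg) *: (q^T *m q) +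
  (3 * S ^+ 2 + m.+2%:R * Q * Sg) *: ((row a h)^T *m q + q^T *m row a h).
Proof.
have := congr1 (cov_mx (d a) (g a)) hess_shape.
rewrite cov_mxZ // cov_mxD cov_mx_scalar // cov_mxZ // cov_mx_outer // -row_hess.
have -> : d a (2 * m.+2%:R * Q * S ^+ 2) =
    2 * m.+2%:R * (S ^+ 2 * d a Q + 2 * Q * S * d a S).
  by rewrite !dM !d_nat; ring.
have -> : d a (- (3 * S ^+ 3)) = - (9 * S ^+ 2 * d a S).
  by rewrite raddfN dM d_nat dX; ring.
by rewrite addrA.
Qed.

Let ev_hess_deriv x a :
  (2 * m.+2%:R * (((qx x *m (qx x)^T) 0 0) ^+ 2 +
     2 * ev x Q * (qx x *m (qx x)^T) 0 0 * sg x) * qx x 0 a) *: map_mx (ev x) h +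
  (2 * m.+2%:R * ev x Q * ((qx x *m (qx x)^T) 0 0) ^+ 2) *:
    map_mx (ev x) (cov_mx (d a) (g a) h) =
  (- (9 * ((qx x *m (qx x)^T) 0 0) ^+ 2 * sg x * qx x 0 a))%:M +
  (\row_a ev x (d a (3 * S ^+ 2 + m.+2%:R * Q * Sg))) 0 a *: ((qx x)^T *m qx x) +
  (3 * ((qx x *m (qx x)^T) 0 0) ^+ 2 + m.+2%:R * ev x Q * sg x * (qx x *m (qx x)^T) 0 0) *:
  ((row a (map_mx (ev x) h))^T *m qx x + (qx x)^T *m row a (map_mx (ev x) h)).
Proof.
have := congr1 (map_mx (ev x)) (hess_shape_deriv a); rewrite -!ev_S mxE.
have -> : m.+2%:R * ev x Q * sg x * ev x S = m.+2%:R * ev x Q * ev x Sg.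
  by rewrite /sg -!mulrA mulVf ?S_neq0 // mulr1.
have -> : 2 * m.+2%:R * (ev x S ^+ 2 + 2 * ev x Q * ev x S * sg x) * qx x 0 a =
   2 * m.+2%:R * (ev x S ^+ 2 * ev x (d a Q) + 2 * ev x Q * ev x S * ev x (d a S)).
  by rewrite ev_s_parallel !mxE; ring.
have -> : 9 * ev x S ^+ 2 * sg x * qx x 0 a = 9 * ev x S ^+ 2 * ev x (d a S).
  by rewrite ev_s_parallel !mxE; ring.
rewrite /qx -map_row !map_trmx -!(map_mxM (ev x)).
move: (cov_mx _ _ _) (d a (_ + _)) => u v.
by rewrite !(map_mxD, map_mxN, map_mxZ, map_scalar_mx) /= !evE.
Qed.

Let ev_ricci x a b k :
  map_mx (ev x) (cov_mx (d a) (g a) h) b k - map_mx (ev x) (cov_mx (d b) (g b) h) a k =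
  - (qx x 0 b * map_mx (ev x) L a k - qx x 0 a * map_mx (ev x) L b k) / 2 +
  ev x c0 * (qx x 0 b * (a == k)%:R - qx x 0 a * (b == k)%:R).
Proof.
have [Q0 S0 m0] := ev_hyps x.
have qL c : ev x ((q *m (row c L)^T) 0 0) = - (ev x Q * ev x (q 0 c)) / 2.
  have := congr1 (fun M : 'rV_m => ev x (M 0 c)) tangent_eq.
  rewrite [in LHS]mxE [in RHS]mxE !evE.
  have -> : (q *m (row c L)^T) 0 0 = (q *m L) 0 c.
    by rewrite -[in RHS]L_sym !mxE; apply: eq_bigr => i _; rewrite !mxE.
  by move=> e; apply: (eq_by_scaling (t := 1 / 2) e); field.
have := congr1 (fun M : 'rV_m => ev x (M 0 k)) (ricci a b).
rewrite row_mul_wedge; move: (cov_mx (d a) _ _) (cov_mx (d b) _ _) => Ma Mb.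
have -> : (Q *: (row b Ma - row a Mb)) 0 k = Q * (Ma b k - Mb a k) by rewrite !mxE.
have rowE c : row c L 0 k = L c k by rewrite mxE.
rewrite !rowE !(evE x) !qL ![map_mx _ _ _ _]mxE => e.
apply: (eq_by_scaling (t := 1 / ev x Q) e); field.
exact: Q0.
Qed.

(* for the closing computation: constants of the derivation [d a] *)
Let dZ a k f : d a k = 0 -> d a (k * f) = k * d a f.
Proof. by rewrite dM => ->; rewrite mul0r add0r. Qed.

Let cM a k l : d a k = 0 -> d a l = 0 -> d a (k * l) = 0.
Proof. by move=> k0 l0; rewrite dZ // l0 mulr0. Qed.

Let cD a k l : d a k = 0 -> d a l = 0 -> d a (k + l) = 0.
Proof. by rewrite raddfD => -> ->; rewrite addr0. Qed.

Let cN a k : d a k = 0 -> d a (- k) = 0.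
Proof. by rewrite raddfN => ->; rewrite oppr0. Qed.

(* shows that the derivatives of polynomial expressions in constants vanish *)
Ltac constant := repeat first [exact: d_nat | exact: d_mu | exact: d_c0 |
  apply: cM | apply: cD | apply: cN].

(** The identity [gradient_relation] holds at every point, hence may be differentiated;
    its derivative in a direction [a] with [q 0 a != 0] is the premise of
    [constant_relation] up to the factor [q 0 a]. *)
Lemma ev_constant_relation x :
  9 * (2 * (m%:R - 1) + 3) * ev x Q +
  2 * (2 * (m%:R - 1) - 3) * (m%:R - 1 + 3) * (m%:R - 1) * ev x c0 = 0.
Proof.
have [Q0 S0 m0] := ev_hyps x.
have ev_normal y : 2 * ev y Q * \tr (map_mx (ev y) h) =
    4 * ev y Q * \tr (map_mx (ev y) L *m map_mx (ev y) L) + (qx y *m (qx y)^T) 0 0.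
  by have := congr1 (ev y) normal_eq; rewrite !(evE y) -map_mxM !trace_map_mx ev_S.
have grad : 3 * mu * (6 - 2 * mu) * S + 4 * c0 * mu * (mu + 3) ^+ 2 * Q ^+ 2 =
    3 * (mu + 3) * (2 * mu + 12) * Q ^+ 3.
  apply: ev_inj => y; have [Q0' S0' m0'] := ev_hyps y.
  have := gradient_relation Q0' (ev_q_neq0 y) m0' (ev_shape y) (ev_hess_shape y)
    (ev_hess_deriv y) (ev_ricci y) (ev_normal y).
  by rewrite !(evE y) -ev_S.
apply: (constant_relation Q0 (ev_q_neq0 x) m0 (ev_shape x) (ev_hess_shape x)
    (ev_hess_deriv x) (ev_ricci x) (ev_normal x)).
have /rV0Pn[a qa] := ev_q_neq0 x; apply: (mulfI qa).
have := congr1 (fun f => ev x (d a f)) grad.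
rewrite raddfD /= (@dZ _ (3 * mu * (6 - 2 * mu))); last by constant.
rewrite (@dZ _ (4 * c0 * mu * (mu + 3) ^+ 2)); last first.
  by rewrite expr2; constant.
rewrite (@dZ _ (3 * (mu + 3) * (2 * mu + 12))); last by constant.
rewrite !dX !(evE x) ev_s_parallel !mxE => e.
by apply: (eq_by_scaling (t := 1) e); ring.
Qed.

(** By [ev_constant_relation] the function [Q] is constant, as its coefficient
    [9 (2 m + 1)] is nonzero; but its gradient is not zero. *)
Lemma nonconstant_impossible : X -> False.
Proof.
move=> x; have /rV0Pn[a] := ev_q_neq0 x.
have E : 9 * (2 * mu + 3) * Q + 2 * (2 * mu - 3) * (mu + 3) * mu * c0 = 0.
  by apply: ev_inj => y; rewrite !(evE y) rmorph0 -[RHS](ev_constant_relation y).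
have := congr1 (fun f => ev x (d a f)) E.
rewrite raddfD /= (@dZ _ (9 * (2 * mu + 3))); last by constant.
have -> : d a (2 * (2 * mu - 3) * (mu + 3) * mu * c0) = 0 by constant.
rewrite addr0 raddf0 rmorph0 rmorphM !(evE x) => /eqP.
have -> : 2 * (m%:R - 1) + 3 = (m.*2.+1)%:R :> R.
  by rewrite -addnn -addn1 !natrD; ring.
by rewrite !mulf_eq0 !pnatr_eq0 /= !mxE => /eqP -> /eqP.
Qed.

End NonConstant.
End Frame.

(** * Structure equations of a hypersurface in an adapted frame *)

(** [H] is the ambient metric along the hypersurface, [w] the ambient connection, [E] an
    orthonormal frame of tangent vectors and [tau] a nowhere zero normal field, all
    written in ambient coordinates.  [tau] is not normalised: its squared length is [Q],
    with inverse [Qi]. *)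
Section MovingFrame.
Variables (A : comPzRingType) (m : nat) (d : 'I_m -> {additive A -> A}).
Hypothesis dM : forall a f g, d a (f * g) = d a f * g + f * d a g.
Variables (w : 'I_m -> 'M[A]_m.+1) (H : 'M[A]_m.+1) (E : 'M[A]_(m, m.+1))
  (tau : 'rV[A]_m.+1) (Qi c0 : A).
Hypothesis H_sym : H^T = H.
Hypothesis metric : forall a, map_mx (d a) H = w a *m H + H *m (w a)^T.
Hypothesis orthonormal : E *m H *m E^T = 1%:M.
Hypothesis normal : tau *m H *m E^T = 0.
Let Q : A := (tau *m H *m tau^T) 0 0.
Hypothesis QQi : Q * Qi = 1.

Local Notation D a := (cov_row (d a) (w a)).

(** The tangential part of the derivative of the frame; [frame_form] is its normal part,
    that is the second fundamental form paired with [tau]. *)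
Definition frame_conn a : 'M[A]_m := D a E *m H *m E^T.
Definition frame_form : 'M[A]_m := \matrix_a (D a E *m H *m tau^T)^T.
Local Notation g := frame_conn.
Local Notation L := frame_form.
Let q : 'rV[A]_m := \row_a d a Q.

Hypothesis d_comm : forall a b f,
  d a (d b f) - d b (d a f) = \sum_k (g a b k - g b a k) * d k f.
Hypothesis curvature : forall a b,
  frame_curvature d (fun a b k => g a b k - g b a k) w a b =
  c0 *: (H *m ((row b E)^T *m row a E - (row a E)^T *m row b E)).
(* [tau] is the tension field itself, and its rough Laplacian vanishes *)
Hypothesis L_sym : L^T = L.
Hypothesis L_tr : \tr L = Q.
Hypothesis laplacian :
  \sum_a (D a (D a tau) - \sum_k g a a k *: D k tau) = 0.

Let tHt : tau *m H *m tau^T = Q%:M.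
Proof. exact: mx11_scalar. Qed.

Let EHt : E *m H *m tau^T = 0.
Proof. by apply: trmx_inj; rewrite !trmx_mul trmxK H_sym mulmxA normal trmx0. Qed.

Lemma row_frame_form a : (row a L)^T = D a E *m H *m tau^T.
Proof. by rewrite rowK trmxK. Qed.

Lemma deriv_metric a p r (M : 'M_(p, m.+1)) (M' : 'M_(r, m.+1)) :
  map_mx (d a) (M *m H *m M'^T) = D a M *m H *m M'^T + M *m H *m (D a M')^T.
Proof.
rewrite /cov_row !map_derivM // metric trmx_add trmx_mul -map_trmx.
by rewrite !mulmxDl !mulmxDr !mulmxDl !mulmxA; abel.
Qed.

Lemma frame_conn_skew a : (g a)^T = - g a.
Proof.
have := deriv_metric a E E; rewrite orthonormal map_deriv_scalar // deriv1 // raddf0 /=.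
move=> /esym/eqP; rewrite addr_eq0 => /eqP h;
  rewrite [in RHS]/frame_conn [in RHS]h opprK /frame_conn.
by rewrite !trmx_mul trmxK H_sym mulmxA.
Qed.

(** The rows of [E] and [tau] form an orthogonal basis of the ambient tangent space. *)
Lemma expand p (M : 'M_(p, m.+1)) :
  M = M *m H *m E^T *m E + Qi *: (M *m H *m tau^T *m tau).
Proof.
pose P : 'M_(1 + m) := col_mx tau E.
pose P' : 'M_(1 + m) := H *m row_mx (Qi *: tau^T) E^T.
have PP' : P *m P' = 1%:M.
  rewrite /P /P' mulmxA mul_col_mx mul_col_row -!scalemxAr tHt EHt normal orthonormal.
  by rewrite !(scaler0, scale_scalar_mx) mulrC QQi -scalar_mx_block.
rewrite -{1}[M]mulmx1 -(mulmx1C PP') /P /P' !mulmxA mul_mx_row mul_row_col.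
by rewrite -!scalemxAr -!scalemxAl addrC.
Qed.

(** The Gauss formula. *)
Lemma deriv_frame a : D a E = g a *m E + Qi *: ((row a L)^T *m tau).
Proof. by rewrite {1}[D a E]expand row_frame_form. Qed.

Lemma deriv_normal_tangent a : D a tau *m H *m E^T = - row a L.
Proof.
have := deriv_metric a tau E; rewrite normal map_mx0 => /esym/eqP.
rewrite addr_eq0 => /eqP ->; congr (- _).
by apply: trmx_inj; rewrite row_frame_form !trmx_mul trmxK H_sym mulmxA.
Qed.

Lemma deriv_normal_normal a : 2 * (D a tau *m H *m tau^T) 0 0 = q 0 a.
Proof.
have /(congr1 (fun M : 'M_1 => M 0 0)) := deriv_metric a tau tau.
rewrite mxE -/Q => e; rewrite [RHS]mxE e [RHS]mxE.
have -> : (tau *m H *m (D a tau)^T) 0 0 = (D a tau *m H *m tau^T) 0 0.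
  transitivity ((tau *m H *m (D a tau)^T)^T 0 0); first by rewrite [RHS]mxE.
  by rewrite !trmx_mul trmxK H_sym mulmxA.
by ring.
Qed.

Local Notation r a := ((D a tau *m H *m tau^T) 0 0).

(** The Weingarten formula; the normal connection enters through the derivative of
    [Q], by [deriv_normal_normal]. *)
Lemma deriv_normal a : D a tau = - (row a L *m E) + (Qi * r a) *: tau.
Proof.
rewrite {1}[D a tau]expand deriv_normal_tangent mulNmx; congr (_ + _).
by rewrite {1}[D a tau *m H *m tau^T]mx11_scalar mul_scalar_mx scalerA.
Qed.

Lemma deriv2_normal_tangent a b : D a (D b tau) *m H *m E^T =
  - cov_row (d a) (g a) (row b L) - (Qi * r b) *: row a L.
Proof.
set rb := r b; have e : D b tau *m H *m tau^T = rb%:M by exact: mx11_scalar.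
have := deriv_metric a (D b tau) E; rewrite deriv_normal_tangent map_mxN.
move/esym/(canRL (addrK _)) => ->.
rewrite deriv_frame trmx_add trmx_scale [(g a *m E)^T]trmx_mul
  [(_ *m tau)^T]trmx_mul trmxK frame_conn_skew.
rewrite !mulmxDr -scalemxAr !mulmxA deriv_normal_tangent.
rewrite e mul_scalar_mx [cov_row _ (g a) _]/cov_row scalerA !mulmxN mulNmx.
by abel.
Qed.

Lemma deriv2_normal_normal a : 2 *: (D a (D a tau) *m H *m tau^T) =
  (d a (q 0 a))%:M - 2 *: (row a L *m (row a L)^T) - (2 * Qi * r a * r a)%:M.
Proof.
have := deriv_normal_normal a.
set ra := r a => rq; have e : D a tau *m H *m tau^T = ra%:M by exact: mx11_scalar.
have /(congr1 ( *:%R 2)) := deriv_metric a (D a tau) tau.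
rewrite e map_deriv_scalar // scale_scalar_mx.
have -> : 2 * d a ra = d a (q 0 a) by rewrite -rq dM (deriv_nat (dM a)) mul0r add0r.
have -> : D a tau *m H *m (D a tau)^T = row a L *m (row a L)^T + (Qi * ra * ra)%:M.
  rewrite {2}[D a tau]deriv_normal -/ra trmx_add trmx_opp trmx_scale trmx_mul.
  rewrite mulmxDr mulmxN -scalemxAr !mulmxA deriv_normal_tangent e.
  by rewrite scale_scalar_mx mulNmx opprK.
rewrite !scalerDr scale_scalar_mx !mulrA => ->.
by rewrite -addrA -opprD addrK.
Qed.

Let normal_row b : tau *m H *m (row b E)^T = 0.
Proof. by rewrite rowE trmx_mul mulmxA normal mul0mx. Qed.

Let row_cov a b : row b (cov_mx (d a) (g a) L) =
  cov_row (d a) (g a) (row b L) - \sum_k g a b k *: row k L.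
Proof.
rewrite /cov_mx /cov_row !linearD linearN /= (row_mul b (g a) L) (row_mul b L (g a)) -map_row
  mulmx_sum_row.
rewrite (eq_bigr (fun k => g a b k *: row k L)) => [|k _]; last by rewrite [row _ _ 0 k]mxE.
by move: (\sum_k _) => s; abel.
Qed.

(** In constant curvature the curvature operator maps [tau] to zero on tangent
    directions; the tangential part of this is Codazzi's equation for [L], with a term
    from the varying length of [tau]. *)
Lemma codazzi_row a b :
  row b (cov_mx (d a) (g a) L) - row a (cov_mx (d b) (g b) L) =
  (Qi * r a) *: row b L - (Qi * r b) *: row a L.
Proof.
have := cov_row_comm dM d_comm w a b tau; rewrite curvature.
rewrite -scalemxAr mulmxA mulmxBr !mulmxA !normal_row !mul0mx subrr scaler0.
move/(congr1 (fun M => M *m H *m E^T)); rewrite !mul0mx !mulmxBl !deriv2_normal_tangent.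
rewrite !mulmx_suml; under eq_bigr do
  rewrite -!scalemxAl deriv_normal_tangent scalerN scalerBl opprB.
rewrite sumrB !row_cov => e.
move: e; move: (\sum_k _) (\sum_k _) (cov_row _ _ (row b L)) (cov_row _ _ (row a L)) => s1 s2
  cb ca.
move: (row a L) (row b L) (r a) (r b) => la lb ra rb e.
apply/eqP; rewrite -subr_eq0 -oppr_eq0 -[X in _ == X]e; apply/eqP; abel.
Qed.

Lemma moving_codazzi a b k : 2 * Q * (cov_mx (d a) (g a) L b k - cov_mx (d b) (g b) L a k)
  = q 0 a * L b k - q 0 b * L a k.
Proof.
have := congr1 (fun M : 'rV_m => M 0 k) (codazzi_row a b).
rewrite -!deriv_normal_normal.
move: (r a) (r b) => ra rb; move: (cov_mx (d a) _ _) (cov_mx (d b) _ _) => ca cb.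
move: frame_form => l; rewrite !mxE => e; apply: (eq_by_scaling (t := 2 * Q) e).
have E2 t : 2 * t = 2 * Q * (Qi * t) by rewrite -[LHS]mul1r -QQi; ring.
by rewrite (E2 ra) (E2 rb); ring.
Qed.

(** Tracing Codazzi replaces the divergence of [L] in the tangential part of the
    Laplacian by the gradient of [tr L = Q]. *)
Lemma moving_tangent : 2 *: (q *m L) = - Q *: q.
Proof.
have lap_row : \sum_a (row a (cov_mx (d a) (g a) L) + (Qi * r a) *: row a L) = 0.
  have rowE a : (D a (D a tau) - \sum_k g a a k *: D k tau) *m H *m E^T =
      - (row a (cov_mx (d a) (g a) L) + (Qi * r a) *: row a L).
    rewrite !mulmxBl deriv2_normal_tangent !mulmx_suml.
    under eq_bigr do rewrite -!scalemxAl deriv_normal_tangent scalerN.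
    rewrite sumrN opprK row_cov; move: (\sum_k _) (cov_row _ (g a) (row a L)) => s c.
    by move: (r a) (row a L) => ra l; abel.
  have := congr1 (fun M => M *m H *m E^T) laplacian; rewrite !mul0mx !mulmx_suml.
  rewrite (eq_bigr _ (fun a _ => rowE a)).
  by rewrite sumrN => /eqP; rewrite oppr_eq0 => /eqP.
have N_sym a : (cov_mx (d a) (g a) L)^T = cov_mx (d a) (g a) L.
  by rewrite trmx_cov_mx ?L_sym // frame_conn_skew.
have N_tr a : \tr (cov_mx (d a) (g a) L) = 2 * r a.
  by rewrite mxtrace_cov_mx L_tr deriv_normal_normal mxE.
apply/rowP => k; have := congr1 (fun M : 'rV_m => M 0 k) lap_row.
have Nk a : cov_mx (d a) (g a) L a k = cov_mx (d k) (g k) L a a + Qi * r a * L a k - Qi * r k *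
  L a a.
  have := congr1 (fun M : 'rV_m => M 0 a) (codazzi_row a k).
  have := congr1 (fun M : 'M_m => M a k) (N_sym a).
  have := congr1 (fun M : 'M_m => M k a) L_sym.
  move: (r a) (r k) => ra rk; move: (cov_mx (d a) _ _) (cov_mx (d k) _ _) => ca ck.
  move: frame_form => l; rewrite !mxE => -> <- e.
  by apply: (eq_by_scaling (t := 1) e); ring.
have termE a : (row a (cov_mx (d a) (g a) L) + (Qi * r a) *: row a L : 'rV_m) 0 k =
    cov_mx (d k) (g k) L a a + 2 * Qi * (r a * L a k) - Qi * r k * L a a.
  have := Nk a; move: (cov_mx (d a) _ _) (cov_mx (d k) _ _) => ca ck.
  move: (r a) (r k) frame_form => ra rk l.
  by rewrite !mxE => ->; ring.
rewrite summxE (eq_bigr _ (fun a _ => termE a)).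
rewrite sumrB big_split /= -!mulr_sumr -/(mxtrace _) -/(mxtrace L) N_tr L_tr.
have -> : (0 : 'rV[A]_m) 0 k = 0 by rewrite mxE.
have -> : (2 *: (q *m L)) 0 k = 4 * \sum_i r i * L i k.
  rewrite [LHS]mxE [X in _ * X]mxE !mulr_sumr; apply: eq_bigr => i _.
  by rewrite -deriv_normal_normal; ring.
have -> : (- Q *: q) 0 k = - (2 * Q * r k).
  by rewrite [LHS]mxE -deriv_normal_normal; ring.
move: (\sum_i _) (r k) => s rk e.
have E2 t : Q * Qi * t = t by rewrite QQi mul1r.
have QiQ : Qi * rk * Q = rk by rewrite -[RHS]E2; ring.
by rewrite -[4 * s]E2; apply: (eq_by_scaling (t := 2 * Q) e); rewrite QiQ; ring.
Qed.

(** The normal part of the Laplacian of [tau], rewritten by differentiating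
    [<tau, tau> = Q] twice. *)
Lemma moving_normal :
  2 * Q * \tr (\matrix_(a, k) cov_row (d a) (g a) q 0 k) =
  4 * Q * \tr (L *m L) + (q *m q^T) 0 0.
Proof.
have hE : \tr (\matrix_(a, k) cov_row (d a) (g a) q 0 k) =
    \sum_a (d a (q 0 a) - \sum_k g a a k * q 0 k).
  apply: eq_bigr => a _; rewrite mxE [LHS]mxE [X in X + _ = _]mxE; congr (_ + _).
  rewrite mxE -sumrN; apply: eq_bigr => k _.
  have := congr1 (fun M : 'M_m => M a k) (frame_conn_skew a).
  by move: (g a) => ga; rewrite mxE [RHS]mxE => ->; ring.
have LLE : \tr (L *m L) = \sum_a (row a L *m (row a L)^T) 0 0.
  apply: eq_bigr => a _; rewrite -{2}L_sym !mxE; apply: eq_bigr => k _.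
  by rewrite [X in _ = X * _]mxE [X in _ = _ * X]mxE [X in _ = _ * X]mxE [X in _ * X = _]mxE.
have qqE : (q *m q^T) 0 0 = \sum_a 4 * (r a * r a).
  by rewrite mulmx_dot; apply: eq_bigr => a _; rewrite -deriv_normal_normal; ring.
have rowE a : 2 * ((D a (D a tau) - \sum_k g a a k *: D k tau) *m H *m tau^T) 0 0 =
    (d a (q 0 a) - \sum_k g a a k * q 0 k) - 2 * (row a L *m (row a L)^T) 0 0 -
    2 * Qi * (r a * r a).
  have := congr1 (fun M : 'M_1 => M 0 0) (deriv2_normal_normal a).
  have -> : 2 * ((D a (D a tau) - \sum_k g a a k *: D k tau) *m H *m tau^T) 0 0 =
     2 * (D a (D a tau) *m H *m tau^T) 0 0 - \sum_k g a a k * q 0 k.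
    rewrite !mulmxBl !mulmx_suml mxE [X in _ * (_ + X)]mxE mulrBr; congr (_ - _).
    rewrite summxE mulr_sumr; apply: eq_bigr => k _.
    rewrite -deriv_normal_normal -!scalemxAl mxE; ring.
  move: (\sum_k _) (r a) (D a (D a tau) *m H *m tau^T) (row a L *m _) => s ra u v.
  by rewrite !(scalar_mx_entry, mxE) eqxx /= => e; apply: (eq_by_scaling (t := 1) e); ring.
have := congr1 (fun M => 2 * (M *m H *m tau^T) 0 0) laplacian.
have -> : 2 * ((0 : 'rV_m.+1) *m H *m tau^T) 0 0 = 0 by rewrite !mul0mx mxE mulr0.
rewrite !mulmx_suml summxE mulr_sumr (eq_bigr _ (fun a _ => rowE a)).
rewrite sumrB sumrB -hE -!mulr_sumr -LLE qqE -mulr_sumr.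
move: (\tr _) (\tr _) (\sum_a _) => t1 t2 s e.
have E2 t : Q * Qi * t = t by rewrite QQi mul1r.
by rewrite -[4 * s]E2; apply: (eq_by_scaling (t := 2 * Q) e); ring.
Qed.

(** The tangential part of the curvature operator applied to the frame. *)
Lemma moving_gauss a b :
  Q *: (map_mx (d a) (g b) - map_mx (d b) (g a) + g b *m g a - g a *m g b -
        \sum_k (g a b k - g b a k) *: g k) =
  (row b L)^T *m row a L - (row a L)^T *m row b L +
  (Q * c0) *: (delta_mx b a - delta_mx a b).
Proof.
have EErow c : E *m H *m (row c E)^T = delta_mx c 0.
  by rewrite rowE trmx_mul mulmxA orthonormal mul1mx trmx_delta.
have rowEE c : row c E *m H *m E^T = delta_mx 0 c.
  by rewrite rowE -!mulmxA (mulmxA E) orthonormal mulmx1.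
have DDE a' b' : D a' (D b' E) *m H *m E^T =
    map_mx (d a') (g b') + g b' *m g a' - Qi *: ((row b' L)^T *m row a' L).
  have := deriv_metric a' (D b' E) E; rewrite -/(g b') => /esym/(canRL (addrK _)) ->.
  have sk := frame_conn_skew a'; rewrite (deriv_frame a').
  move: (g a') sk => ga sk.
  rewrite trmx_add trmx_scale [(ga *m E)^T]trmx_mul [(_ *m tau)^T]trmx_mul trmxK sk.
  rewrite mulmxDr -scalemxAr !mulmxA -/(g b') -row_frame_form mulmxN.
  by rewrite opprD opprK addrA.
have one x y : E *m (H *m ((row x E)^T *m row y E)) *m H *m E^T = delta_mx x y.
  by rewrite !mulmxA EErow -!(mulmxA (delta_mx x 0)) rowEE mul_delta_mx.
have curvE : E *m (c0 *: (H *m ((row b E)^T *m row a E - (row a E)^T *m row b E))) *m H *m E^T =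
    c0 *: (delta_mx b a - delta_mx a b).
  by rewrite -!one mulmxBr -scalemxAr mulmxBr -!scalemxAl 2!mulmxBl.
have := cov_row_comm dM d_comm w a b E; rewrite curvature.
move/(congr1 (fun M => M *m H *m E^T)); rewrite curvE.
rewrite !mulmxBl !DDE !mulmx_suml.
under eq_bigr do rewrite -!scalemxAl -/(g _).
move: (\sum_k (g a b k - g b a k) *: g k) => s.
move: (g a) (g b) => ga gb e; rewrite -scalerA -e.
move: (_^T *m row a L) (_^T *m row b L) (ga *m _) (gb *m _) => x y u v.
apply/matrixP => i j; rewrite !mxE; apply: (eq_by_scaling (t := x i j - y i j) QQi).
by ring.
Qed.

End MovingFrame.

(** * From coordinates to an orthonormal frame *)

Section FrameDerivation.
Variables (A : comPzRingType) (m : nat) (p : 'I_m -> {additive A -> A})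
  (e : 'M[A]_m) (a : 'I_m).

Definition frame_deriv (f : A) : A := \sum_b e a b * p b f.

Fact frame_deriv_additive : zmod_morphism frame_deriv.
Proof.
move=> f g; rewrite /frame_deriv -sumrB; apply: eq_bigr => b _.
by rewrite raddfB mulrBr.
Qed.

HB.instance Definition _ :=
  GRing.isZmodMorphism.Build A A frame_deriv frame_deriv_additive.

Hypothesis pM : forall a f g, p a (f * g) = p a f * g + f * p a g.

Lemma frame_derivM f g : frame_deriv (f * g) = frame_deriv f * g + f * frame_deriv g.
Proof.
rewrite /frame_deriv mulr_suml mulr_sumr -big_split; apply: eq_bigr => b _ /=.
by rewrite pM; ring.
Qed.

Lemma map_frame_deriv q r (M : 'M_(q, r)) :
  map_mx frame_deriv M = \sum_b e a b *: map_mx (p b) M.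
Proof.
apply/matrixP => i j; rewrite mxE summxE; apply: eq_bigr => b _.
by rewrite !mxE.
Qed.

End FrameDerivation.

Lemma cov_rowM (A : comPzRingType) (d : {additive A -> A})
    (dM : forall f g, d (f * g) = d f * g + f * d g) q m n (w : 'M_n)
    (M : 'M_(q, m)) (N : 'M_(m, n)) :
  cov_row d w (M *m N) = map_mx d M *m N + M *m cov_row d w N.
Proof. by rewrite /cov_row map_derivM // mulmxDr !mulmxA; abel. Qed.

(** [p] are the coordinate derivations of the hypersurface, [T] the Jacobian of the
    immersion, [C] the ambient connection pulled back to coordinate directions, [G] the
    induced metric and [Gam] its connection matrices.  The rows of [e] are an orthonormal
    frame.  [tangent] says that [Gam] is the tangential part of the ambient connection. *)
Section Coordinates.
Variables (A : comPzRingType) (m : nat) (p : 'I_m -> {additive A -> A}).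
Hypothesis pM : forall a f g, p a (f * g) = p a f * g + f * p a g.
Hypothesis p_comm : forall a b f, p a (p b f) = p b (p a f).
Variables (C : 'I_m -> 'M[A]_m.+1) (H : 'M[A]_m.+1) (T : 'M[A]_(m, m.+1))
  (Gam : 'I_m -> 'M[A]_m) (e : 'M[A]_m) (c0 : A).
Hypothesis H_sym : H^T = H.
Hypothesis metric : forall a, map_mx (p a) H = C a *m H + H *m (C a)^T.
Hypothesis torsion : forall a b,
  row b (cov_row (p a) (C a) T) = row a (cov_row (p b) (C b) T).
Hypothesis curvature : forall a b,
  map_mx (p a) (C b) - map_mx (p b) (C a) + C b *m C a - C a *m C b =
  c0 *: (H *m ((row b T)^T *m row a T - (row a T)^T *m row b T)).
Variable G : 'M[A]_m.
Hypothesis GE : G = T *m H *m T^T.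
Hypothesis tangent : forall a, cov_row (p a) (C a) T *m H *m T^T = Gam a *m G.
Hypothesis orthonormal : e *m G *m e^T = 1%:M.

(** Contraction with the frame turns coordinate derivations, and in [frame_w] connection
    matrices, into those along the frame vectors. *)
Definition frame_d a : {additive A -> A} := frame_deriv p e a.
Definition frame_w n (w : 'I_m -> 'M[A]_n) a : 'M[A]_n := \sum_b e a b *: w b.
Local Notation d := frame_d.
(** Row [b] is the Levi-Civita derivative of frame vector [b] along frame vector [a], in
    coordinates. *)
Definition coord_nabla a : 'M[A]_m := cov_row (d a) (frame_w Gam a) e.
Definition coord_form a : 'M[A]_(m, m.+1) :=
  cov_row (d a) (frame_w C a) (e *m T) - coord_nabla a *m T.
Definition coord_tension : 'rV[A]_m.+1 := \sum_a row a (coord_form a).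
Local Notation E := (e *m T).
Local Notation tau := coord_tension.
Local Notation g := (frame_conn d (frame_w C) H E).

Let dM a f f' : d a (f * f') = d a f * f' + f * d a f'.
Proof. exact: frame_derivM. Qed.

Let GeTe : G *m e^T *m e = 1%:M.
Proof. by apply: mulmx1C; rewrite mulmxA orthonormal. Qed.

Lemma cov_row_frame a q n (w : 'I_m -> 'M_n) (M : 'M_(q, n)) :
  cov_row (d a) (frame_w w a) M = \sum_b e a b *: cov_row (p b) (w b) M.
Proof.
rewrite /cov_row /d map_frame_deriv /frame_w mulmx_sumr -big_split; apply: eq_bigr => b _ /=.
by rewrite scalerDr scalemxAr.
Qed.

(** Both sides contract the same tensor with two frame vectors, and may be compared in
    coordinates. *)
Lemma frame_sym n (X : 'I_m -> 'M[A]_(m, n)) :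
  (forall a b, row b (X a) = row a (X b)) -> forall a b,
  row b (e *m \sum_c e a c *: X c) = row a (e *m \sum_c e b c *: X c).
Proof.
have rowE a b : row b (e *m \sum_c e a c *: X c) =
    \sum_c \sum_k (e a c * e b k) *: row k (X c).
  rewrite row_mul mulmx_sumr; apply: eq_bigr => c _.
  rewrite -scalemxAr mulmx_sum_row scaler_sumr; apply: eq_bigr => k _.
  by rewrite scalerA mxE.
move=> X_sym a b; rewrite !rowE exchange_big; apply: eq_bigr => c _.
by apply: eq_bigr => k _; rewrite X_sym mulrC.
Qed.

Lemma Gam_sym a b : row b (Gam a) = row a (Gam b).
Proof.
have GamE c : Gam c = cov_row (p c) (C c) T *m H *m T^T *m (e^T *m e).
  by rewrite tangent -mulmxA (mulmxA G) GeTe mulmx1.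
by rewrite !GamE -!mulmxA 2!row_mul torsion.
Qed.

Let B c := cov_row (p c) (C c) T - Gam c *m T.

Let B_sym a b : row b (B a) = row a (B b).
Proof. by rewrite /B !linearB /= !row_mul torsion Gam_sym. Qed.

Lemma coord_formE a : coord_form a = e *m \sum_c e a c *: B c.
Proof.
have nablaE : coord_nabla a = map_mx (d a) e + e *m frame_w Gam a by [].
rewrite /coord_form cov_rowM // nablaE mulmxDl opprD addrACA subrr add0r cov_row_frame /B.
under [in RHS]eq_bigr do rewrite scalerBr scalemxAl.
by rewrite sumrB mulmxBr /frame_w -mulmx_suml mulmxA.
Qed.

Lemma coord_form_sym a b : row b (coord_form a) = row a (coord_form b).
Proof. by rewrite !coord_formE; apply: frame_sym B_sym a b. Qed.

Lemma coord_form_normal a : coord_form a *m H *m T^T = 0.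
Proof.
rewrite coord_formE -!mulmxA mulmx_suml big1 ?mulmx0 // => c _.
by rewrite -scalemxAl /B mulmxBl mulmxA tangent GE !mulmxA subrr scaler0.
Qed.

Lemma tension_normal : tau *m H *m T^T = 0.
Proof.
rewrite /tau !mulmx_suml big1 // => a _.
by rewrite -!row_mul coord_form_normal row0.
Qed.

Lemma frame_orthonormal : E *m H *m E^T = 1%:M.
Proof. by rewrite trmx_mul -orthonormal GE !mulmxA. Qed.

Lemma tension_frame_normal : tau *m H *m E^T = 0.
Proof. by rewrite trmx_mul mulmxA tension_normal mul0mx. Qed.

(** The intrinsic covariant derivatives of the frame and the tangential components
    [frame_conn] of the ambient ones agree. *)
Lemma nablaE a : coord_nabla a = g a *m e.
Proof.
rewrite /frame_conn.
have -> : cov_row (d a) (frame_w C a) E = coord_form a + coord_nabla a *m T by rewrite subrK.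
move: (coord_form a) (coord_form_normal a) (coord_nabla a) => F F0 N.
rewrite trmx_mul mulmxA !mulmxDl F0 !mul0mx add0r -(mulmxA N) -(mulmxA N) -GE.
by rewrite -!mulmxA (mulmxA G) GeTe mulmx1.
Qed.

(** The bracket of two frame vectors, since the connection is torsion-free. *)
Lemma bracketE a b c : d a (e b c) - d b (e a c) = \sum_k (g a b k - g b a k) * e k c.
Proof.
have rowE a' b' : row b' (map_mx (d a') e) = row b' (g a' *m e) - row b' (e *m frame_w Gam a').
  by rewrite -linearB -nablaE /coord_nabla /cov_row addrK.
have symE := frame_sym Gam_sym a b.
have h : row b (map_mx (d a) e) - row a (map_mx (d b) e) = row b (g a *m e) - row a (g b *m e).
  by rewrite !rowE symE opprB addrA addrNK.
have := congr1 (fun M : 'rV_m => M 0 c) h.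
move: (g a) (g b) => ga gb; rewrite !mxE => ->; rewrite -sumrB.
by apply: eq_bigr => k _; rewrite mulrBl.
Qed.

Lemma frame_deriv_comm a b f :
  d a (d b f) - d b (d a f) = \sum_k (g a b k - g b a k) * d k f.
Proof.
have dd a' b' : d a' (d b' f) = \sum_c d a' (e b' c) * p c f +
   \sum_c \sum_k e b' c * e a' k * p k (p c f).
  have -> : d b' f = \sum_c e b' c * p c f by [].
  rewrite raddf_sum -big_split; apply: eq_bigr => c _ /=.
  rewrite dM; congr (_ + _).
  have -> : d a' (p c f) = \sum_k e a' k * p k (p c f) by [].
  by rewrite mulr_sumr; apply: eq_bigr => k _; rewrite mulrA.
have sym : \sum_c \sum_k e b c * e a k * p k (p c f) = \sum_c \sum_k e a c * e b k * p k (p c f).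
  rewrite exchange_big; apply: eq_bigr => c _; apply: eq_bigr => k _.
  by rewrite p_comm (mulrC (e b k)).
rewrite !dd sym opprD addrACA subrr addr0 -sumrB.
transitivity (\sum_c \sum_k (g a b k - g b a k) * e k c * p c f).
  by apply: eq_bigr => c _; rewrite -mulrBl bracketE mulr_suml.
rewrite exchange_big; apply: eq_bigr => k _.
have -> : d k f = \sum_c e k c * p c f by [].
by rewrite mulr_sumr; apply: eq_bigr => c _; rewrite mulrA.
Qed.

Lemma frame_metric a : map_mx (d a) H = frame_w C a *m H + H *m (frame_w C a)^T.
Proof.
rewrite /d map_frame_deriv /frame_w mulmx_suml raddf_sum mulmx_sumr -big_split.
apply: eq_bigr => b _ /=.
by rewrite metric scalerDr trmx_scale -scalemxAl -scalemxAr.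
Qed.

Lemma frame_curvatureE a b :
  frame_curvature d (fun a b k => g a b k - g b a k) (frame_w C) a b =
  c0 *: (H *m ((row b E)^T *m row a E - (row a E)^T *m row b E)).
Proof.
have dw a' b' : map_mx (d a') (frame_w C b') = \sum_c d a' (e b' c) *: C c +
    \sum_c \sum_k (e b' c * e a' k) *: map_mx (p k) (C c).
  rewrite /frame_w raddf_sum -big_split; apply: eq_bigr => c _ /=.
  rewrite map_derivZ //; congr (_ + _).
  by rewrite map_frame_deriv scaler_sumr; apply: eq_bigr => k _; rewrite scalerA.
have brk : \sum_c d a (e b c) *: C c - \sum_c d b (e a c) *: C c =
    \sum_k (g a b k - g b a k) *: frame_w C k.
  rewrite -sumrB; under eq_bigr do rewrite -scalerBl bracketE scaler_suml.
  rewrite exchange_big; apply: eq_bigr => k _; rewrite scaler_sumr.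
  by apply: eq_bigr => c _; rewrite scalerA.
have prod a' b' : frame_w C b' *m frame_w C a' = \sum_c \sum_k (e b' c * e a' k) *: (C c *m C k).
  rewrite /frame_w mulmx_suml; apply: eq_bigr => c _; rewrite mulmx_sumr.
  by apply: eq_bigr => k _; rewrite -scalemxAl -scalemxAr scalerA.
have sym (F : 'I_m -> 'I_m -> 'M[A]_m.+1) :
    \sum_c \sum_k (e a c * e b k) *: F c k = \sum_c \sum_k (e b c * e a k) *: F k c.
  rewrite exchange_big; apply: eq_bigr => c _; apply: eq_bigr => k _.
  by rewrite mulrC.
rewrite /frame_curvature !dw -brk !prod !sym.
transitivity (\sum_c \sum_k (e b c * e a k) *: (map_mx (p k) (C c) - map_mx (p c) (C k)
   + C c *m C k - C k *m C c)).
  under [RHS]eq_bigr do under eq_bigr do rewrite !(scalerDr, scalerN).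
  under [RHS]eq_bigr do rewrite !big_split !sumrN.
  rewrite !big_split !sumrN /=.
  move: (\sum_c d a _ *: _) (\sum_c d b _ *: _) (\sum_c \sum_k _) (\sum_c \sum_k _) (\sum_c
    \sum_k _) (\sum_c \sum_k _).
  by move=> x1 x2 x3 x4 x5 x6; abel.
under eq_bigr do under eq_bigr do rewrite curvature scalerA mulrC -scalerA.
under eq_bigr do rewrite -scaler_sumr; rewrite -scaler_sumr; congr (_ *: _).
have outer (x y : 'I_m) : H *m ((row x E)^T *m row y E) =
    \sum_c \sum_k (e x c * e y k) *: (H *m ((row c T)^T *m row k T)).
  have rowE z : row z E = \sum_c e z c *: row c T.
    by rewrite row_mul mulmx_sum_row; apply: eq_bigr => c _; rewrite mxE.
  have rowTE z : (row z E)^T = \sum_c e z c *: (row c T)^T.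
    by rewrite rowE raddf_sum; apply: eq_bigr => c _; rewrite /= trmx_scale.
  rewrite rowTE rowE mulmx_suml mulmx_sumr; apply: eq_bigr => c _.
  rewrite !mulmx_sumr; apply: eq_bigr => k _.
  by rewrite -scalemxAl -!scalemxAr scalerA.
rewrite mulmxBr !outer sym -sumrB; apply: eq_bigr => c _.
rewrite -sumrB; apply: eq_bigr => k _.
by rewrite mulmxBr scalerBr.
Qed.

Lemma frame_formE a : (row a (frame_form d (frame_w C) H E tau))^T = coord_form a *m H *m tau^T.
Proof.
rewrite row_frame_form.
have -> : cov_row (d a) (frame_w C a) E = coord_form a + coord_nabla a *m T by rewrite subrK.
have THt : T *m H *m tau^T = 0.
  by apply: trmx_inj; rewrite trmx_mul [(T *m H)^T]trmx_mul trmxK H_sym mulmxA tension_normal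
    trmx0.
move: (coord_form a) (coord_nabla a) => F N.
by rewrite !mulmxDl -!(mulmxA N) THt mulmx0 addr0.
Qed.

Lemma frame_form_sym : (frame_form d (frame_w C) H E tau)^T = frame_form d (frame_w C) H E tau.
Proof.
have LE a b : frame_form d (frame_w C) H E tau a b = (row b (coord_form a) *m H *m tau^T) 0 0.
  have := congr1 (fun M : 'cV_m => M b 0) (frame_formE a).
  rewrite -!row_mul; move: (frame_form _ _ _ _ _) (_ *m tau^T) => l u.
  by rewrite !mxE.
by apply/matrixP => a b; rewrite [LHS]mxE !LE coord_form_sym.
Qed.

Lemma frame_form_tr : \tr (frame_form d (frame_w C) H E tau) = (tau *m H *m tau^T) 0 0.
Proof.
rewrite [X in _ = (X *m H *m _) 0 0]/coord_tension !mulmx_suml summxE; apply: eq_bigr => a _.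
have := congr1 (fun M : 'cV_m => M a 0) (frame_formE a).
rewrite -!row_mul; move: (frame_form _ _ _ _ _) (_ *m tau^T) => l u.
by rewrite !mxE.
Qed.

Hypothesis laplacian : \sum_a (cov_row (d a) (frame_w C a) (cov_row (d a) (frame_w C a) tau) -
  \sum_c coord_nabla a a c *: cov_row (p c) (C c) tau) = 0.

Lemma frame_laplacian : \sum_a (cov_row (d a) (frame_w C a) (cov_row (d a) (frame_w C a) tau) -
  \sum_k g a a k *: cov_row (d k) (frame_w C k) tau) = 0.
Proof.
rewrite -[RHS]laplacian; apply: eq_bigr => a _; congr (_ - _).
rewrite nablaE; under eq_bigr do rewrite cov_row_frame scaler_sumr.
rewrite exchange_big; apply: eq_bigr => c _ /=.
have -> : (g a *m e) a c = \sum_k g a a k * e k c by rewrite [LHS]mxE.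
by rewrite scaler_suml; apply: eq_bigr => k _; rewrite scalerA.
Qed.

End Coordinates.

(** The coordinate data give rise to the frame data of the previous parts: here the two
    impossibility results are transferred to the tension field in coordinates. *)
Section TensionalHypersurface.
Variables (R : realFieldType) (X : Type) (A : comPzRingType).
Variable ev : X -> {rmorphism A -> R}.
Hypothesis ev_inj : forall f g, (forall x, ev x f = ev x g) -> f = g.
Variables (m : nat) (p : 'I_m -> {additive A -> A}).
Hypothesis pM : forall a f g, p a (f * g) = p a f * g + f * p a g.
Hypothesis p_comm : forall a b f, p a (p b f) = p b (p a f).
Variables (C : 'I_m -> 'M[A]_m.+1) (H : 'M[A]_m.+1) (T : 'M[A]_(m, m.+1))
  (Gam : 'I_m -> 'M[A]_m) (G e : 'M[A]_m) (Qi c0 : A).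
Hypothesis p_c0 : forall a, p a c0 = 0.
Hypothesis H_sym : H^T = H.
Hypothesis metric : forall a, map_mx (p a) H = C a *m H + H *m (C a)^T.
Hypothesis torsion : forall a b,
  row b (cov_row (p a) (C a) T) = row a (cov_row (p b) (C b) T).
Hypothesis curvature : forall a b,
  map_mx (p a) (C b) - map_mx (p b) (C a) + C b *m C a - C a *m C b =
  c0 *: (H *m ((row b T)^T *m row a T - (row a T)^T *m row b T)).
Hypothesis GE : G = T *m H *m T^T.
Hypothesis tangent : forall a, cov_row (p a) (C a) T *m H *m T^T = Gam a *m G.
Hypothesis orthonormal : e *m G *m e^T = 1%:M.
Local Notation d := (frame_d p e).
Local Notation tau := (coord_tension p C T Gam e).
Definition tension_sq : A := (tau *m H *m tau^T) 0 0.
Local Notation Q := tension_sq.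
Hypothesis QQi : Q * Qi = 1.
Hypothesis Q_gt0 : forall x, 0 < ev x Q.
Hypothesis laplacian : \sum_a (cov_row (d a) (frame_w e C a) (cov_row (d a) (frame_w e C a) tau) -
  \sum_c coord_nabla p Gam e a a c *: cov_row (p c) (C c) tau) = 0.
Local Notation w := (frame_w e C).
Local Notation E := (e *m T).
Local Notation g := (frame_conn d w H E).
Definition tension_form : 'M[A]_m := frame_form d w H E tau.
Local Notation L := tension_form.
Definition tension_grad : 'rV[A]_m := \row_a d a Q.
Local Notation q := tension_grad.

Let dM a f f' : d a (f * f') = d a f * f' + f * d a f'.
Proof. exact: frame_derivM. Qed.

Let d_comm a b f : d a (d b f) - d b (d a f) = \sum_k (g a b k - g b a k) * d k f.
Proof. exact: (frame_deriv_comm pM p_comm torsion GE tangent orthonormal). Qed.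

Let metric' a : map_mx (d a) H = w a *m H + H *m (w a)^T.
Proof. exact: frame_metric. Qed.

Let E1 : E *m H *m E^T = 1%:M.
Proof. exact: (frame_orthonormal GE orthonormal). Qed.

Let normal' : tau *m H *m E^T = 0.
Proof. exact: (tension_frame_normal pM e GE tangent). Qed.

Let curvature' a b : frame_curvature d (fun a b k => g a b k - g b a k) w a b =
  c0 *: (H *m ((row b E)^T *m row a E - (row a E)^T *m row b E)).
Proof. exact: (frame_curvatureE pM torsion curvature GE tangent orthonormal). Qed.

Lemma tension_form_sym : L^T = L.
Proof. exact: (frame_form_sym pM H_sym torsion GE tangent orthonormal). Qed.

Lemma tension_form_tr : \tr L = Q.
Proof. exact: (frame_form_tr pM e H_sym GE tangent). Qed.

Let laplacian' : \sum_a (cov_row (d a) (w a) (cov_row (d a) (w a) tau) -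
  \sum_k g a a k *: cov_row (d k) (w k) tau) = 0.
Proof. exact: (frame_laplacian pM GE tangent orthonormal laplacian). Qed.

Let d_c0 a : d a c0 = 0.
Proof. by rewrite /frame_d /= /frame_deriv big1 // => b _; rewrite p_c0 mulr0. Qed.

Let g_skew a : (g a)^T = - g a.
Proof. exact: (frame_conn_skew dM H_sym metric' E1). Qed.

Lemma tension_tangent : 2 *: (q *m L) = - Q *: q.
Proof.
exact: (moving_tangent dM H_sym metric' E1 normal' QQi d_comm curvature'
  tension_form_sym tension_form_tr laplacian').
Qed.

Let gauss a b := moving_gauss dM H_sym metric' E1 normal' QQi d_comm curvature' a b.
Let codazzi a b k := moving_codazzi dM H_sym metric' E1 normal' QQi d_comm curvature' a b k.
Let normal_eq := moving_normal dM H_sym metric' E1 normal' QQi tension_form_sym laplacian'.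

Lemma tension_not_constant : X -> q <> 0.
Proof.
move=> x.
apply: (constant_impossible tension_form_sym tension_form_tr normal_eq Q_gt0 x).
Qed.

Hypothesis quad : (2 *: L + Q%:M) *m
  ((m.+2%:R * Q) *: L - (2 * \tr (L *m L) + Q ^+ 2)%:M) = 0.

Lemma tension_not_regular : X -> ~ (forall x, ev x ((q *m q^T) 0 0) != 0).
Proof.
move=> x S_neq0.
exact: (nonconstant_impossible ev_inj dM g_skew d_comm d_c0 tension_form_sym
  tension_form_tr codazzi tension_tangent normal_eq gauss quad Q_gt0 S_neq0 x).
Qed.

End TensionalHypersurface.

(** * Levi-Civita connections and their pullbacks *)

Section Christoffel.
Variables (A : comPzRingType) (n : nat) (p : 'I_n -> {additive A -> A}).
Variables (H Hi : 'M[A]_n) (half : A).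
Hypothesis half2 : 2 * half = 1.
Hypothesis H_sym : H^T = H.
Hypothesis HiH : Hi *m H = 1%:M.

(** Row [j] of this matrix consists of the components of [nabla_i] of the [j]-th
    coordinate vector.  The inverse metric [Hi] and one half are parameters because the
    coefficient ring is not a field. *)
Definition levi_civita i : 'M[A]_n := \matrix_(j, k) (half *
  \sum_l Hi k l * (p i (H j l) + p j (H i l) - p l (H i j))).

Let Hs i j : H i j = H j i.
Proof. by rewrite -[in LHS]H_sym mxE. Qed.

Lemma levi_civita_lower i j k :
  (levi_civita i *m H) j k = half * (p i (H j k) + p j (H i k) - p k (H i j)).
Proof.
have HiHT : Hi^T *m H = 1%:M by apply: mulmx1C; rewrite -{1}H_sym -trmx_mul HiH trmx1.
rewrite mxE; under eq_bigr do rewrite mxE -mulrA mulr_suml.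
rewrite -mulr_sumr exchange_big /=; congr (_ * _).
rewrite (bigD1 k) //= [X in _ + X]big1 ?addr0 => [|l lk].
  have := congr1 (fun M : 'M_n => M k k) HiHT; rewrite !mxE eqxx => e.
  transitivity (\sum_s Hi^T k s * H s k * (p i (H j k) + p j (H i k) - p k (H i j))).
    by apply: eq_bigr => s _; rewrite mxE; ring.
  by rewrite -mulr_suml e mul1r.
have := congr1 (fun M : 'M_n => M l k) HiHT; rewrite !mxE (negbTE lk) => e.
transitivity (\sum_s Hi^T l s * H s k * (p i (H j l) + p j (H i l) - p l (H i j))).
  by apply: eq_bigr => s _; rewrite mxE; ring.
by rewrite -mulr_suml e mul0r.
Qed.

Lemma levi_civita_sym i j : row j (levi_civita i) = row i (levi_civita j).
Proof.
apply/rowP => k; rewrite !mxE; congr (_ * _); apply: eq_bigr => l _.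
by rewrite (Hs j i) [p i _ + _]addrC.
Qed.

Lemma levi_civita_metric i : map_mx (p i) H = levi_civita i *m H + H *m (levi_civita i)^T.
Proof.
apply/matrixP => j k; rewrite mxE [RHS]mxE levi_civita_lower.
have -> : (H *m (levi_civita i)^T) j k = (levi_civita i *m H) k j.
  by rewrite -{1}H_sym -trmx_mul mxE.
rewrite levi_civita_lower (Hs k j) -[LHS]mul1r -half2; ring.
Qed.

Hypothesis pM : forall a f g, p a (f * g) = p a f * g + f * p a g.
Hypothesis p_comm : forall a b f, p a (p b f) = p b (p a f).

Definition levi_civita_curv i j : 'M[A]_n := map_mx (p i) (levi_civita j) - map_mx (p j)
  (levi_civita i) +
  levi_civita j *m levi_civita i - levi_civita i *m levi_civita j.

Lemma levi_civita_curv_anti i j : levi_civita_curv i j = - levi_civita_curv j i.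
Proof. by rewrite /levi_civita_curv; abel. Qed.

Lemma levi_civita_curv_skew i j : levi_civita_curv i j *m H + H *m (levi_civita_curv i j)^T = 0.
Proof.
have E a b : map_mx (p a) (map_mx (p b) H) = map_mx (p a) (levi_civita b) *m H +
    levi_civita b *m (levi_civita a *m H + H *m (levi_civita a)^T) + ((levi_civita a *m H + H
      *m (levi_civita a)^T) *m (levi_civita b)^T +
    H *m (map_mx (p a) (levi_civita b))^T).
  by rewrite levi_civita_metric map_mxD !map_derivM // -!levi_civita_metric map_trmx.
have : map_mx (p i) (map_mx (p j) H) = map_mx (p j) (map_mx (p i) H).
  by apply/matrixP => a b; rewrite !mxE p_comm.
rewrite !E /levi_civita_curv !trmx_add !trmx_opp !trmx_mul.
move: (map_mx (p i) (levi_civita j)) (map_mx (p j) (levi_civita i)) (levi_civita i)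
  (levi_civita j) => dj di ci cj.
rewrite !(mulmxDl, mulmxDr, mulNmx, mulmxN) !mulmxA.
repeat match goal with |- context [mulmx ?a ?b] =>
  let x := fresh in set x := (mulmx a b); clearbody x end.
move=> e; apply/matrixP => a b; have := congr1 (fun M : 'M_n => M a b) e.
by rewrite !mxE => e'; apply: (eq_by_scaling (t := 1) e'); ring.
Qed.

Lemma levi_civita_bianchi i j k :
  row k (levi_civita_curv i j) + row i (levi_civita_curv j k) + row j (levi_civita_curv k i) = 0.
Proof.
have rowE a b c : row c (levi_civita_curv a b) = map_mx (p a) (row c (levi_civita b)) -
    map_mx (p b) (row c (levi_civita a)) + row c (levi_civita b) *m levi_civita a - row c
      (levi_civita a) *m levi_civita b.
  by rewrite /levi_civita_curv !linearD !linearN /= -!map_row -!row_mul.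
rewrite !rowE (levi_civita_sym k j) (levi_civita_sym k i) (levi_civita_sym j i).
by abel.
Qed.

End Christoffel.

(** A map whose components are the functions [x l] pulls functions back by [phi] and
    satisfies the chain rule [chain]; connections and their curvature are pulled back
    accordingly. *)
Section Pullback.
Variables (A' A : comPzRingType) (phi : {rmorphism A' -> A}) (m n : nat).
Variables (p' : 'I_n -> {additive A' -> A'}) (p : 'I_m -> {additive A -> A}).
Hypothesis pM : forall a f g, p a (f * g) = p a f * g + f * p a g.
Hypothesis p_comm : forall a b f, p a (p b f) = p b (p a f).
Variable x : 'I_n -> A.
Hypothesis chain : forall a f, p a (phi f) = \sum_l p a (x l) * phi (p' l f).
Variables (H : 'M[A']_n) (Gam : 'I_n -> 'M[A']_n) (c0 : A').
Hypothesis metric : forall i, map_mx (p' i) H = Gam i *m H + H *m (Gam i)^T.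
Hypothesis torsion : forall i j, row j (Gam i) = row i (Gam j).
Hypothesis curvature : forall i j, map_mx (p' i) (Gam j) - map_mx (p' j) (Gam i) +
  Gam j *m Gam i - Gam i *m Gam j = c0 *: (H *m (delta_mx j i - delta_mx i j)).

Definition pull_jac : 'M[A]_(m, n) := \matrix_(a, l) p a (x l).
Definition pull_conn a : 'M[A]_n := \sum_l pull_jac a l *: map_mx phi (Gam l).
Local Notation T := pull_jac.
Local Notation C := pull_conn.

Let chain_mx a q r (M : 'M[A']_(q, r)) :
  map_mx (p a) (map_mx phi M) = \sum_l T a l *: map_mx phi (map_mx (p' l) M).
Proof.
apply/matrixP => i j; rewrite !mxE chain summxE.
by apply: eq_bigr => l _; rewrite !mxE.
Qed.

Lemma pull_metric a :
  map_mx (p a) (map_mx phi H) = C a *m map_mx phi H + map_mx phi H *m (C a)^T.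
Proof.
rewrite chain_mx /C mulmx_suml raddf_sum mulmx_sumr -big_split.
apply: eq_bigr => l _ /=.
by rewrite metric map_mxD !map_mxM scalerDr trmx_scale map_trmx -scalemxAl -scalemxAr.
Qed.

Lemma pull_torsion a b : row b (cov_row (p a) (C a) T) = row a (cov_row (p b) (C b) T).
Proof.
have rowE a' b' : row b' T *m C a' =
    \sum_l \sum_j (T a' l * T b' j) *: map_mx phi (row j (Gam l)).
  rewrite /C mulmx_sumr; apply: eq_bigr => l _.
  rewrite -scalemxAr mulmx_sum_row scaler_sumr; apply: eq_bigr => j _.
  by rewrite scalerA map_row [row _ _ _ _]mxE.
rewrite /cov_row !linearD /= !row_mul !rowE; congr (_ + _).
  by apply/rowP => k; rewrite !mxE p_comm.
rewrite exchange_big; apply: eq_bigr => j _; apply: eq_bigr => l _.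
by rewrite torsion mulrC.
Qed.

(** The terms with second derivatives of the map cancel, and what remains is the
    contraction of the ambient curvature with the Jacobian. *)
Lemma pull_curvature a b :
  map_mx (p a) (C b) - map_mx (p b) (C a) + C b *m C a - C a *m C b =
  phi c0 *: (map_mx phi H *m ((row b T)^T *m row a T - (row a T)^T *m row b T)).
Proof.
pose D := \sum_l p a (p b (x l)) *: map_mx phi (Gam l).
have dCab : map_mx (p a) (C b) = D +
    \sum_c \sum_k (T b c * T a k) *: map_mx phi (map_mx (p' k) (Gam c)).
  rewrite /C raddf_sum -big_split; apply: eq_bigr => c _ /=.
  rewrite map_derivZ //; congr (_ + _); first by rewrite mxE.
  by rewrite chain_mx scaler_sumr; apply: eq_bigr => k _; rewrite scalerA.
have dCba : map_mx (p b) (C a) = D +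
    \sum_c \sum_k (T a c * T b k) *: map_mx phi (map_mx (p' k) (Gam c)).
  rewrite /C raddf_sum -big_split; apply: eq_bigr => c _ /=.
  rewrite map_derivZ //; congr (_ + _); first by rewrite mxE p_comm.
  by rewrite chain_mx scaler_sumr; apply: eq_bigr => k _; rewrite scalerA.
have prod a' b' : C b' *m C a' = \sum_c \sum_k (T b' c * T a' k) *: map_mx phi (Gam c *m Gam k).
  rewrite /C mulmx_suml; apply: eq_bigr => c _; rewrite mulmx_sumr.
  by apply: eq_bigr => k _; rewrite -scalemxAl -scalemxAr scalerA map_mxM.
have sym (F : 'I_n -> 'I_n -> 'M[A]_n) :
    \sum_c \sum_k (T a c * T b k) *: F c k = \sum_c \sum_k (T b c * T a k) *: F k c.
  rewrite exchange_big; apply: eq_bigr => c _; apply: eq_bigr => k _.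
  by rewrite mulrC.
rewrite dCab dCba !prod !sym.
transitivity (\sum_c \sum_k (T b c * T a k) *: map_mx phi (map_mx (p' k) (Gam c) -
   map_mx (p' c) (Gam k) + Gam c *m Gam k - Gam k *m Gam c)).
  under [RHS]eq_bigr do under eq_bigr do rewrite !(map_mxD, map_mxN) !(scalerDr, scalerN).
  under [RHS]eq_bigr do rewrite !big_split !sumrN.
  rewrite !big_split !sumrN /=.
  move: (D) (\sum_c \sum_k _) (\sum_c \sum_k _) (\sum_c \sum_k _) (\sum_c \sum_k _).
  by move=> D0 x1 x2 x3 x4; abel.
under eq_bigr do under eq_bigr do rewrite curvature map_mxZ scalerA mulrC -scalerA.
under eq_bigr do rewrite -scaler_sumr; rewrite -scaler_sumr; congr (_ *: _).
have outer (u v : 'I_m) : (row u T)^T *m row v T =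
    \sum_c \sum_k (T u c * T v k) *: map_mx phi (delta_mx c k).
  apply/matrixP => i j; rewrite mxE big_ord1 !mxE summxE (bigD1 i) //= summxE (bigD1 j) //=.
  rewrite !mxE !eqxx rmorph1 mulr1 !big1 ?addr0 // => [c ci|k kj].
    by rewrite summxE big1 // => k _; rewrite !mxE eq_sym (negbTE ci) rmorph0 mulr0.
  by rewrite !mxE (eq_sym j) (negbTE kj) andbF rmorph0 mulr0.
rewrite !outer sym -sumrB mulmx_sumr; apply: eq_bigr => c _.
rewrite -sumrB mulmx_sumr; apply: eq_bigr => k _.
by rewrite -scalerBr -map_mxB -scalemxAr map_mxM.
Qed.

End Pullback.

Section Koszul.
Variables (A : comPzRingType) (m n : nat) (p : 'I_m -> {additive A -> A}).
Hypothesis pM : forall a f g, p a (f * g) = p a f * g + f * p a g.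
Variables (C : 'I_m -> 'M[A]_n) (H : 'M[A]_n) (T : 'M[A]_(m, n)) (Gi : 'M[A]_m) (half : A).
Hypothesis half2 : 2 * half = 1.
Hypothesis H_sym : H^T = H.
Hypothesis metric : forall a, map_mx (p a) H = C a *m H + H *m (C a)^T.
Hypothesis torsion : forall a b,
  row b (cov_row (p a) (C a) T) = row a (cov_row (p b) (C b) T).
Local Notation G := (T *m H *m T^T).
Hypothesis GiG : Gi *m G = 1%:M.

(** The tangential part [Y] of the pulled back connection is symmetric and satisfies
    [d G = Y + Y^T], and the Koszul formula recovers it from the derivatives of [G]. *)
Lemma koszul a : cov_row (p a) (C a) T *m H *m T^T = levi_civita p G Gi half a *m G.
Proof.
pose Y a := cov_row (p a) (C a) T *m H *m T^T.
have G_sym : G^T = G by rewrite !trmx_mul trmxK H_sym mulmxA.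
have dG b : map_mx (p b) G = Y b + (Y b)^T.
  rewrite /Y /cov_row !map_derivM // metric !trmx_mul trmxK H_sym -map_trmx trmx_add trmx_mul.
  by rewrite !mulmxDl !mulmxDr !mulmxDl !mulmxA; abel.
have Y_sym b c : row c (Y b) = row b (Y c).
  by rewrite /Y !row_mul torsion.
have pGE b c k : p b (G c k) = Y b c k + Y b k c.
  by have := congr1 (fun M : 'M_m => M c k) (dG b); rewrite !mxE.
have YE b c k : Y b c k = Y c b k.
  by have := congr1 (fun M : 'rV_m => M 0 k) (Y_sym b c); rewrite !mxE.
apply/matrixP => b k; rewrite levi_civita_lower // !pGE (YE b a) (YE k a) (YE k b).
by rewrite -[LHS]mul1r -half2; rewrite -/(Y a); ring.
Qed.

End Koszul.

(** * Two principal curvatures *)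

(** Over the complex numbers a real symmetric matrix is unitarily diagonalisable with
    real eigenvalues. *)
Lemma symmetric_two_eigenvalues (R : rcfType) m (L : 'M[R]_m) (l1 l2 : R) :
  L^T = L -> (forall a, eigenvalue L a -> a = l1 \/ a = l2) ->
  (L - l1%:M) *m (L - l2%:M) = 0.
Proof.
move=> L_sym L_eig; pose f := @real_complex R.
pose M : 'M[R[i]]_m := map_mx f L.
have Mherm : M \is hermsymmx.
  apply: realsym_hermsym.
    by apply/is_hermitianmxP; rewrite expr0 scale1r map_mx_id // /M map_trmx L_sym.
  by apply/mxOverP => i j; rewrite mxE complex_real.
have MP := orthomx_spectralP (hermitian_normalmx Mherm).
have Dreal := hermitian_spectral_diag_real Mherm.
have Pu := spectral_unit M.
move: (spectralmx M) (spectral_diag M) MP Dreal Pu => P D MP Dreal Pu.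
have PM : P *m M = diag_mx D *m P by rewrite MP !mulmxA mulmxV // mul1mx.
have Deig i : D 0 i = f l1 \/ D 0 i = f l2.
  have /mxOverP/(_ 0 i)/complex_realP[r rE] := Dreal.
  rewrite rE; suff /L_eig[->|->] : eigenvalue L r by [left|right].
  rewrite -(eigenvalue_map f) -/M; apply/eigenvalueP; exists (row i P).
    by rewrite -row_mul PM row_mul row_diag_mx -scalemxAl -rowE rE.
  by apply: contraL Pu => /eqP Pi0; rewrite -row_free_unit; apply/row_freePn; exists i;
    rewrite Pi0 sub0mx.
suff M0 : (M - (f l1)%:M) *m (M - (f l2)%:M) = 0.
  apply: (@map_mx_inj _ _ f).
  by rewrite map_mxM !map_mxB !map_scalar_mx map_mx0.
have shift a : M - a%:M = invmx P *m (diag_mx D - a%:M) *m P.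
  by rewrite mulmxBr mulmxBl -MP mul_mx_scalar -scalemxAl mulVmx // scalemx1.
rewrite !shift !mulmxA mulmxK // -(mulmxA (invmx P)).
suff -> : (diag_mx D - (f l1)%:M) *m (diag_mx D - (f l2)%:M) = 0 by rewrite mulmx0 mul0mx.
rewrite -!diag_const_mx -!linearB /= mulmx_diag; apply/matrixP => i j; rewrite !mxE.
by case: (Deig i) => ->; rewrite subrr ?mul0r ?mulr0 mul0rn.
Qed.

(** One of the eigenvalues is [- (Q / 2)]; taking the trace of the quadratic equation of
    [L] expresses the other one through [\tr (L *m L)]. *)
Lemma two_curvatures_quad (R : rcfType) m (L : 'M[R]_m) (q : 'rV[R]_m) (Q l1 l2 : R) :
  0 < Q -> q != 0 -> L^T = L -> \tr L = Q -> 2 *: (q *m L) = - Q *: q ->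
  (forall a, eigenvalue L a -> a = l1 \/ a = l2) ->
  (2 *: L + Q%:M) *m ((m.+2%:R * Q) *: L - (2 * \tr (L *m L) + Q ^+ 2)%:M) = 0.
Proof.
move=> Q0 q0 L_sym L_tr qL L_eig.
have ev : eigenvalue L (- (Q / 2)).
  apply/eigenvalueP; exists q => //; apply: (@scalerI _ _ 2); first by rewrite pnatr_eq0.
  by rewrite qL scalerA; congr (_ *: _); field.
have oppE : - ((- (Q / 2))%:M) = (Q / 2)%:M :> 'M[R]_m.
  by apply/matrixP => i j; rewrite !mxE mulNrn opprK.
have [l Ll] : exists l, (L + (Q / 2)%:M) *m (L - l%:M) = 0.
  have [E|E] := L_eig _ ev.
    exists l2; rewrite -(symmetric_two_eigenvalues L_sym L_eig) -E.
    by rewrite oppE.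
  exists l1; rewrite -(@symmetric_two_eigenvalues _ _ L l2 l1) ?L_sym //; last first.
    by move=> a /L_eig[]; [right|left].
  by rewrite -E oppE.
have m2 : m.+2%:R = 2 + m%:R :> R by rewrite -natrD.
have trE : m.+2%:R * Q * l = 2 * \tr (L *m L) + Q ^+ 2.
  have := congr1 mxtrace Ll; rewrite mulmxDl !mulmxBr mul_mx_scalar !mul_scalar_mx.
  rewrite mxtraceD !linearB /= !mxtraceZ mxtrace0 mxtrace_scalar L_tr -mulr_natl => e.
  by apply: (eq_by_scaling (t := -2) e); rewrite m2; field.
rewrite -trE; have -> : 2 *: L + Q%:M = 2 *: (L + (Q / 2)%:M).
  by rewrite scalerDr scale_scalar_mx mulrC divfK ?pnatr_eq0.
have -> : (m.+2%:R * Q) *: L - (m.+2%:R * Q * l)%:M = (m.+2%:R * Q) *: (L - l%:M).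
  by rewrite scalerBr scale_scalar_mx.
by rewrite -scalemxAl -scalemxAr Ll !scaler0.
Qed.

(** * Constant sectional curvature *)

(** A tensor with the symmetries of a curvature tensor is determined by its sectional
    curvatures. *)
Section CurvatureTensor.
Variables (R : realFieldType) (V : zmodType) (B : V -> V -> V -> V -> R).
Hypothesis add1 : forall u u' v w z, B (u + u') v w z = B u v w z + B u' v w z.
Hypothesis add2 : forall u v v' w z, B u (v + v') w z = B u v w z + B u v' w z.
Hypothesis add3 : forall u v w w' z, B u v (w + w') z = B u v w z + B u v w' z.
Hypothesis add4 : forall u v w z z', B u v w (z + z') = B u v w z + B u v w z'.
Hypothesis skew12 : forall u v w z, B u v w z = - B v u w z.
Hypothesis skew34 : forall u v w z, B u v w z = - B u v z w.
Hypothesis bianchi : forall u v w z, B u v w z + B v w u z + B w u v z = 0.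
Hypothesis sec0 : forall u v, B u v v u = 0.

Lemma pair_sym w u v z : B w u v z = B v z w u.
Proof.
have := bianchi u v w z; have := bianchi v w z u; have := bianchi w z u v;
  have := bianchi z u v w.
have := skew34 u v w z; have := skew34 v w u z; have := skew34 w z v u; have := skew34 z u w v.
have := skew12 u w z v; have := skew34 w u z v; have := skew12 v z u w; have := skew34 z v u w.
have := skew12 z v w u.
lra.
Qed.

(** Polarising [sec0] twice makes [B] skew in all pairs of arguments, so that its first
    three arguments can be permuted cyclically and the Bianchi identity gives [3 B = 0]. *)
Lemma curvature_tensor_eq0 u v w z : B u v w z = 0.
Proof.
have B1 a b c : B a b c a = 0.
  have := sec0 a (b + c); rewrite !add2 !add3 !sec0 => h.
  have := pair_sym a c b a; have := skew12 b a a c; have := skew34 a b a c; lra.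
have B2 a b c e : B a b c e = - B e b c a.
  by have := B1 (a + e) b c; rewrite add1 !add4 !B1 => h; lra.
(* B is unchanged by cyclic permutation of its first three arguments *)
have cyc a b c e : B a b c e = B b c a e.
  by have := B2 a b c e; have := pair_sym e b c a; have := skew34 c a e b;
     have := pair_sym c a b e; have := skew12 e b c a; have := B2 b c a e;
     have := skew12 e c a b; have := pair_sym e c a b; have := skew34 a b e c; lra.
have := bianchi u v w z; rewrite -(cyc u v w z) (cyc w u v z); lra.
Qed.

End CurvatureTensor.

Section ConstantCurvature.
Variables (R : realFieldType) (n : nat) (H : 'M[R]_n) (Om : 'I_n -> 'I_n -> 'M[R]_n) (c : R).
Hypothesis H_sym : H^T = H.
Local Notation dot u v := ((u *m H *m v^T) 0 0).
Hypothesis H_pos : forall u : 'rV_n, u != 0 -> 0 < dot u u.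
Hypothesis Om_anti : forall i j, Om i j = - Om j i.
Hypothesis Om_skew : forall i j, Om i j *m H + H *m (Om i j)^T = 0.
Hypothesis Om_bianchi : forall i j k, row k (Om i j) + row i (Om j k) + row j (Om k i) = 0.

Implicit Types u v w z : 'rV[R]_n.

(** [Om i j] is the curvature operator on coordinate directions [i] and [j], as a matrix
    acting on rows. *)
Definition curv_op (u v : 'rV[R]_n) : 'M[R]_n :=
  \sum_i \sum_j (u 0 i * v 0 j) *: Om i j.

Hypothesis sec : forall u v : 'rV_n, row_free (col_mx u v) ->
  dot (v *m curv_op u v) u / (dot u u * dot v v - dot u v ^+ 2) = c.

Let dotC u v : dot u v = dot v u.
Proof.
transitivity ((u *m H *m v^T)^T 0 0); first by rewrite [RHS]mxE.
by rewrite !trmx_mul trmxK H_sym mulmxA.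
Qed.

Let dotDl u (u' : 'rV_n) v : dot (u + u') v = dot u v + dot u' v.
Proof. by rewrite !mulmxDl mxE. Qed.
Let dotZl a u v : dot (a *: u) v = a * dot u v.
Proof. by rewrite -!scalemxAl mxE. Qed.
Let dotDr u v (v' : 'rV_n) : dot u (v + v') = dot u v + dot u v'.
Proof. by rewrite (dotC u (v + v')) dotDl (dotC v) (dotC v'). Qed.
Let dotZr a u v : dot u (a *: v) = a * dot u v.
Proof. by rewrite (dotC u (a *: v)) dotZl (dotC v). Qed.
Let dotNl u v : dot (- u) v = - dot u v.
Proof. by rewrite -scaleN1r dotZl mulN1r. Qed.

Let dot0l u : dot (0 : 'rV_n) u = 0.
Proof. by rewrite !mul0mx mxE. Qed.

Let curvDl u (u' : 'rV_n) v : curv_op (u + u') v = curv_op u v + curv_op u' v.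
Proof.
rewrite -big_split; apply: eq_bigr => i _; rewrite -big_split; apply: eq_bigr => j _ /=.
by rewrite mxE mulrDl scalerDl.
Qed.

Let curv_anti u v : curv_op u v = - curv_op v u.
Proof.
rewrite /curv_op exchange_big -sumrN; apply: eq_bigr => i _; rewrite -sumrN.
by apply: eq_bigr => j _; rewrite Om_anti scalerN mulrC.
Qed.

Let curvZl a u v : curv_op (a *: u) v = a *: curv_op u v.
Proof.
rewrite scaler_sumr; apply: eq_bigr => i _; rewrite scaler_sumr; apply: eq_bigr => j _ /=.
by rewrite mxE scalerA mulrA.
Qed.

Let curv_skew u v : curv_op u v *m H = - (H *m (curv_op u v)^T).
Proof.
rewrite /curv_op mulmx_suml raddf_sum mulmx_sumr -sumrN; apply: eq_bigr => i _.
rewrite mulmx_suml raddf_sum mulmx_sumr -sumrN; apply: eq_bigr => j _ /=.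
by apply/eqP; rewrite -addr_eq0 trmx_scale -scalemxAl -scalemxAr -scalerDr Om_skew scaler0.
Qed.

Let curv_bianchi u v w : w *m curv_op u v + u *m curv_op v w + v *m curv_op w u = 0.
Proof.
have E a b e : e *m curv_op a b = \sum_i \sum_j \sum_k (a 0 i * b 0 j * e 0 k) *: row k (Om i j).
  rewrite mulmx_sumr; apply: eq_bigr => i _; rewrite mulmx_sumr; apply: eq_bigr => j _.
  rewrite -scalemxAr mulmx_sum_row scaler_sumr; apply: eq_bigr => k _.
  by rewrite scalerA.
have rot (F : 'I_n -> 'I_n -> 'I_n -> 'rV[R]_n) :
    \sum_i \sum_j \sum_k F i j k = \sum_k \sum_i \sum_j F i j k.
  by under eq_bigr do rewrite exchange_big; rewrite exchange_big.
rewrite !E [X in _ + X + _]rot [X in _ + _ + X]rot [X in _ + _ + X]rot -!big_split big1 //= =>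
  i _.
rewrite -!big_split big1 //= => j _; rewrite -!big_split big1 //= => k _.
rewrite -[RHS](scaler0 _ (u 0 i * v 0 j * w 0 k)) -(Om_bianchi i j k) !scalerDr.
by congr (_ + _ *: _ + _ *: _); ring.
Qed.

Let B u v w z := dot (w *m curv_op u v) z - c * (dot v w * dot u z - dot u w * dot v z).

Let sec0 u v : B u v v u = 0.
Proof.
have self t (x : 'rV_n) : curv_op (t *: x) x = 0.
  rewrite curvZl; have := curv_anti x x => /eqP; rewrite -addr_eq0 -mulr2n -scaler_nat.
  by rewrite scaler_eq0 pnatr_eq0 /= => /eqP ->; rewrite scaler0.
have [->|v0] := eqVneq v 0.
  by rewrite /B (mul0mx _ (curv_op u 0)) !dot0l (dotC u 0) dot0l; ring.
have vv := H_pos v0.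
(* only the component [w] of [u] orthogonal to [v] matters *)
pose t := dot u v / dot v v; pose w := u - t *: v.
have wv : dot w v = 0 by rewrite /w dotDl dotNl dotZl /t divfK ?subrr // lt0r_neq0.
have uE : u = t *: v + w by rewrite /w addrC subrK.
clearbody w t.
have [w0|w0] := eqVneq w 0.
  rewrite uE w0 addr0 /B self mulmx0 !mul0mx mxE.
  by rewrite !dotZl !dotZr; ring.
have ww := H_pos w0.
have free : row_free (col_mx u v).
  apply: inj_row_free => x; rewrite -[x]hsubmxK mul_row_col.
  rewrite [lsubmx x]mx11_scalar [rsubmx x]mx11_scalar !mul_scalar_mx.
  move: (lsubmx x 0 0) (rsubmx x 0 0) => a b e.
  have a0 : a = 0.
    have vw : dot v w = 0 by rewrite dotC.
    have uw : dot u w = dot w w by rewrite {1}uE dotDl dotZl vw mulr0 add0r.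
    have := congr1 (fun y : 'rV_n => dot y w) e; rewrite dotDl !dotZl vw uw dot0l mulr0 addr0.
    by move/eqP; rewrite mulf_eq0 (negbTE (lt0r_neq0 ww)) orbF => /eqP.
  move: e; rewrite a0 scale0r add0r => /eqP; rewrite scaler_eq0 (negbTE v0) orbF => /eqP ->.
  by rewrite raddf0 row_mx0.
have det : dot u u * dot v v - dot u v ^+ 2 = dot w w * dot v v.
  rewrite uE !dotDl !dotDr !dotZl !dotZr (dotC v w) wv; ring.
have := sec free; rewrite det => e.
have d0 : dot w w * dot v v != 0 by rewrite mulf_neq0 ?lt0r_neq0.
apply: (eq_by_scaling (t := dot w w * dot v v) e).
rewrite /B (dotC v u); have -> : dot v v * dot u u - dot u v * dot u v = dot w w * dot v v.
  by rewrite -det; ring.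
field.
by rewrite !lt0r_neq0.
Qed.

(** The difference with the model tensor of curvature [c] has the symmetries of a
    curvature tensor, and vanishing sectional curvatures: on independent vectors by
    [sec], and trivially otherwise. *)
Lemma constant_curvature_tensor i j :
  Om i j = c *: (H *m (delta_mx j i - delta_mx i j)).
Proof.
have B0 u v w z : B u v w z = 0.
  apply: (@curvature_tensor_eq0 R 'rV[R]_n B) => //; rewrite /B.
  - by move=> u1 u2 v1 w1 z1; rewrite curvDl mulmxDr !dotDl; ring.
  - move=> u1 v1 v2 w1 z1; rewrite curv_anti curvDl opprD -!(curv_anti u1) mulmxDr !dotDl; ring.
  - by move=> u1 v1 w1 w2 z1; rewrite mulmxDl !dotDl !dotDr; ring.
  - by move=> u1 v1 w1 z1 z2; rewrite !dotDr; ring.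
  - by move=> u1 v1 w1 z1; rewrite curv_anti mulmxN dotNl; ring.
  - move=> u1 v1 w1 z1.
    have -> : dot (w1 *m curv_op u1 v1) z1 = - dot (z1 *m curv_op u1 v1) w1.
      rewrite -(mulmxA w1) curv_skew mulmxN mulNmx mxE dotC; congr (- _).
      by rewrite trmx_mul !mulmxA.
    by ring.
  - move=> u1 v1 w1 z1.
    have := congr1 (fun x => dot x z1) (curv_bianchi u1 v1 w1); rewrite !dotDl => e.
    rewrite dot0l in e; apply: (eq_by_scaling (t := 1) e).
    by rewrite (dotC w1 v1) (dotC w1 u1) (dotC v1 u1); ring.
have curvE : curv_op (delta_mx 0 i) (delta_mx 0 j) = Om i j.
  rewrite /curv_op (bigD1 i) //= (bigD1 j) //= !mxE !eqxx mulr1 scale1r.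
  rewrite !big1 ?addr0 // => [a /negbTE ai|b /negbTE bj].
    by rewrite big1 // => b _; rewrite !mxE ai andbF mul0r scale0r.
  by rewrite !mxE bj andbF mulr0 scale0r.
apply/eqP; rewrite -subr_eq0; apply/eqP/row_matrixP => k; rewrite row0.
set X := _ - _; apply/eqP/negPn/negP => /H_pos;
  suff -> : dot (row k X) (row k X) = 0 by rewrite ltxx.
have prod w z (x y : 'rV_n) : dot (w *m (H *m (x^T *m y))) z = dot x w * dot y z.
  by rewrite !mulmxA [w *m H *m x^T]mx11_scalar mul_scalar_mx dotZl (dotC w).
have deltaE a b : delta_mx a b = (delta_mx 0 a : 'rV_n)^T *m (delta_mx 0 b : 'rV_n) :> 'M[R]_n.
  by rewrite trmx_delta mul_delta_mx.
rewrite {1}rowE; move: (row k X) => z;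
  rewrite /X mulmxBr -scalemxAr !mulmxBr dotDl dotNl dotZl dotDl dotNl.
rewrite !deltaE !prod; have := B0 (delta_mx 0 i) (delta_mx 0 j) (delta_mx 0 k) z;
  rewrite /B curvE => e.
by apply: (eq_by_scaling (t := 1) e); ring.
Qed.

End ConstantCurvature.

(** * Calculus of smooth maps *)

Local Open Scope classical_set_scope.
Local Open Scope ring_scope.

Lemma near_eq_differentiable (R : numFieldType) (V W : normedModType R)
    (f g : V -> W) (x : V) :
  (\near x, f x = g x) -> differentiable f x -> differentiable g x.
Proof.
move=> fg fx; have fgx : f x = g x by exact: nbhs_singleton fg.
have dfc := diff_continuous fx.
suff e : g \o shift x = cst (g x) + 'd f x +o_ 0 id.
  by apply/diff_locallyP; rewrite (diff_unique dfc e).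
apply/eqaddoP => _/posnumP[eps].
have /eqaddoP/(_ _ (gt0 eps)) h := diff_locally fx.
have fg0 : \forall y \near (0 : V), f (y + x) = g (y + x).
  by move: fg; rewrite (near_shift 0 x) /= subr0.
near=> y.
have fgy : f (y + x) = g (y + x) by near: y.
have -> : (g \o shift x - (cst (g x) + 'd f x)) y = (f \o shift x - (cst (f x) + 'd f x)) y.
  by rewrite -[LHS]/(g (y + x) - (g x + 'd f x y)) -fgx -fgy.
by near: y; exact: h.
Unshelve. all: by end_near. Qed.

Section Ck.
Context {R : realType} {n : nat}.
Implicit Types (U : set 'rV[R]_n) (W : normedModType R).

Lemma Ck_on_eq W k U (f g : 'rV[R]_n -> W) : open U ->
  (forall x, U x -> f x = g x) -> Ck_on k U f -> Ck_on k U g.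
Proof.
move=> oU; elim: k f g => [|k IH] f g fg.
  move=> cf x Ux; have fgx : \near x, f x = g x.
    by near=> y; apply: fg; near: y; exact: open_nbhs_nbhs.
  have cfx := cf x Ux; rewrite /prop_for /continuous_at -fg //.
  by apply: cvg_trans cfx; exact: (near_eq_cvg fgx).
have fgn x : U x -> \near x, f x = g x.
  by move=> Ux; near=> y; apply: fg; near: y; exact: open_nbhs_nbhs.
move=> [df Df]; split=> [x Ux|v].
  by apply: near_eq_differentiable (df x Ux); exact: fgn.
apply: (IH (fun x => 'D_v f x)) (Df v) => x Ux.
by apply: near_eq_derive; exact: fgn.
Unshelve. all: by end_near. Qed.

Lemma Ck_onS W k U (f : 'rV[R]_n -> W) : Ck_on k.+1 U f -> Ck_on k U f.
Proof.
elim: k f => [|k IH] f [df Df].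
  by move=> x Ux; apply: differentiable_continuous; exact: df.
by split=> // v; apply: IH; exact: Df.
Qed.

Lemma Ck_on_cst W k U (c : W) : Ck_on k U (fun=> c).
Proof.
elim: k c => [|k IH] c; first by move=> x _; exact: cst_continuous.
split=> [x _|v]; first exact: differentiable_cst.
have -> : (fun x => 'D_v (fun=> c) x) = (fun=> 0) :> ('rV[R]_n -> W).
  by apply/funext => x; rewrite derive_cst.
exact: IH.
Qed.

Lemma Ck_onD W k U (f g : 'rV[R]_n -> W) : open U ->
  Ck_on k U f -> Ck_on k U g -> Ck_on k U (fun x => f x + g x).
Proof.
move=> oU; elim: k f g => [|k IH] f g.
  by move=> cf cg x Ux; apply: continuousD; [exact: cf|exact: cg].
move=> [df Df] [dg Dg]; split=> [x Ux|v].
  by apply: differentiableD; [exact: df|exact: dg].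
apply: (Ck_on_eq oU _ (IH _ _ (Df v) (Dg v))) => x Ux.
by rewrite deriveD //; apply: diff_derivable; [exact: df|exact: dg].
Qed.

Lemma Ck_onM k U (f g : 'rV[R]_n -> R) : open U ->
  Ck_on k U f -> Ck_on k U g -> Ck_on k U (fun x => f x * g x).
Proof.
move=> oU; elim: k f g => [|k IH] f g.
  by move=> cf cg x Ux; apply: continuousM; [exact: cf|exact: cg].
move=> Cf Cg; have [[df Df] [dg Dg]] := (Cf, Cg); split=> [x Ux|v].
  by apply: differentiableM; [exact: df|exact: dg].
apply: (Ck_on_eq oU _ (Ck_onD oU (IH _ _ (Ck_onS Cf) (Dg v)) (IH _ _ (Ck_onS Cg) (Df v)))) => x
  Ux.
by rewrite deriveM //; apply: diff_derivable; [exact: df|exact: dg].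
Qed.

Lemma Ck_onV k U (f : 'rV[R]_n -> R) : open U -> (forall x, U x -> f x != 0) ->
  Ck_on k U f -> Ck_on k U (fun x => (f x)^-1).
Proof.
move=> oU f0; elim: k f f0 => [|k IH] f f0.
  by move=> cf x Ux; apply: continuousV; [exact: f0|exact: cf].
move=> Cf; have [df Df] := Cf; split=> [x Ux|v].
  by apply: differentiableV; [exact: df|exact: f0].
have Ci := IH _ f0 (Ck_onS Cf).
have C1 : Ck_on k U (fun=> -1 : R) by exact: Ck_on_cst.
apply: (Ck_on_eq oU _ (Ck_onM oU (Ck_onM oU C1 (Ck_onM oU Ci Ci)) (Df v))) => x Ux.
rewrite deriveV; [|exact: f0|by apply: diff_derivable; exact: df].
by rewrite -exprVn expr2 mulN1r.
Qed.

Lemma Ck_on_sum W k U I (r : seq I) (f : I -> 'rV[R]_n -> W) : open U ->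
  (forall i, Ck_on k U (f i)) -> Ck_on k U (fun x => \sum_(i <- r) f i x).
Proof.
move=> oU Cf; elim: r => [|i r IHr].
  by apply: (Ck_on_eq oU _ (Ck_on_cst k U 0)) => x _; rewrite big_nil.
by apply: (Ck_on_eq oU _ (Ck_onD oU (Cf i) IHr)) => x _; rewrite big_cons.
Qed.

Lemma Ck_on_coord p q k U (f : 'rV[R]_n -> 'M[R]_(p, q)) i j : open U ->
  Ck_on k U f -> Ck_on k U (fun x => f x i j).
Proof.
move=> oU; elim: k f => [|k IH] f.
  move=> cf x Ux; apply: (@continuous_comp _ _ _ f (fun M => M i j)); first exact: cf.
  exact: coord_continuous.
move=> [df Df]; split=> [x Ux|v].
  apply: (@differentiable_comp _ _ _ _ f (fun M : 'M[R]_(p, q) => M i j)); first exact: df.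
  exact: differentiable_coord.
apply: (Ck_on_eq oU _ (IH _ (Df v))) => x Ux.
by rewrite derive_mx ?mxE //; apply: diff_derivable; exact: df.
Qed.

Lemma derive_coord p q (f : 'rV[R]_n -> 'M[R]_(p, q)) x v i j :
  differentiable f x -> 'D_v (fun x => f x i j) x = ('D_v f x) i j.
Proof. by move=> df; rewrite derive_mx ?mxE //; exact: diff_derivable. Qed.

Lemma derive_delta W (f : 'rV[R]_n -> W) x v : differentiable f x ->
  'D_v f x = \sum_l v 0 l *: 'D_(delta_mx 0 l) f x.
Proof.
move=> df; rewrite deriveE // {1}[v]row_sum_delta linear_sum.
by apply: eq_bigr => l _; rewrite linearZ deriveE.
Qed.

Lemma is_derive_line W (f : 'rV[R]_n -> W) (y u : 'rV[R]_n) (t : R) :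
  differentiable f (t *: u + y) ->
  is_derive t 1 (fun s : R => f (s *: u + y)) ('D_u f (t *: u + y)).
Proof.
move=> df; have fE : (fun h : R => h^-1 *: (f ((h *: 1 + t) *: u + y) - f (t *: u + y))) =
    (fun h : R => h^-1 *: (f (h *: u + (t *: u + y)) - f (t *: u + y))).
  by apply/funext => h; rewrite scalerDl addrA [h *: 1]mulr1.
apply: DeriveDef; first by rewrite /derivable fE; exact: diff_derivable.
by rewrite /derive fE.
Qed.

(** The mean value theorem along [u] reduces the second difference to a difference of
    values of ['D_u f], which its differentiability at [x] controls. *)
Lemma second_difference U (f : 'rV[R]_n -> R) x u v (eps : R) : open U -> U x ->
  (forall y, U y -> differentiable f y) -> differentiable (fun y => 'D_u f y) x ->
  0 < eps -> exists2 r : R, 0 < r & forall s, 0 < s -> s < r ->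
  `|f (s *: u + (s *: v + x)) - f (s *: u + x) - f (s *: v + x) + f x
    - s ^+ 2 * 'D_v (fun y => 'D_u f y) x| <= eps * s ^+ 2.
Proof.
move=> oU Ux df dg eps0; pose g y := 'D_u f y; pose K := `|u| + `|v| + 1.
have K0 : 0 < K by rewrite /K ltr_wpDl // addr_ge0.
have e0 : 0 < eps / (2 * K) by rewrite divr_gt0 ?mulr_gt0.
have /eqaddoP/(_ _ e0) H1 := diff_locally dg.
have H2 : \forall h \near (0 : 'rV[R]_n), U (h + x).
  have : \forall y \near x, U y by exact: open_nbhs_nbhs.
  by rewrite (near_shift 0 x) /= subr0.
have : \forall h \near (0 : 'rV[R]_n), U (h + x) /\
    `|g (h + x) - (g x + 'd g x h)| <= eps / (2 * K) * `|h|.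
  by near=> h; split; near: h; [exact: H2|exact: H1].
move=> /nbhs_norm0P[r /= r0 Hr].
exists (r / K); first exact: divr_gt0.
move=> s s0 sr; have sK : s * K < r by rewrite -ltr_pdivlMr.
have hu t : 0 <= t -> t <= s -> `|t *: u| <= s * K.
  move=> t0 ts; rewrite normrZ ger0_norm //; apply: ler_pM => //.
  by rewrite /K -addrA lerDl addr_ge0.
have huv t : 0 <= t -> t <= s -> `|t *: u + s *: v| <= s * K.
  move=> t0 ts; apply: (le_trans (ler_normD _ _));
    rewrite !normrZ (ger0_norm t0) (ger0_norm (ltW s0)).
  apply: (@le_trans _ _ (s * `|u| + s * `|v|)); first by rewrite lerD2r ler_wpM2r.
  by rewrite -mulrDr; apply: ler_wpM2l; rewrite ?(ltW s0) // /K lerDl.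
pose phi t := f (t *: u + (s *: v + x)) - f (t *: u + x).
pose phi' t := g (t *: u + (s *: v + x)) - g (t *: u + x).
have Uu t : 0 <= t -> t <= s -> U (t *: u + x).
  by move=> t0 ts; apply: (Hr _ (le_lt_trans (hu t t0 ts) sK)).1.
have Uuv t : 0 <= t -> t <= s -> U (t *: u + (s *: v + x)).
  by move=> t0 ts; rewrite addrA; apply: (Hr _ (le_lt_trans (huv t t0 ts) sK)).1.
have dphi t : 0 <= t -> t <= s -> is_derive t 1 phi (phi' t).
  by move=> t0 ts; apply: is_deriveB; apply: is_derive_line; apply: df; [exact: Uuv|exact: Uu].
have [c] : exists2 c, c \in `]0, s[ & phi s - phi 0 = phi' c * (s - 0).
  apply: MVT => // [t|].
    by rewrite in_itv /= => /andP[t0 ts]; apply: dphi; exact: ltW.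
  apply: derivable_within_continuous => t; rewrite in_itv /= => /andP[t0 ts].
  by case: (dphi t t0 ts).
rewrite in_itv /= subr0 => /andP[/ltW c0 /ltW cs] phiE.
have -> : f (s *: u + (s *: v + x)) - f (s *: u + x) - f (s *: v + x) + f x = phi' c * s.
  by rewrite -phiE /phi !scale0r !add0r; ring.
have Dg : 'D_v g x = 'd g x v by exact: deriveE.
have [_ b1] := Hr _ (le_lt_trans (huv c c0 cs) sK).
have [_ b2] := Hr _ (le_lt_trans (hu c c0 cs) sK).
have lin : 'd g x (c *: u + s *: v) = 'd g x (c *: u) + s *: 'D_v g x.
  by rewrite linearD; congr (_ + _); rewrite linearZ Dg.
rewrite lin in b1.
have c1 := le_trans b1 (ler_wpM2l (ltW e0) (huv c c0 cs)).
have c2 := le_trans b2 (ler_wpM2l (ltW e0) (hu c c0 cs)).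
have e2 : eps / (2 * K) * (s * K) = eps * s / 2 by field; rewrite lt0r_neq0.
rewrite {}e2 in c1 c2.
have -> : phi' c * s - s ^+ 2 * 'D_v g x = s * (phi' c - s * 'D_v g x) by ring.
rewrite normrM (ger0_norm (ltW s0)) expr2 mulrCA; apply: ler_wpM2l; first exact: ltW.
rewrite /phi' addrA; move: c1 c2; set g1 := g (_ + _ + _); set g2 := g (c *: u + x);
  set d1 := 'd g x _.
move=> c1 c2; rewrite (_ : _ - _ = (g1 - (g x + (d1 + s *: 'D_v g x))) - (g2 - (g x + d1)));
  last first.
  by rewrite (_ : s *: (_ : R^o) = s * 'D_v g x) //; ring.
apply: (le_trans (ler_normB _ _)); rewrite (_ : eps * s = eps * s / 2 + eps * s / 2);
  last by field.
exact: lerD.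
Unshelve. all: by end_near. Qed.

(** Schwarz's theorem: the second difference is symmetric in [u] and [v], so both mixed
    derivatives approximate it. *)
Lemma derive_comm U (f : 'rV[R]_n -> R) u v x : open U -> U x -> Ck_on 2 U f ->
  'D_v (fun y => 'D_u f y) x = 'D_u (fun y => 'D_v f y) x.
Proof.
move=> oU Ux [df Df]; apply/eqP; rewrite -subr_eq0 -normr_le0; apply/ler_addgt0Pr => e e0;
  rewrite add0r.
have e20 : 0 < e / 2 by rewrite divr_gt0.
have [r1 r10 H1] := second_difference v oU Ux df ((Df u).1 x Ux) e20.
have [r2 r20 H2] := second_difference u oU Ux df ((Df v).1 x Ux) e20.
pose s := Num.min r1 r2 / 2.
have s0 : 0 < s by rewrite divr_gt0 // lt_min r10.
have m0 : 0 < Num.min r1 r2 by rewrite lt_min r10.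
have sm : s < Num.min r1 r2 by rewrite /s ltr_pdivrMr // ltr_pMr // ltr1n.
have := H1 s s0; have := H2 s s0; move: sm; rewrite lt_min => /andP[s1 s2] /(_ s2) h2 /(_ s1) h1.
have s20 : 0 < s ^+ 2 by rewrite exprn_gt0.
rewrite -(ler_pM2r s20).
move: h1 h2; rewrite (addrCA (s *: v)).
set A := f _; set B := f _; set C := f _; set a := 'D_v _ x; set b := 'D_u _ x => h1 h2.
have -> : `|a - b| * s ^+ 2 = `|(A - C - B + f x - s ^+ 2 * b) - (A - B - C + f x - s ^+ 2 * a)|.
  by rewrite -{1}(ger0_norm (ltW s20)) -normrM; congr `|_|; ring.
apply: (le_trans (ler_normB _ _)).
by have := lerD h2 h1; rewrite -mulrDl -splitr.
Qed.

End Ck.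

Section Composition.
Context {R : realType} {m n : nat}.
Variables (W : set 'rV[R]_m) (U : set 'rV[R]_n) (F : 'rV[R]_m -> 'rV[R]_n).
Hypothesis oW : open W.
Hypothesis FU : forall x, W x -> U (F x).

Lemma derive_comp (f : 'rV[R]_n -> R) x v :
  differentiable F x -> differentiable f (F x) ->
  'D_v (fun y => f (F y)) x =
  \sum_l 'D_v (fun y => F y 0 l) x * 'D_(delta_mx 0 l) f (F x).
Proof.
move=> dF df; rewrite deriveE; last exact: (@differentiable_comp _ _ _ _ F f).
rewrite (@diff_comp _ _ _ _ F f) //= -!deriveE //.
by rewrite derive_delta //; apply: eq_bigr => l _; rewrite derive_coord.
Qed.

Lemma Ck_on_comp k (f : 'rV[R]_n -> R) :
  Ck_on k W F -> Ck_on k U f -> Ck_on k W (fun x => f (F x)).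
Proof.
elim: k f => [|k IH] f.
  move=> cF cf x Wx; apply: (@continuous_comp _ _ _ F f); first exact: cF.
  exact: (cf _ (FU Wx)).
move=> CF [df Df]; have [dF DF] := CF; split=> [x Wx|v].
  by apply: (@differentiable_comp _ _ _ _ F f); [exact: dF|apply: df; exact: FU].
apply: (@Ck_on_eq _ _ _ k W (fun x => \sum_l ('D_v F x) 0 l * 'D_(delta_mx 0 l) f (F x))) => //.
  move=> x Wx; rewrite derive_comp; [|exact: dF|by apply: df; exact: FU].
  by apply: eq_bigr => l _; rewrite derive_coord //; exact: dF.
apply: Ck_on_sum => // l; apply: Ck_onM => //.
  by apply: Ck_on_coord => //; exact: DF.
by apply: (IH (fun y => 'D_(delta_mx 0 l) f y)); [exact: Ck_onS|exact: Df].
Qed.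

End Composition.

(** * The ring of smooth functions on an open set *)

Record openset (R : realType) (n : nat) := OpenSet {
  oset :> set 'rV[R]_n;
  osetP : open oset
}.

Section SmoothRing.
Context {R : realType} {n : nat}.
Variable W : openset R n.

Definition opoint := {x : 'rV[R]_n | oset W x}.

(** Functions on the points of [W], so that equality in the ring is equality on [W]; they
    are restrictions of functions smooth on [W], so that they can be differentiated. *)
Definition extends_smoothly : {pred opoint -> R} :=
  fun f => `[< exists2 g : 'rV[R]_n -> R, smooth_on W g & forall x, f x = g (sval x) >].

Fact extends_smoothly_subring : subring_closed extends_smoothly.
Proof.
have oW := @osetP _ _ W; split.
- apply/asboolP; exists (fun=> 1) => // k; exact: Ck_on_cst.
- move=> f g /asboolP[f' sf fE] /asboolP[g' sg gE]; apply/asboolP.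
  exists (fun x => f' x + -1 * g' x) => [k|x].
    by apply: Ck_onD => //; apply: Ck_onM => //; exact: Ck_on_cst.
  by rewrite mulN1r -fE -gE.
- move=> f g /asboolP[f' sf fE] /asboolP[g' sg gE]; apply/asboolP.
  exists (fun x => f' x * g' x) => [k|x]; first exact: Ck_onM.
  by rewrite -fE -gE.
Qed.

HB.instance Definition _ :=
  GRing.isSubringClosed.Build (opoint -> R) extends_smoothly extends_smoothly_subring.

Record sfun := SFun { sfun_val : opoint -> R; _ : sfun_val \in extends_smoothly }.

HB.instance Definition _ := [isSub of sfun for sfun_val].
HB.instance Definition _ := [Choice of sfun by <:].
HB.instance Definition _ := GRing.SubChoice_isSubComPzRing.Build (opoint -> R) extends_smoothly
  sfun extends_smoothly_subring.

Definition seval (x : opoint) (f : sfun) : R := sfun_val f x.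

Fact seval_zmod x : zmod_morphism (seval x).
Proof. by move=> f g; have /(congr1 (fun h : opoint -> R => h x)) := raddfB (val : sfun -> _) f
  g. Qed.
Fact seval_monoid x : monoid_morphism (seval x).
Proof.
split=> [|f g].
  by have /(congr1 (fun h : opoint -> R => h x)) := rmorph1 (val : sfun -> _).
by have /(congr1 (fun h : opoint -> R => h x)) := rmorphM (val : sfun -> _) f g.
Qed.
HB.instance Definition _ x := GRing.isZmodMorphism.Build sfun R (seval x) (seval_zmod x).
HB.instance Definition _ x := GRing.isMonoidMorphism.Build sfun R (seval x) (seval_monoid x).

Lemma seval_inj f g : (forall x, seval x f = seval x g) -> f = g.
Proof. by move=> fg; apply/val_inj/funext. Qed.

Lemma sfun_of_subproof (g : 'rV[R]_n -> R) : smooth_on W g ->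
  (fun x : opoint => g (sval x)) \in extends_smoothly.
Proof. by move=> sg; apply/asboolP; exists g. Qed.

Definition sfun_of g (sg : smooth_on W g) : sfun := SFun (sfun_of_subproof sg).

Lemma seval_of g (sg : smooth_on W g) x : seval x (sfun_of sg) = g (sval x).
Proof. by []. Qed.

Lemma sfun_rep_subproof (f : sfun) :
  exists g : 'rV[R]_n -> R, smooth_on W g /\ forall x, sfun_val f x = g (sval x).
Proof. by case: f => f /= /asboolP[g sg fE]; exists g. Qed.

(** The derivative is computed on a chosen extension to the whole space; by
    [seval_sderiv] the choice does not matter. *)
Definition sfun_rep f : 'rV[R]_n -> R := sval (cid (sfun_rep_subproof f)).

Lemma sfun_rep_smooth f : smooth_on W (sfun_rep f).
Proof. exact: (svalP (cid (sfun_rep_subproof f))).1. Qed.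

Lemma sfun_repE f x : sfun_rep f (sval x) = seval x f.
Proof. exact/esym/(svalP (cid (sfun_rep_subproof f))).2. Qed.

Lemma smooth_derive (g : 'rV[R]_n -> R) v : smooth_on W g -> smooth_on W (fun x => 'D_v g x).
Proof. by move=> sg k; have [_] := sg k.+1; exact. Qed.

Definition sderiv (v : 'rV[R]_n) (f : sfun) : sfun := sfun_of (smooth_derive v (sfun_rep_smooth
  f)).

Lemma seval_sderiv_near v f g x : (forall y, oset W y -> g y = sfun_rep f y) ->
  seval x (sderiv v f) = 'D_v g (sval x).
Proof.
move=> gE; rewrite /sderiv seval_of; apply: near_eq_derive; near=> y; apply/esym/gE.
by near: y; apply: open_nbhs_nbhs; split; [exact: osetP|exact: svalP x].
Unshelve. all: by end_near. Qed.

Lemma seval_sderiv v f g x : (forall y, seval y f = g (sval y)) ->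
  seval x (sderiv v f) = 'D_v g (sval x).
Proof.
move=> gE; apply: seval_sderiv_near => y Wy;
  exact/esym/(eq_trans (sfun_repE f (exist _ y Wy)))/gE.
Qed.

Lemma smooth_differentiable (W' : normedModType R) (g : 'rV[R]_n -> W') x : smooth_on W g ->
  oset W x -> differentiable g x.
Proof. by move=> sg; have [h _] := sg 1; exact: h. Qed.

Let sfun_rep_diff f (x : opoint) : differentiable (sfun_rep f) (sval x).
Proof. by apply: (smooth_differentiable (sfun_rep_smooth f)); exact: svalP x. Qed.

Fact sderiv_zmod v : zmod_morphism (sderiv v).
Proof.
move=> f g; apply: seval_inj => x.
rewrite raddfB (@seval_sderiv v (f - g) (fun y => sfun_rep f y - sfun_rep g y)); last first.
  by move=> y; rewrite raddfB !sfun_repE.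
by rewrite deriveB //; exact/diff_derivable/sfun_rep_diff.
Qed.
HB.instance Definition _ v := GRing.isZmodMorphism.Build sfun sfun (sderiv v) (sderiv_zmod v).

Lemma sderivM v f g : sderiv v (f * g) = sderiv v f * g + f * sderiv v g.
Proof.
apply: seval_inj => x.
have Dx h : seval x (sderiv v h) = 'D_v (sfun_rep h) (sval x) by [].
rewrite rmorphD !rmorphM (@seval_sderiv v (f * g) (fun y => sfun_rep f y * sfun_rep g y));
  last first.
  by move=> y; rewrite rmorphM !sfun_repE.
rewrite deriveM; [|exact/diff_derivable/sfun_rep_diff..].
rewrite -[RHS]/(seval x (sderiv v f) * seval x g + seval x f * seval x (sderiv v g)) !Dx
  -!sfun_repE.
by rewrite addrC; congr (_ + _); exact: mulrC.
Qed.

Lemma sderiv_comm u v f : sderiv u (sderiv v f) = sderiv v (sderiv u f).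
Proof.
apply: seval_inj => x.
have E w w' : seval x (sderiv w (sderiv w' f)) = 'D_w (fun y => 'D_w' (sfun_rep f) y) (sval x).
  exact: seval_sderiv.
transitivity ('D_u (fun y => 'D_v (sfun_rep f) y) (sval x)); first exact: E.
transitivity ('D_v (fun y => 'D_u (sfun_rep f) y) (sval x)); last exact/esym/E.
by apply: (derive_comm _ _ (@osetP _ _ W)); [exact: svalP x|exact: sfun_rep_smooth].
Qed.

Definition sconst (c : R) : sfun := @sfun_of (fun=> c) (fun k => Ck_on_cst k W c).

Lemma seval_const x c : seval x (sconst c) = c.
Proof. by []. Qed.

Lemma sderiv_const v c : sderiv v (sconst c) = 0.
Proof.
apply: seval_inj => x; rewrite (@seval_sderiv v (sconst c) (fun=> c)) //.
by rewrite derive_cst rmorph0.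
Qed.

Lemma nonvanishing_unit f : (forall x, seval x f != 0) -> exists g, f * g = 1.
Proof.
move=> f0; have sV : smooth_on W (fun x => (sfun_rep f x)^-1).
  move=> k; apply: Ck_onV (sfun_rep_smooth f k); first exact: osetP.
  by move=> x Wx; have := f0 (exist _ x Wx); rewrite -sfun_repE.
exists (sfun_of sV); apply: seval_inj => x.
by rewrite rmorphM rmorph1 [X in _ * X]seval_of sfun_repE mulfV ?f0.
Qed.

End SmoothRing.

(** A smooth map [F] from [W] to [U] induces a ring morphism from functions on [U] to
    functions on [W]. *)
Section SmoothPullback.
Context {R : realType} {m n : nat}.
Variables (W : openset R m) (U : openset R n) (F : 'rV[R]_m -> 'rV[R]_n).
Hypothesis FU : forall x, oset W x -> oset U (F x).
Hypothesis sF : smooth_on W F.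

Definition point_map (x : opoint W) : opoint U := exist _ (F (sval x)) (FU (svalP x)).

Fact pullback_smooth (f : sfun U) : smooth_on W (fun x => sfun_rep f (F x)).
Proof. by move=> k; apply: (Ck_on_comp (@osetP _ _ W) FU (sF k)); exact: sfun_rep_smooth. Qed.

Definition pullback (f : sfun U) : sfun W := sfun_of (pullback_smooth f).

Lemma seval_pullback x f : seval x (pullback f) = seval (point_map x) f.
Proof. exact: (sfun_repE f (point_map x)). Qed.

Fact pullback_zmod : zmod_morphism pullback.
Proof.
move=> f g; apply: seval_inj => x; rewrite seval_pullback.
rewrite (raddfB (seval (point_map x))) (raddfB (seval x)).
by congr (_ - _); exact/esym/seval_pullback.
Qed.
Fact pullback_monoid : monoid_morphism pullback.
Proof.
split=> [|f g]; apply: seval_inj => x; rewrite seval_pullback.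
  by rewrite (rmorph1 (seval (point_map x))) (rmorph1 (seval x)).
rewrite (rmorphM (seval (point_map x))) (rmorphM (seval x)).
by congr (_ * _); exact/esym/seval_pullback.
Qed.
HB.instance Definition _ := GRing.isZmodMorphism.Build _ _ pullback pullback_zmod.
HB.instance Definition _ := GRing.isMonoidMorphism.Build _ _ pullback pullback_monoid.

Fact coordinate_smooth l : smooth_on W (fun x => F x 0 l).
Proof. by move=> k; apply: Ck_on_coord (sF k); exact: osetP. Qed.

Definition coordinate l : sfun W := sfun_of (coordinate_smooth l).

Lemma pullback_chain v f :
  sderiv v (pullback f) = \sum_l sderiv v (coordinate l) * pullback (sderiv (delta_mx 0 l) f).
Proof.
apply: seval_inj => x; rewrite (@seval_sderiv _ _ _ v _ (fun y => sfun_rep f (F y))) //.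
rewrite rmorph_sum derive_comp.
- apply: eq_bigr => l _; rewrite rmorphM; congr (_ * _).
    by rewrite [RHS](@seval_sderiv _ _ _ v _ (fun y => F y 0 l)).
  by rewrite [RHS]seval_pullback.
- exact: (smooth_differentiable sF (svalP x)).
- exact: (smooth_differentiable (sfun_rep_smooth f) (FU (svalP x))).
Qed.

End SmoothPullback.

Section Evaluation.
Context {R : realType} {p : nat}.
Variable W : openset R p.
Definition partial (i : 'I_p) : {additive sfun W -> sfun W} := sderiv (delta_mx 0 i).

Lemma partialM i f g : partial i (f * g) = partial i f * g + f * partial i g.
Proof. exact: sderivM. Qed.

Lemma partial_comm i j f : partial i (partial j f) = partial j (partial i f).
Proof. exact: sderiv_comm. Qed.

Definition has_values q r (Y : 'rV[R]_p -> 'M[R]_(q, r)) (xi : 'M[sfun W]_(q, r)) :=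
  forall x, map_mx (seval x) xi = Y (sval x).

Lemma has_values_derive q r (Y : 'rV[R]_p -> 'M[R]_(q, r)) xi u x : has_values Y xi ->
  'D_u Y (sval x) = \sum_i u 0 i *: map_mx (seval x) (map_mx (partial i) xi).
Proof.
move=> YE.
have near_rep i j : \forall y \near sval x, sfun_rep (xi i j) y = Y y i j.
  near=> y; have Wy : oset W y.
    by near: y; apply: open_nbhs_nbhs; split; [exact: osetP|exact: svalP x].
  have := YE (exist _ y Wy) => /matrixP/(_ i j) /=; rewrite mxE => <-.
  exact: (sfun_repE _ (exist _ y Wy)).
have dif i j : differentiable (sfun_rep (xi i j)) (sval x).
  exact: (smooth_differentiable (sfun_rep_smooth _) (svalP x)).
rewrite derive_mx; last first.
  apply/derivable_mxP => i j; apply: (near_eq_derivable (near_rep i j)).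
  exact: diff_derivable.
apply/matrixP => i j; rewrite mxE summxE -(near_eq_derive _ (near_rep i j)).
rewrite derive_delta //; apply: eq_bigr => l _.
by rewrite !mxE.
Unshelve. all: by end_near. Qed.

(** The Levi-Civita connection computed in the ring of smooth functions has the values of
    the one defined pointwise. *)
Section Levi.
Variables (G0 : 'rV[R]_p -> 'M[R]_p) (G Gi : 'M[sfun W]_p).
Hypothesis G0E : has_values G0 G.
Hypothesis GiG : Gi *m G = 1%:M.
Definition shalf : sfun W := sconst W 2^-1.

Lemma shalf2 : 2 * shalf = 1.
Proof.
apply: seval_inj => x; rewrite rmorphM rmorph_nat rmorph1 [X in _ * X]seval_const.
by rewrite mulfV // pnatr_eq0.
Qed.

Local Notation Lev := (levi_civita partial G Gi shalf).

Lemma eval_metric_inv x : map_mx (seval x) Gi = invmx (G0 (sval x)).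
Proof.
have e : map_mx (seval x) Gi *m G0 (sval x) = 1%:M.
  by rewrite -G0E -map_mxM GiG map_mx1.
have [_ u] := mulmx1_unit e.
by rewrite -[LHS]mulmx1 -(mulmxV u) mulmxA e mul1mx.
Qed.

Lemma eval_christoffel x i j k : seval x (Lev i j k) = christoffel G0 (sval x) i j k.
Proof.
rewrite mxE rmorphM rmorph_sum [X in X * _]seval_const; congr (_ * _).
apply: eq_bigr => l _; rewrite rmorphM; congr (_ * _).
  by rewrite -eval_metric_inv mxE.
have gE a b c : seval x (partial a (G b c)) = gram_deriv G0 (sval x) a b c.
  apply: seval_sderiv => y; by rewrite -G0E mxE.
by rewrite rmorphB rmorphD -!gE.
Qed.

Lemma eval_Gamma x u v :
  Gamma G0 (sval x) u v = v *m \sum_i u 0 i *: map_mx (seval x) (Lev i).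
Proof.
apply/rowP => k; rewrite mxE mulmx_sumr summxE; apply: eq_bigr => i _.
rewrite -scalemxAr mxE mxE mulr_sumr; apply: eq_bigr => j _.
by rewrite [X in _ = _ * (_ * X)]mxE [X in _ = _ * (_ * X)]eval_christoffel mulrA.
Qed.

Lemma eval_nabla x u Y (xi : 'rV_p) : has_values Y xi ->
  nabla G0 u Y (sval x) = \sum_i u 0 i *: map_mx (seval x) (cov_row (partial i) (Lev i) xi).
Proof.
move=> YE; rewrite /nabla (has_values_derive _ _ YE) eval_Gamma -YE mulmx_sumr -big_split.
by apply: eq_bigr => i _; rewrite /cov_row map_mxD map_mxM scalerDr scalemxAr.
Qed.

End Levi.
End Evaluation.

(** * The ambient metric in coordinates *)

Lemma posdef_unit (R : realFieldType) n (G : 'M[R]_n) :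
  (forall u : 'rV_n, u != 0 -> 0 < (u *m G *m u^T) 0 0) -> G \in unitmx.
Proof.
move=> pos; rewrite -row_free_unit; apply: inj_row_free => v vG.
by apply/eqP/negPn/negP => /pos; rewrite vG mul0mx mxE ltxx.
Qed.

Section Ambient.
Context {R : realType} {n : nat}.
Variables (U : openset R n) (H0 : 'rV[R]_n -> 'M[R]_n) (c : R).
Hypothesis H_smooth : forall i j, smooth_on U (fun y => H0 y i j).
Hypothesis H_sym : forall y, oset U y -> (H0 y)^T = H0 y.
Hypothesis H_pos : forall y, oset U y -> forall u, u != 0 -> 0 < inner (H0 y) u u.

Definition amb_metric : 'M[sfun U]_n := \matrix_(i, j) sfun_of (H_smooth i j).
Local Notation H := amb_metric.

Lemma amb_metricE : has_values H0 H.
Proof. by move=> x; apply/matrixP => i j; rewrite !mxE. Qed.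

Lemma amb_metric_sym : H^T = H.
Proof.
apply/matrixP => i j; apply: seval_inj => x; rewrite !mxE [LHS]seval_of [RHS]seval_of.
by rewrite -[in RHS](H_sym (svalP x)) mxE.
Qed.

(** The determinant of the metric has no zeros, since the metric is positive definite. *)
Lemma amb_inv_subproof : exists D : sfun U, \det H * D = 1.
Proof.
apply: nonvanishing_unit => x; rewrite -[seval x _]/((seval x : {rmorphism _ -> _}) _)
  -det_map_mx amb_metricE.
by rewrite -unitfE; apply: (posdef_unit (H_pos (svalP x))).
Qed.

Definition amb_inv : 'M[sfun U]_n := sval (cid amb_inv_subproof) *: \adj H.
Local Notation Hi := amb_inv.

Lemma amb_invE : Hi *m H = 1%:M.
Proof.
by rewrite /Hi -scalemxAl mul_adj_mx scale_scalar_mx mulrC (svalP (cid amb_inv_subproof)).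
Qed.

Definition amb_conn i := levi_civita (@partial R n U) H Hi (shalf U) i.
Local Notation Gam := amb_conn.
Local Notation partial := (@partial R n U).

Lemma amb_conn_sym i j : row j (Gam i) = row i (Gam j).
Proof. exact: levi_civita_sym amb_metric_sym i j. Qed.

Lemma amb_conn_metric i : map_mx (partial i) H = Gam i *m H + H *m (Gam i)^T.
Proof. exact: (levi_civita_metric partial (shalf2 U) amb_metric_sym amb_invE). Qed.

Lemma nabla_const w v : has_values (nabla H0 v (cst w))
  (\sum_j sconst U (v 0 j) *: (map_mx (sconst U) w *m Gam j)).
Proof.
have cE : has_values (cst w) (map_mx (sconst U) w).
  by move=> x; apply/matrixP => i j; rewrite !mxE.
move=> x; rewrite (eval_nabla amb_metricE amb_invE _ _ cE) raddf_sum.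
apply: eq_bigr => j _; rewrite /= map_mxZ; congr (_ *: map_mx _ _).
rewrite /cov_row (_ : map_mx _ (map_mx _ _) = 0) ?add0r //.
by apply/matrixP => a b; rewrite !mxE; exact: sderiv_const.
Qed.

Let Om x i j : 'M[R]_n := map_mx (seval x) (levi_civita_curv partial H Hi (shalf U) i j).

(** On constant vectors the two iterated covariant derivatives contribute the curvature
    of the connection matrices, contracted with [u] and [v]. *)
Lemma riemannE x u v w : riemann H0 (sval x) u v w = w *m curv_op (Om x) u v.
Proof.
have E a b : nabla H0 a (nabla H0 b (cst w)) (sval x) = \sum_i \sum_j (a 0 i * b 0 j) *:
    (w *m map_mx (seval x) (map_mx (partial i) (Gam j) + Gam j *m Gam i)).
  rewrite (eval_nabla amb_metricE amb_invE _ _ (nabla_const w b)).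
  apply: eq_bigr => i _; rewrite -/(Gam i).
  have -> : cov_row (partial i) (Gam i) (\sum_j sconst U (b 0 j) *: (map_mx (sconst U) w *m Gam
    j)) =
      \sum_j sconst U (b 0 j) *: (map_mx (sconst U) w *m (map_mx (partial i) (Gam j) + Gam j *m
        Gam i)).
    rewrite /cov_row raddf_sum mulmx_suml -big_split; apply: eq_bigr => j _ /=.
    rewrite map_derivZ; last exact: partialM.
    rewrite [partial i _]sderiv_const scale0r add0r map_derivM; last exact: partialM.
    rewrite (_ : map_mx (partial i) (map_mx _ _) = 0); last first.
      by apply/matrixP => s t; rewrite !mxE; exact: sderiv_const.
    by rewrite mul0mx add0r -scalemxAl -mulmxA -scalerDr -mulmxDr.
  rewrite raddf_sum scaler_sumr; apply: eq_bigr => j _ /=.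
  rewrite map_mxZ map_mxM scalerA; congr ((_ * _) *: (_ *m _)).
  by apply/matrixP => s t; rewrite !mxE.
rewrite /riemann !E [X in _ - X]exchange_big -sumrB mulmx_sumr; apply: eq_bigr => i _.
rewrite -sumrB mulmx_sumr; apply: eq_bigr => j _.
rewrite (mulrC (v 0 j)) -scalerBr -mulmxBr -scalemxAr; congr (_ *: (_ *m _)).
rewrite /Om /levi_civita_curv -map_mxB -/(Gam i) -/(Gam j); congr map_mx.
by move: (map_mx (partial i) _) (map_mx (partial j) _) => s t; abel.
Qed.

Hypothesis sec : forall y, oset U y -> forall u v, row_free (col_mx u v) -> sectional H0 y u v
  = c.

(** Pointwise this is [constant_curvature_tensor]. *)
Lemma amb_curvature i j : map_mx (partial i) (Gam j) - map_mx (partial j) (Gam i) +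
  Gam j *m Gam i - Gam i *m Gam j = sconst U c *: (H *m (delta_mx j i - delta_mx i j)).
Proof.
suff E x : map_mx (seval x) (levi_civita_curv partial H Hi (shalf U) i j) =
    map_mx (seval x) (sconst U c *: (H *m (delta_mx j i - delta_mx i j))).
  by apply/matrixP => a b; apply: seval_inj => x; have /matrixP/(_ a b) := E x; rewrite !mxE.
have -> : map_mx (seval x) (sconst U c *: (H *m (delta_mx j i - delta_mx i j))) =
    c *: (H0 (sval x) *m (delta_mx j i - delta_mx i j)).
  by rewrite map_mxZ map_mxM map_mxB !map_delta_mx amb_metricE.
apply: (@constant_curvature_tensor R n (H0 (sval x)) (Om x)).
- exact: H_sym (svalP x).
- exact: H_pos (svalP x).
- by move=> a b; rewrite /Om levi_civita_curv_anti map_mxN.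
- move=> a b; rewrite /Om -amb_metricE map_trmx -!map_mxM -map_mxD.
  rewrite (levi_civita_curv_skew (shalf2 U) amb_metric_sym amb_invE (@partialM _ _ U)
    (@partial_comm _ _ U)).
  exact: map_mx0.
- move=> a b k; rewrite /Om -!map_row -!map_mxD.
  by rewrite (levi_civita_bianchi partial Hi (shalf U) amb_metric_sym) map_mx0.
- by move=> u v uv; rewrite -(sec (svalP x) uv) /sectional riemannE.
Qed.

End Ambient.

(** * A hypersurface in coordinates *)

(** An immersion [F] of an open set [W] into an open set [U] of constant curvature [c],
    with an orthonormal frame [e0].  All data become matrices over the ring of smooth
    functions on [W], and the definitions in coordinates are the values of the
    corresponding constructions. *)
Section LocalHypersurface.
Context {R : realType} {m : nat}.
Variables (W : openset R m) (U : openset R m.+1).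
Variables (G0 : 'rV[R]_m -> 'M[R]_m) (H0 : 'rV[R]_m.+1 -> 'M[R]_m.+1)
  (F : 'rV[R]_m -> 'rV[R]_m.+1) (e0 : 'I_m -> 'rV[R]_m -> 'rV[R]_m) (c : R).
Hypothesis H_smooth : forall i j, smooth_on U (fun y => H0 y i j).
Hypothesis H_sym : forall y, oset U y -> (H0 y)^T = H0 y.
Hypothesis H_pos : forall y, oset U y -> forall u, u != 0 -> 0 < inner (H0 y) u u.
Hypothesis sec : forall y, oset U y -> forall u v, row_free (col_mx u v) -> sectional H0 y u v
  = c.
Hypothesis FU : forall x, oset W x -> oset U (F x).
Hypothesis sF : smooth_on W F.
Hypothesis isom : forall x, oset W x -> forall u v,
  inner (G0 x) u v = inner (H0 (F x)) ('d F x u) ('d F x v).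
Hypothesis frame : orthonormal_frame G0 W e0.

Local Notation A := (sfun W).
Local Notation phi := (pullback FU sF : {rmorphism sfun U -> sfun W}).
Local Notation partial := (@partial R m W).
Local Notation amb := (amb_conn H_smooth H_pos).

Definition loc_metric : 'M[A]_m.+1 := map_mx phi (amb_metric H_smooth).
Definition loc_jac : 'M[A]_(m, m.+1) := pull_jac partial (coordinate sF).
Definition loc_conn a : 'M[A]_m.+1 := pull_conn phi partial (coordinate sF) amb a.
Local Notation H := loc_metric.
Local Notation T := loc_jac.
Local Notation C := loc_conn.
(** The induced metric; it is expressed through the Jacobian of [F], which makes it smooth. *)
Definition loc_gram : 'M[A]_m := T *m H *m T^T.
Local Notation G := loc_gram.

Let frame_smooth i j : smooth_on W (fun x => e0 i x 0 j).
Proof. by move=> k; apply: Ck_on_coord (frame.1 i k); exact: osetP. Qed.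

Definition loc_frame : 'M[A]_m := \matrix_(i, j) sfun_of (frame_smooth i j).
Local Notation e := loc_frame.

Lemma loc_metricE : has_values (fun x => H0 (F x)) H.
Proof.
move=> x; rewrite -[RHS](amb_metricE H_smooth (point_map FU x)).
by apply/matrixP => i j; rewrite !mxE seval_pullback.
Qed.

Lemma loc_jacE x v : v *m map_mx (seval x) T = 'd F (sval x) v.
Proof.
have dF := smooth_differentiable sF (svalP x).
rewrite -deriveE // derive_delta //; apply/rowP => l.
rewrite mxE summxE; apply: eq_bigr => a _; rewrite !mxE -derive_coord //; congr (_ * _).
exact: (@seval_sderiv _ _ _ _ (coordinate sF l) (fun y => F y 0 l)).
Qed.

Lemma loc_gramE : has_values G0 G.
Proof.
move=> x; have E u v : inner (map_mx (seval x) G) u v = inner (G0 (sval x)) u v.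
  rewrite (isom (svalP x)) -!loc_jacE /inner -loc_metricE /loc_gram !map_mxM -map_trmx.
  by rewrite trmx_mul !mulmxA.
apply/matrixP => i j; have := E (delta_mx 0 i) (delta_mx 0 j).
have dE (M : 'M[R]_m) : inner M (delta_mx 0 i) (delta_mx 0 j) = M i j.
  by rewrite /inner -rowE trmx_delta -colE !mxE.
by rewrite !dE.
Qed.

Lemma loc_frameE i : has_values (e0 i) (row i e).
Proof. by move=> x; apply/rowP => j; rewrite !mxE. Qed.

Lemma loc_orthonormal : e *m G *m e^T = 1%:M.
Proof.
apply/matrixP => i j; apply: seval_inj => x.
have := frame.2 (sval x) (svalP x) i j.
rewrite /inner -!loc_frameE -loc_gramE !map_trmx -!map_mxM mxE.
have -> : (row i e *m G *m (row j e)^T) 0 0 = (e *m G *m e^T) i j.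
  rewrite -row_mul; move: (e *m G) e => M N; rewrite !mxE.
  by apply: eq_bigr => k _; rewrite !mxE.
by move=> ->; rewrite mxE rmorph_nat.
Qed.

(** In terms of an orthonormal frame the inverse of the metric is a polynomial. *)
Definition loc_gram_inv : 'M[A]_m := e^T *m e.
Local Notation Gi := loc_gram_inv.

Lemma loc_gram_invE : Gi *m G = 1%:M.
Proof. by rewrite /Gi -mulmxA; apply: mulmx1C; exact: loc_orthonormal. Qed.

Definition loc_levi a : 'M[A]_m := levi_civita partial G Gi (shalf W) a.
Local Notation Gam := loc_levi.

Lemma loc_metric_sym : H^T = H.
Proof. by rewrite /H map_trmx amb_metric_sym. Qed.

Lemma loc_compat a : map_mx (partial a) H = C a *m H + H *m (C a)^T.
Proof.
apply: (pull_metric _ (amb_conn_metric H_smooth H_sym H_pos)) => b f.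
exact: pullback_chain.
Qed.

Lemma loc_torsion a b : row b (cov_row (partial a) (C a) T) = row a (cov_row (partial b) (C b) T).
Proof. exact: (pull_torsion _ (@partial_comm _ _ W) _ (amb_conn_sym H_smooth H_sym H_pos)). Qed.

Lemma loc_curvature a b :
  map_mx (partial a) (C b) - map_mx (partial b) (C a) + C b *m C a - C a *m C b =
  phi (sconst U c) *: (H *m ((row b T)^T *m row a T - (row a T)^T *m row b T)).
Proof.
apply: (pull_curvature (@partialM _ _ W) (@partial_comm _ _ W)
  _ (amb_curvature H_smooth H_sym H_pos sec)) => a' f.
exact: pullback_chain.
Qed.

Lemma loc_const a : partial a (phi (sconst U c)) = 0.
Proof.
rewrite [LHS](pullback_chain FU sF) big1 // => l _.
by rewrite sderiv_const raddf0 mulr0.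
Qed.

Lemma loc_tangent a : cov_row (partial a) (C a) T *m H *m T^T = Gam a *m G.
Proof.
exact: (koszul (@partialM _ _ W) (shalf2 W) loc_metric_sym loc_compat loc_torsion loc_gram_invE).
Qed.

Lemma loc_connE x a : map_mx (seval x) (C a) =
  \sum_l seval x (T a l) *: map_mx (seval (point_map FU x)) (amb l).
Proof.
rewrite /C /loc_conn /pull_conn raddf_sum; apply: eq_bigr => l _.
rewrite /= map_mxZ; congr (_ *: _); move: (amb l) => M.
by apply/matrixP => i j; rewrite !mxE; exact: seval_pullback.
Qed.

Lemma pull_nablaE x u (xi : 'rV[R]_m -> 'rV[R]_m.+1) (xi' : 'rV[A]_m.+1) : has_values xi xi' ->
  pull_nabla H0 F u xi (sval x) =
  \sum_a u 0 a *: map_mx (seval x) (cov_row (partial a) (C a) xi').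
Proof.
move=> xiE; rewrite /pull_nabla (has_values_derive _ _ xiE).
have := eval_Gamma (amb_metricE H_smooth) (amb_invE H_smooth H_pos) (point_map FU x) ('d F
  (sval x) u) (xi (sval x)).
rewrite /= => ->; rewrite -xiE.
have -> : \sum_i ('d F (sval x) u) 0 i *: map_mx (seval (point_map FU x))
    (amb i) =
    \sum_a u 0 a *: map_mx (seval x) (C a).
  under [RHS]eq_bigr do rewrite loc_connE scaler_sumr.
  rewrite exchange_big; apply: eq_bigr => l _ /=.
  rewrite -loc_jacE mxE scaler_suml; apply: eq_bigr => a _.
  by rewrite mxE scalerA.
rewrite mulmx_sumr -big_split; apply: eq_bigr => a _ /=.
by rewrite /cov_row map_mxD map_mxM scalerDr scalemxAr.
Qed.

Lemma loc_nablaE x u (Y : 'rV[R]_m -> 'rV[R]_m) (Y' : 'rV[A]_m) : has_values Y Y' ->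
  nabla G0 u Y (sval x) = \sum_a u 0 a *: map_mx (seval x) (cov_row (partial a) (Gam a) Y').
Proof. exact: (eval_nabla loc_gramE loc_gram_invE). Qed.

Lemma has_values_diff (Y : 'rV[R]_m -> 'rV[R]_m) (Y' : 'rV[A]_m) : has_values Y Y' ->
  has_values (fun y => 'd F y (Y y)) (Y' *m T).
Proof. by move=> YE x; rewrite map_mxM YE loc_jacE. Qed.

Lemma second_formE x (X Y : 'rV[R]_m -> 'rV[R]_m) (Y' : 'rV[A]_m) : has_values Y Y' ->
  second_form G0 H0 F X Y (sval x) =
  \sum_a X (sval x) 0 a *: map_mx (seval x)
     (cov_row (partial a) (C a) (Y' *m T) - cov_row (partial a) (Gam a) Y' *m T).
Proof.
move=> YE; rewrite /second_form (pull_nablaE _ _ (has_values_diff YE)) (loc_nablaE _ _ YE).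
rewrite -loc_jacE mulmx_suml -sumrB; apply: eq_bigr => a _.
by rewrite map_mxB map_mxM scalerBr -scalemxAl.
Qed.

Local Notation d := (frame_d partial e).
Local Notation tau := (coord_tension partial C T Gam e).
Local Notation form := (coord_form partial C T Gam e).

Lemma row_cov_row a n' (w : 'M[A]_n') q i (M : 'M[A]_(q, n')) :
  row i (cov_row (partial a) w M) = cov_row (partial a) w (row i M).
Proof. by rewrite /cov_row linearD /= row_mul map_row. Qed.

Lemma frame_entry x i a : e0 i (sval x) 0 a = seval x (e i a).
Proof. by rewrite -loc_frameE [LHS]mxE [X in seval x X]mxE. Qed.

Lemma frame_second_formE x i j :
  second_form G0 H0 F (e0 i) (e0 j) (sval x) = map_mx (seval x) (row j (form i)).
Proof.
rewrite (second_formE _ _ (loc_frameE j)) /coord_form /coord_nabla !cov_row_frame.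
rewrite mulmx_suml -sumrB !raddf_sum; apply: eq_bigr => a _ /=.
rewrite frame_entry -scalemxAl -scalerBr linearZ linearB /= row_mul !row_cov_row row_mul.
by rewrite map_mxZ.
Qed.

Lemma tensionE : has_values (tension G0 H0 F e0) tau.
Proof.
move=> x; rewrite /tension; under eq_bigr do rewrite frame_second_formE.
by rewrite raddf_sum.
Qed.

Lemma rough_laplacianE x (xi : 'rV[R]_m -> 'rV[R]_m.+1) (xi' : 'rV[A]_m.+1) : has_values xi xi' ->
  rough_laplacian G0 H0 F e0 xi (sval x) = - map_mx (seval x)
    (\sum_a (cov_row (d a) (frame_w e C a) (cov_row (d a) (frame_w e C a) xi') -
      \sum_b coord_nabla partial Gam e a a b *: cov_row (partial b) (C b) xi')).
Proof.
move=> xiE; rewrite /rough_laplacian; congr (- _); rewrite raddf_sum; apply: eq_bigr => a _.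
have D1 : has_values (fun y => pull_nabla H0 F (e0 a y) xi y) (cov_row (d a) (frame_w e C a) xi').
  move=> y; rewrite (pull_nablaE _ _ xiE) cov_row_frame raddf_sum; apply: eq_bigr => b _.
  by rewrite /= map_mxZ frame_entry.
rewrite (pull_nablaE _ _ D1) (pull_nablaE _ _ xiE) /= map_mxB; congr (_ - _).
  rewrite [in RHS]cov_row_frame raddf_sum; apply: eq_bigr => b _.
  by rewrite /= map_mxZ frame_entry.
rewrite raddf_sum; apply: eq_bigr => b _; rewrite /= map_mxZ; congr (_ *: _).
rewrite (loc_nablaE _ _ (loc_frameE a)) /coord_nabla cov_row_frame.
rewrite !summxE rmorph_sum; apply: eq_bigr => k _.
rewrite frame_entry -row_cov_row.
move: (cov_row _ _ e) => M.
by rewrite !mxE rmorphM.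
Qed.

Let B a := cov_row (partial a) (C a) T - Gam a *m T.

(** The second fundamental form paired with the tension field, in coordinates; by
    [loc_formE] it is [tension_form] up to the change to the frame. *)
Definition loc_form : 'M[A]_m := \matrix_(i, j) (row j (B i) *m H *m tau^T) 0 0.

Lemma coord_second_formE x i j :
  second_form G0 H0 F (cst (delta_mx 0 i)) (cst (delta_mx 0 j)) (sval x) =
  map_mx (seval x) (row j (B i)).
Proof.
have dE : has_values (cst (delta_mx 0 j)) (delta_mx 0 j : 'rV[A]_m).
  by move=> y; rewrite map_delta_mx.
rewrite (second_formE _ _ dE) (bigD1 i) //= big1 ?addr0 => [|a /negbTE ai]; last first.
  by rewrite mxE ai scale0r.
have e1 : cov_row (partial i) (C i) (delta_mx 0 j *m T) = row j (cov_row (partial i) (C i) T).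
  by rewrite -rowE -(row_cov_row i (C i) j T).
have e2 : cov_row (partial i) (Gam i) (delta_mx 0 j) = row j (Gam i).
  rewrite /cov_row -rowE (_ : map_mx _ _ = 0) ?add0r //.
  by apply/rowP => k; rewrite !mxE raddfMn (deriv1 (@partialM _ _ W i)) mul0rn.
by rewrite mxE !eqxx scale1r e1 e2 /B linearB /= row_mul.
Qed.

(** In the frame, the shape operator for a multiple of the tension field is a multiple of
    [loc_form] followed by raising an index. *)
Lemma shape_operatorE x r :
  shape_operator G0 H0 F (sval x) (r *: map_mx (seval x) tau) =
  r *: (map_mx (seval x) loc_form *m (map_mx (seval x) e)^T *m map_mx (seval x) e).
Proof.
rewrite /shape_operator -(eval_metric_inv loc_gramE loc_gram_invE) /loc_gram_inv map_mxM
  -map_trmx mulmxA.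
rewrite !scalemxAl; congr (_ *m _ *m _); apply/matrixP => i j.
rewrite mxE coord_second_formE /inner linearZ /= -scalemxAr mxE -(loc_metricE x).
rewrite map_trmx -!map_mxM [RHS]mxE; congr (_ * _).
by rewrite mxE [RHS]mxE [X in _ = seval x X]mxE.
Qed.

Local Notation L := (tension_form partial C H T Gam e).

Lemma loc_formE : L = e *m loc_form *m e^T.
Proof.
have rowE a : (row a L)^T = e *m \sum_b e a b *: (B b *m H *m tau^T).
  rewrite (frame_formE (@partialM _ _ W) e loc_metric_sym (erefl G) loc_tangent).
  rewrite (coord_formE (@partialM _ _ W)) -!mulmxA mulmx_suml; congr (_ *m _).
  by apply: eq_bigr => b _; rewrite -scalemxAl !mulmxA.
apply/row_matrixP => a; apply: trmx_inj; rewrite rowE row_mul trmx_mul trmxK; congr (_ *m _).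
apply/matrixP => k z; rewrite ord1 summxE [RHS]mxE [RHS]mxE [RHS]mxE.
apply: eq_bigr => b _; rewrite mxE; congr (_ * _).
by rewrite [RHS]mxE -!row_mul [RHS]mxE.
Qed.

Hypothesis two_curv : forall x, oset W x -> forall eta, unit_normal H0 F x eta ->
  exists k1 k2 : R, forall a, eigenvalue (shape_operator G0 H0 F x eta) a -> a = k1 \/ a = k2.
Local Notation Q := (tension_sq partial C H T Gam e).
Local Notation q := (tension_grad partial C H T Gam e).
Hypothesis lap0 : forall x, oset W x ->
  rough_laplacian G0 H0 F e0 (tension G0 H0 F e0) x = 0.
Hypothesis tau_neq0 : forall x, oset W x -> tension G0 H0 F e0 x != 0.

Lemma loc_laplacian : \sum_a (cov_row (d a) (frame_w e C a) (cov_row (d a) (frame_w e C a) tau) -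
  \sum_b coord_nabla partial Gam e a a b *: cov_row (partial b) (C b) tau) = 0.
Proof.
apply/rowP => k; apply: seval_inj => x; have := rough_laplacianE x tensionE.
rewrite (lap0 (svalP x)) => /eqP; rewrite eq_sym oppr_eq0 => /eqP/rowP/(_ k).
by rewrite [LHS]mxE => ->; rewrite !mxE rmorph0.
Qed.

Lemma tension_sqE x : seval x Q = inner (H0 (F (sval x))) (tension G0 H0 F e0 (sval x))
  (tension G0 H0 F e0 (sval x)).
Proof.
rewrite /inner -tensionE -(loc_metricE x) map_trmx -!map_mxM [RHS]mxE //.
Qed.

Lemma tension_sq_gt0 x : 0 < seval x Q.
Proof.
rewrite tension_sqE; apply: H_pos; first exact: FU (svalP x).
exact: tau_neq0 (svalP x).
Qed.

Lemma tension_sq_inv : exists Qi, Q * Qi = 1.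
Proof. by apply: nonvanishing_unit => x; rewrite lt0r_neq0 // tension_sq_gt0. Qed.

(** The hypothesis on the principal curvatures is applied to the unit normal
    [tau / |tau|], whose shape operator is conjugate to [L / |tau|]. *)
Lemma loc_quad (x : opoint W) : map_mx (seval x) q != 0 ->
  map_mx (seval x) ((2 *: L + Q%:M) *m
  ((m.+2%:R * Q) *: L - (2 * \tr (L *m L) + Q ^+ 2)%:M)) = 0.
Proof.
move=> qx0; have [Qi QQi] := tension_sq_inv; have Q0 := tension_sq_gt0 x.
pose r := (Num.sqrt (seval x Q))^-1.
have r0 : 0 < r by rewrite invr_gt0 sqrtr_gt0.
have rr : r * r * seval x Q = 1.
  by rewrite -[X in _ * X](sqr_sqrtr (ltW Q0)) /r expr2; field; rewrite lt0r_neq0 // sqrtr_gt0.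
pose eta := r *: map_mx (seval x) tau.
have eta_normal : unit_normal H0 F (sval x) eta.
  split.
    rewrite /inner /eta -(loc_metricE x) linearZ /= -scalemxAr -!scalemxAl scalerA mxE.
    by rewrite map_trmx -!map_mxM mxE.
  move=> u; rewrite /inner -loc_jacE -(loc_metricE x) trmx_mul /eta -!scalemxAl mulmxA map_trmx.
  rewrite -!map_mxM (tension_normal (@partialM _ _ W) e (erefl G) loc_tangent) map_mx0 mul0mx
    scaler0.
  by rewrite mxE.
have [k1 [k2 kE]] := two_curv (svalP x) eta_normal.
have eig a : eigenvalue (map_mx (seval x) L) a -> a = k1 / r \/ a = k2 / r.
  move=> /eigenvalueP[v vL v0].
  suff /kE[<-|<-] : eigenvalue (shape_operator G0 H0 F (sval x) eta) (a * r).
    - by left; rewrite mulfK // lt0r_neq0.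
    - by right; rewrite mulfK // lt0r_neq0.
  apply/eigenvalueP; exists (v *m map_mx (seval x) e).
    rewrite shape_operatorE -scalemxAr !mulmxA.
    have -> : v *m map_mx (seval x) e *m map_mx (seval x) loc_form *m (map_mx (seval x) e)^T =
      a *: v.
      by rewrite -vL loc_formE !map_mxM -map_trmx !mulmxA.
    by rewrite -scalemxAl scalerA mulrC.
  apply: contraNneq v0 => ve0.
  have /(congr1 (map_mx (seval x))) := loc_orthonormal; rewrite map_mx1 !map_mxM -map_trmx => E.
  by rewrite -[v]mulmx1 -E !mulmxA ve0 !mul0mx.
have Lsym : L^T = L.
  exact: (tension_form_sym (@partialM _ _ W) loc_metric_sym loc_torsion (erefl G) loc_tangent
    loc_orthonormal).
have Ltr : \tr L = Q.
  exact: (tension_form_tr (@partialM _ _ W) e loc_metric_sym (erefl G) loc_tangent).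
have Ltan : 2 *: (q *m L) = - Q *: q.
  exact: (tension_tangent (@partialM _ _ W) (@partial_comm _ _ W) loc_metric_sym loc_compat
    loc_torsion
   loc_curvature (erefl G) loc_tangent loc_orthonormal QQi loc_laplacian).
rewrite map_mxM map_mxD map_mxB !map_mxZ !map_scalar_mx.
rewrite !(rmorph_nat (seval x), rmorphM (seval x), rmorphXn (seval x), rmorphD (seval x)).
rewrite -trace_map_mx map_mxM.
apply: (two_curvatures_quad Q0 qx0 _ _ _ eig).
- by rewrite map_trmx Lsym.
- by rewrite trace_map_mx Ltr.
- have := congr1 (map_mx (seval x)) Ltan.
  by rewrite !map_mxZ map_mxM (rmorph_nat (seval x)) (rmorphN (seval x)).
Qed.

Lemma tension_grad_neq0 : opoint W -> q <> 0.
Proof.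
have [Qi QQi] := tension_sq_inv.
move=> x0; have K := (tension_not_constant (ev := fun x => seval x) (@partialM _ _ W)
  loc_metric_sym
  loc_compat loc_torsion (erefl G) loc_tangent loc_orthonormal QQi tension_sq_gt0
  loc_laplacian x0).
exact: K.
Qed.

Lemma tension_grad_vanishes : opoint W -> ~ (forall x, map_mx (seval x) q != 0).
Proof.
move=> x0 qx; have [Qi QQi] := tension_sq_inv.
have quad : (2 *: L + Q%:M) *m
  ((m.+2%:R * Q) *: L - (2 * \tr (L *m L) + Q ^+ 2)%:M) = 0.
  apply/matrixP => i j; apply: seval_inj => x; have /matrixP/(_ i j) := loc_quad (qx x).
  by move: (_ *m _) => M; rewrite !mxE rmorph0.
apply: (tension_not_regular (@seval_inj _ _ W) (@partialM _ _ W) (@partial_comm _ _ W)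
  loc_const loc_metric_sym
  loc_compat loc_torsion loc_curvature (erefl G) loc_tangent loc_orthonormal QQi tension_sq_gt0
  loc_laplacian quad x0) => x.
have E : seval x ((q *m q^T) 0 0) = (map_mx (seval x) q *m (map_mx (seval x) q)^T) 0 0.
  by rewrite map_trmx -map_mxM [RHS]mxE.
rewrite -[X in X != 0]/(seval x ((q *m q^T) 0 0)) E.
by apply: contra_neq (qx x) => /dot_eq0.
Qed.

Lemma tension_gradE x a : seval x (q 0 a) =
  'D_(e0 a (sval x)) (fun y => inner (H0 (F y)) (tension G0 H0 F e0 y) (tension G0 H0 F e0 y))
    (sval x).
Proof.
have QE y : seval y Q = inner (H0 (F (sval y))) (tension G0 H0 F e0 (sval y)) (tension G0 H0 F
  e0 (sval y)).
  exact: tension_sqE.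
rewrite -(seval_sderiv _ _ QE) [q 0 a]mxE [RHS]derive_delta; last first.
  exact: (smooth_differentiable (sfun_rep_smooth _) (svalP x)).
rewrite rmorph_sum; apply: eq_bigr => b _; rewrite rmorphM frame_entry //.
Qed.

Lemma tension_eq0_laplacian : (forall x, oset W x -> tension G0 H0 F e0 x = 0) ->
  forall x, oset W x -> rough_laplacian G0 H0 F e0 (tension G0 H0 F e0) x = 0.
Proof.
move=> t0 x Wx; have z : has_values (tension G0 H0 F e0) (0 : 'rV[A]_m.+1).
  by move=> y; rewrite map_mx0 t0 //; exact: svalP y.
have cov_row0 (f : {additive A -> A}) w : cov_row f w (0 : 'rV[A]_m.+1) = 0.
  by rewrite /cov_row map_mx0 mul0mx addr0.
rewrite (rough_laplacianE (exist _ x Wx) z) big1 ?map_mx0 ?oppr0 // => a _.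
rewrite !cov_row0 big1 ?subr0 // => b _.
by rewrite cov_row0 scaler0.
Qed.

End LocalHypersurface.

(** * H-tensional hypersurfaces are minimal *)

Lemma smooth_on_subset (R : realType) n (V : normedModType R) (A B : set 'rV[R]_n)
    (f : 'rV[R]_n -> V) : A `<=` B -> smooth_on B f -> smooth_on A f.
Proof.
move=> AB sf k; move: (sf k); elim: k f {sf} => [|k IH] f.
  by move=> h x /AB; exact: h.
by move=> [df Df]; split=> [x /AB|v]; [exact: df|exact/IH/Df].
Qed.

Lemma open_nonzero (R : realType) n (W : openset R n) (g : sfun W) (f : 'rV[R]_n -> R) :
  (forall x, seval x g = f (sval x)) -> open [set x | oset W x /\ f x != 0].
Proof.
move=> gE; rewrite openE => x [Wx fx0]; rewrite /interior.
have cg : sfun_rep g y @[y --> x] --> sfun_rep g x by exact: (sfun_rep_smooth g 0%N x Wx).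
have gx : sfun_rep g x != 0 by rewrite (sfun_repE g (exist _ x Wx)) gE.
have Wn : \forall y \near x, oset W y by apply: open_nbhs_nbhs; split=> //; exact: osetP.
have gn : \forall y \near x, sfun_rep g y != 0.
  by apply: (cg [set z | z != 0]); apply: open_nbhs_nbhs; split => //; exact: open_neq.
by apply: filterS2 Wn gn => y Wy gy; split; rewrite // -(gE (exist _ y Wy)) -sfun_repE.
Qed.

Section Hypersurface.
Context {R : realType} {m : nat}.
Variables (c : R) (V : openset R m.+1) (G0 : 'rV[R]_m -> 'M[R]_m)
  (H0 : 'rV[R]_m.+1 -> 'M[R]_m.+1) (F : 'rV[R]_m -> 'rV[R]_m.+1)
  (e0 : 'I_m -> 'rV[R]_m -> 'rV[R]_m) (U : set 'rV[R]_m).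
Hypothesis H_smooth : forall i j, smooth_on V (fun y => H0 y i j).
Hypothesis H_sym : forall y, oset V y -> (H0 y)^T = H0 y.
Hypothesis H_pos : forall y, oset V y -> forall u, u != 0 -> 0 < inner (H0 y) u u.
Hypothesis sec : forall y, oset V y -> forall u v, row_free (col_mx u v) -> sectional H0 y u v
  = c.
Hypothesis oU : open U.
Hypothesis FU : forall x, U x -> oset V (F x).
Hypothesis sF : smooth_on U F.
Hypothesis isom : forall x, U x -> forall u v,
  inner (G0 x) u v = inner (H0 (F x)) ('d F x u) ('d F x v).
Hypothesis frame : orthonormal_frame G0 U e0.

Lemma tension0_rough_laplacian0 : (forall x, U x -> tension G0 H0 F e0 x = 0) ->
  forall x, U x -> rough_laplacian G0 H0 F e0 (tension G0 H0 F e0) x = 0.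
Proof. exact: (@tension_eq0_laplacian R m (OpenSet oU) V G0 H0 F e0 H_smooth H_pos FU sF isom
  frame). Qed.

Hypothesis two_curv : forall x, U x -> forall eta, unit_normal H0 F x eta ->
  exists k1 k2 : R, forall a, eigenvalue (shape_operator G0 H0 F x eta) a -> a = k1 \/ a = k2.
Hypothesis lap0 : forall x, U x ->
  rough_laplacian G0 H0 F e0 (tension G0 H0 F e0) x = 0.

Let Qf x := inner (H0 (F x)) (tension G0 H0 F e0 x) (tension G0 H0 F e0 x).

(** If the tension field is nonzero somewhere, it is so on an open set [W1].  There its
    squared length cannot be constant, so some derivative along the frame is nonzero at
    a point, hence on an open subset [W2]; but by [tension_grad_vanishes] no such open
    set exists. *)
Lemma tension_eq0 x : U x -> tension G0 H0 F e0 x = 0.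
Proof.
move=> Ux; apply/eqP/negPn/negP => t0.
have sub_frame (W : set 'rV[R]_m) : W `<=` U -> orthonormal_frame G0 W e0.
  by move=> WU; split=> [i|y /WU]; [exact: smooth_on_subset WU (frame.1 i)|exact: frame.2].
have inner0 (y : 'rV[R]_m) : Qf y != 0 -> tension G0 H0 F e0 y != 0.
  by apply: contra_neq => h; rewrite /Qf h /inner !mul0mx mxE.
pose U0 := OpenSet oU.
have oW1 : open [set y | U y /\ Qf y != 0].
  by apply: (@open_nonzero R m U0);
    exact: (@tension_sqE R m U0 V G0 H0 F e0 H_smooth H_pos FU sF isom frame).
pose W1 := OpenSet oW1.
have WU1 : [set y | U y /\ Qf y != 0] `<=` U by move=> y [].
have fr1 := sub_frame _ WU1; have sF1 := smooth_on_subset WU1 sF.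
have FU1 y : oset W1 y -> oset V (F y) by move=> [Uy _]; exact: FU.
have is1 y : oset W1 y -> forall u v, inner (G0 y) u v = inner (H0 (F y)) ('d F y u) ('d F y v).
  by move=> [Uy _]; exact: isom.
have lap1 y : oset W1 y -> rough_laplacian G0 H0 F e0 (tension G0 H0 F e0) y = 0.
  by move=> [Uy _]; exact: lap0.
have tau1 y : oset W1 y -> tension G0 H0 F e0 y != 0 by move=> [_ /inner0].
have x1 : opoint W1.
  exists x; split=> //; rewrite lt0r_neq0 //; apply: H_pos => //; exact: FU.
apply: (@tension_grad_neq0 R m W1 V G0 H0 F e0 H_smooth H_sym H_pos FU1 sF1 is1 fr1 lap1 tau1 x1).
apply/rowP => a; rewrite [RHS]mxE; apply: seval_inj => y; rewrite [RHS](rmorph0 (seval y)).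
rewrite tension_gradE; last exact: is1.
have [->//|Dy0] := eqVneq ('D_(e0 a (sval y)) Qf (sval y)) 0; exfalso.
have oW2 : open [set y | oset W1 y /\ 'D_(e0 a y) Qf y != 0].
  apply: (@open_nonzero R m W1) => z.
  exact: (@tension_gradE R m W1 V G0 H0 F e0 H_smooth H_pos FU1 sF1 is1 fr1 z a).
pose W2 := OpenSet oW2.
have W21 : [set y | oset W1 y /\ 'D_(e0 a y) Qf y != 0] `<=` oset W1 by move=> z [].
have WU2 := subset_trans W21 WU1.
have fr2 := sub_frame _ WU2; have sF2 := smooth_on_subset WU2 sF.
have y2 : opoint W2 by exists (sval y); split=> //; exact: svalP.
apply: (@tension_grad_vanishes R m W2 V G0 H0 F e0 c H_smooth H_sym H_pos sec
  (fun z Wz => FU1 z (W21 z Wz)) sF2 (fun z Wz => is1 z (W21 z Wz)) fr2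
  (fun z Wz => two_curv (WU2 z Wz)) (fun z Wz => lap1 z (W21 z Wz))
  (fun z Wz => tau1 z (W21 z Wz)) y2) => z.
apply: contraTneq (svalP z).2 => /rowP/(_ a); rewrite mxE tension_gradE ?mxE => [Dz|];
  last by move=> w Ww; exact: is1 (W21 w Ww).
by rewrite /Qf Dz eqxx.
Qed.
End Hypersurface.

Theorem theorem5p7 (R : realType) (m : nat) (m_gt0 : (0 < m)%N) (c : R)
    (M : manifold R m) (g : riemannian_metric M)
    (N : manifold R m.+1) (h : riemannian_metric N) (iota : M -> N)
    (M_connected : connected [set: M])
    (h_const : constant_sectional_curvature h c)
    (iota_isom : isometric_immersion g h iota)
    (two_curv : at_most_two_principal_curvatures g h iota) :
  H_tensional g h iota <-> minimal g h iota.
Proof.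
(* in a pair of charts the immersion satisfies the hypotheses of the local results *)
have chart_facts phi psi U : atlas phi -> atlas psi -> U `<=` local_dom iota phi psi ->
    [/\ open (cran psi), forall x, U x -> cran psi (local_map iota phi psi x),
        smooth_on U (local_map iota phi psi) &
        forall x, U x -> forall u v, inner (gram g phi x) u v =
          inner (gram h psi (local_map iota phi psi x))
            ('d (local_map iota phi psi) x u) ('d (local_map iota phi psi) x v)].
  move=> aphi apsi Usub; have [_ /(_ _ _ aphi apsi)[sF Fisom]] := iota_isom.
  split.
  - by have [] := atlas_chart apsi.
  - move=> x /Usub[p [dp ip] <-]; have [_ _ K _ _] := atlas_chart aphi.
    by rewrite /local_map /= K //; exists (iota p).
  - exact: smooth_on_subset Usub sF.
  - by move=> x /Usub/Fisom[].
split=> Hyp phi psi aphi apsi U e oU Usub fr x Ux.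
  have [oV FU sF iso] := chart_facts phi psi U aphi apsi Usub.
  rewrite /mean_curvature (@tension_eq0 R m c (OpenSet oV) (gram g phi) (gram h psi)
    (local_map iota phi psi) e U (gram_smooth h apsi) (gram_sym h apsi) (gram_pos h apsi)
    (h_const _ apsi) oU FU sF iso fr _ _ x Ux) ?scaler0 //.
  - by move=> y Uy; exact: two_curv (Usub y Uy).
  - by move=> y Uy; exact: (Hyp _ _ aphi apsi U).
have [oV FU sF iso] := chart_facts phi psi U aphi apsi Usub.
apply: (@tension0_rough_laplacian0 R m (OpenSet oV) (gram g phi) (gram h psi)
  (local_map iota phi psi) e U (gram_smooth h apsi) (gram_pos h apsi) oU FU sF iso fr) => //.
move=> y Uy; have /eqP := Hyp _ _ aphi apsi _ _ oU Usub fr _ Uy.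
by rewrite scaler_eq0 invr_eq0 pnatr_eq0 -[_ == 0%N]/(m == 0%N) -leqn0 leqNgt m_gt0 => /eqP.
Qed.
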